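(* Let $h_{NL}:H^{-s}\to\mathbb{R}$ be a function in the Gross–Sobolev space $\mathbb{D}^{1,2}(\nu_0)$ with $\exp(-h_{NL})\in L^2(H^{-s},\nu_0)$. Let $$d\mu_0=\frac{e^{-h_{NL}}\,d\nu_0}{\int_{H^{-s}}e^{-h_{NL}}\,d\nu_0},\qquad \mu_t=(e^{itA})_\sharp\mu_0\quad(t\in\mathbb{R}),$$ and $v(t,u)=-ie^{itA}\nabla h_{NL}(e^{-itA}u)$ for $t\in\mathbb{R}$, $u\in H^{-s}$. Then for all $t\in\mathbb{R}$ and any $F\in\mathscr{C}^\infty_{b,cyl}(H^{-s})$, $$\frac{d}{dt}\int_{H^{-s}}F(u)\,\mu_t(du)=\int_{H^{-s}}\langle v(t,u),\nabla F(u)\rangle\,\mu_t(du).$$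
   Context: $(H,\|\cdot\|_H)$ is a complex Hilbert space and $A:D(A)\subset H\to H$ is a self-adjoint operator with compact resolvent such that $A\ge c\,\mathds{1}$ for some constant $c>0$. $\{e_k\}_{k\in\mathbb{N}}$ is an orthonormal basis of eigenvectors, $Ae_k=\lambda_ke_k$, and $s\ge0$ is such that $\sum_{k}\lambda_k^{-(s+1)}<+\infty$. For $r>0$: $H^r=(D(A^{r/2}),\|A^{r/2}\cdot\|_H)$, and $H^{-r}$ is the completion of $H$ for the norm $\|A^{-r/2}\cdot\|_H$. All these spaces are regarded as real Hilbert spaces, with $\langle u,w\rangle_{H^{-r}_{\mathbb{R}}}=\mathrm{Re}\langle u,A^{-r}w\rangle_H$. The unitary group $e^{itA}$ extends to isometries of $H^{-s}$. The bracket $\langle\cdot,\cdot\rangle$ without index is the duality bracket between $H^{-s}$ and $H^s$ extending $\mathrm{Re}\langle\cdot,\cdot\rangle_H$. $\nu_0$ is the unique centred Gaussian probability measure on $H^{-s}$ with $$\int_{H^{-s}}e^{i\langle u,\xi\rangle_{H^{-s}_{\mathbb{R}}}}\nu_0(du)=e^{-\frac12\langle\xi,A^{-(s+1)}\xi\rangle_{H^{-s}_{\mathbb{R}}}},\quad\forall\xi\in H^{-s}.$$ Let $\{f_j\}_{j\in\mathbb{N}}$ enumerate $\{e_k,ie_k:k\in\mathbb{N}\}$. $\mathscr{C}^\infty_{b,cyl}(H^{-s})$ (resp. $\mathscr{C}^\infty_{c,cyl}(H^{-s})$) is the set of $F(u)=\varphi(\langle u,f_1\rangle,\dots,\langle u,f_m\rangle)$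 with $m\in\mathbb{N}$ and $\varphi\in\mathscr{C}^\infty(\mathbb{R}^m)$ bounded together with all its derivatives (resp. $\varphi\in\mathscr{C}_c^\infty(\mathbb{R}^m)$); then $\nabla F(u)=\sum_{j=1}^m\partial_j\varphi(\langle u,f_1\rangle,\dots,\langle u,f_m\rangle)f_j$. The Malliavin derivative $\nabla$ is the closure of the operator $F\mapsto\nabla F$, from $\mathscr{C}^\infty_{c,cyl}(H^{-s})\subset L^2(H^{-s},\nu_0)$ to $L^2(H^{-s},\nu_0;H^{-s})$, and $\mathbb{D}^{1,2}(\nu_0)=\{F\in L^2(H^{-s},\nu_0):\nabla F\in L^2(H^{-s},\nu_0;H^{-s})\}$ is its domain. $\nabla h_{NL}$ denotes a fixed Borel representative defined on all of $H^{-s}$. *)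

(* Defs.v *)
From HB Require Import structures.
From mathcomp Require Import all_boot all_order all_algebra.
From mathcomp Require Export sesquilinear complex.
From mathcomp Require Import all_classical all_reals all_analysis.

Set Implicit Arguments.
Unset Strict Implicit.
Unset Printing Implicit Defensive.

Import Order.TTheory GRing.Theory Num.Theory.
Import numFieldNormedType.Exports.

Local Open Scope classical_set_scope.
Local Open Scope complex_scope.
Local Open Scope ring_scope.

Definition borel (T : ptopologicalType) := g_sigma_algebraType (@open T).

Definition cis (R : realType) (x : R) : R[i] := cos x +i* sin x.

(* [normedModType R[i]] has R[i]-valued norms. *)
Definition rnorm (R : realType) (V : normedModType R[i]) (x : V) : R :=
  complex.Re `|x|.

Definition complex_integral d (T : measurableType d) (R : realType)
    (mu : {measure set T -> \bar R}) (f : T -> R[i]) : R[i] :=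
  (\int[mu]_x complex.Re (f x)) +i* (\int[mu]_x complex.Im (f x)).

Section hilbert.
Context (R : realType) (H : completeNormedModType R[i]).

(* Inner products are linear in the first variable and antilinear in the
   second; a Hilbert space is a complete normed space whose norm comes from
   an inner product. *)
Definition inner_product_of_norm (dot : {dot H for Num.conj}) : Prop :=
  forall x, `|x| ^+ 2 = dot x x.

Definition real_dot (dot : {dot H for Num.conj}) (x y : H) : R :=
  complex.Re (dot x y).

Definition linear_operator (DA : set H) (A : H -> H) : Prop :=
  forall (a : R[i]) x y, DA x -> DA y ->
    DA (a *: x + y) /\ A (a *: x + y) = a *: A x + A y.

(* The last condition says that the graph of the adjoint of A is the graph
   of A, domains included. *)
Definition self_adjoint (dot : {dot H for Num.conj}) (DA : set H) (A : H -> H)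
    : Prop :=
  [/\ linear_operator DA A, dense DA &
      forall y z, (forall x, DA x -> dot (A x) y = dot x z) <->
                  (DA y /\ z = A y)].

Definition compact_operator (T : H -> H) : Prop :=
  compact (closure (T @` [set x | `|x| <= 1])).

Definition resolvent (DA : set H) (A : H -> H) (z : R[i]) (T : H -> H) : Prop :=
  (forall x, DA (T x) /\ A (T x) - z *: T x = x) /\
  (forall x, DA x -> T (A x - z *: x) = x).

Definition compact_resolvent (DA : set H) (A : H -> H) : Prop :=
  exists z T, resolvent DA A z T /\ compact_operator T.

Definition bounded_below (dot : {dot H for Num.conj}) (DA : set H) (A : H -> H)
    (c : R) : Prop :=
  forall x, DA x -> c%:C * dot x x <= dot (A x) x.

Definition orthonormal_basis (dot : {dot H for Num.conj}) (e : nat -> H) : Prop :=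
  (forall j k, dot (e j) (e k) = (j == k)%:R) /\
  (forall x, series (fun k => dot x (e k) *: e k) @ \oo --> x).

Definition eigenvectors (DA : set H) (A : H -> H) (e : nat -> H)
    (la : nat -> R) : Prop :=
  forall k, DA (e k) /\ A (e k) = (la k)%:C *: e k.

(* g(A), expanded in the orthonormal basis of eigenvectors; g must be bounded
   on the spectrum of A. *)
Definition functional_calculus (dot : {dot H for Num.conj}) (e : nat -> H)
    (la : nat -> R) (g : R -> R[i]) (x : H) : H :=
  limn (series (fun k => (g (la k) * dot x (e k)) *: e k)).

(* Only for p <= 0, where A^p is bounded because A >= c > 0. *)
Definition op_pow dot e la (p : R) : H -> H :=
  functional_calculus dot e la (fun l => (l `^ p)%:C).

Definition unitary_group dot e la (t : R) : H -> H :=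
  functional_calculus dot e la (fun l => cis (t * l)).

Definition enumerates (f : nat -> H) (e : nat -> H) : Prop :=
  injective f /\
  range f = range e `|` range (fun k => 'i *: e k).

End hilbert.

(* K is a completion of H for the norm |A^{-r/2} .|_H, with embedding iota. *)
Definition is_negative_space (R : realType) (H K : completeNormedModType R[i])
    (dot : {dot H for Num.conj}) (e : nat -> H) (la : nat -> R) (r : R)
    (iota : {linear H -> K}) : Prop :=
  dense (range iota) /\
  (forall x, `|iota x| = `|op_pow dot e la (- (r / 2)) x|).

(* Extension by continuity along the dense embedding iota. *)
Definition extend (R : realType) (H K : completeNormedModType R[i])
    (T : pnbhsType) (iota : {linear H -> K}) (g : H -> T) (u : K) : T :=
  lim (g @ filter_from (nbhs u) (fun B : set K => iota @^-1` B)).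

Section negative_space.
Context (R : realType) (H K : completeNormedModType R[i]).
Variables (dot : {dot H for Num.conj}) (e : nat -> H) (la : nat -> R).
Variable iota : {linear H -> K}.

Definition op_pow_ext (p : R) : K -> K :=
  extend iota (iota \o op_pow dot e la p).

Definition unitary_group_ext (t : R) : K -> K :=
  extend iota (iota \o unitary_group dot e la t).

(* The duality bracket between H^{-s} and H^s; only meaningful for w in H^s,
   seen as a subspace of H. *)
Definition bracket (u : K) (w : H) : R :=
  extend iota (fun x => real_dot dot x w : R^o) u.

Definition cyl_coord (f : nat -> H) (m : nat) (u : K) : 'rV[R]_m :=
  \row_(j < m) bracket u (f j).

Definition cyl (f : nat -> H) (m : nat) (phi : 'rV[R]_m -> R) (u : K) : R :=
  phi (cyl_coord f m u).

Definition cyl_grad (f : nat -> H) (m : nat) (phi : 'rV[R]_m -> R) (u : K) : H :=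
  \sum_(j < m)
    ('D_(delta_mx 0 j) (phi : _ -> R^o) (cyl_coord f m u) : R)%:C *: f j.

End negative_space.

Section smooth.
Context (R : realType) (m : nat).
Implicit Type phi : 'rV[R]_m -> R.

Definition iter_partial phi (js : seq 'I_m) : 'rV[R]_m -> R :=
  foldr (fun j (g : 'rV[R]_m -> R) x =>
           'D_(delta_mx 0 j) (g : _ -> R^o) x) phi js.

Definition smooth phi : Prop :=
  forall js, continuous (iter_partial phi js : _ -> R^o) /\
    forall j x, derivable (iter_partial phi js : _ -> R^o) x (delta_mx 0 j).

Definition smooth_bounded phi : Prop :=
  smooth phi /\
  forall js, exists M, forall x, `|iter_partial phi js x| <= M.

Definition smooth_compact phi : Prop :=
  smooth phi /\ compact (closure [set x | phi x != 0]).

End smooth.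

Section gaussian.
Context (R : realType) (K : completeNormedModType R[i]).
Variable dotK : {dot K for Num.conj}.

(* The library's [normal_prob 0 0] is not the Dirac mass at 0. *)
Definition centred_normal (sigma : R) (B : set R) : \bar R :=
  if sigma == 0 then \d_(0 : R) B else normal_prob 0 sigma B.

Definition centred_gaussian (nu : probability (borel K) R) : Prop :=
  forall xi : K, exists2 sigma : R, 0 <= sigma &
    forall B : set (measurableTypeR R), measurable B ->
      nu ((fun u => real_dot dotK u xi) @^-1` B) = centred_normal sigma B.

Definition has_covariance (nu : probability (borel K) R) (Q : K -> K) : Prop :=
  forall xi : K,
    complex_integral nu (fun u => cis (real_dot dotK u xi)) =
    (expR (- (real_dot dotK xi (Q xi) / 2)))%:C.

End gaussian.

(* (h, G) lies in the closure, in L^2(nu) x L^2(nu; K), of the graph of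
   F |-> nabla F on the smooth compactly supported cylindrical functions. *)
Definition malliavin_derivative (R : realType)
    (H K : completeNormedModType R[i]) (dot : {dot H for Num.conj})
    (iota : {linear H -> K}) (f : nat -> H) (nu : probability (borel K) R)
    (h : K -> R) (G : K -> K) : Prop :=
  [/\ (h : borel K -> R) \in Lfun nu 2%:E,
      measurable_fun setT (G : borel K -> borel K),
      (fun u : borel K => rnorm (G u)) \in Lfun nu 2%:E &
      forall eps : R, 0 < eps ->
        exists m (phi : 'rV[R]_m -> R),
          [/\ smooth_compact phi,
              (Lnorm nu 2%:E (fun u : borel K =>
                 (h u - cyl dot iota f phi u)%:E) < eps%:E)%E &
              (Lnorm nu 2%:E (fun u : borel K =>
                 (rnorm (G u - iota (cyl_grad dot iota f phi u)))%:E)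
                 < eps%:E)%E]].

(* Main.v *)
Require Import Defs.
From HB Require Import structures.
From mathcomp Require Import all_boot all_order all_algebra.
From mathcomp Require Import sesquilinear complex.
From mathcomp Require Import all_classical all_reals all_analysis.
From mathcomp Require Import measurable_realfun.
From mathcomp Require Import ring lra.
Import Order.TTheory GRing.Theory Num.Theory.
Import numFieldNormedType.Exports.
Set Implicit Arguments.
Unset Strict Implicit.
Unset Printing Implicit Defensive.
Local Open Scope classical_set_scope.
Local Open Scope complex_scope.
Local Open Scope ring_scope.

(** The identity is a Gaussian integration by parts in which the quadratic part
    of the energy drops out by antisymmetry.

    Write [coord c k u] for the bracket of [u] with [c *: e k].  Under [nu0],
    finitely many of these form a centred Gaussian vector, the covariance of
    [coord c k] and [coord c' k'] being [Re (c * conj c') / la k] when [k = k'],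
    and [0] otherwise ([coord_gaussian_vector]).  Each [f j] is [c j *: e (k j)]
    with [c j] equal to [1] or ['i], and [exp (i r A)] turns [coord c k] into
    [coord (cis (- r * la k) * c) k].  Hence, up to the normalizing constant, the
    integral of [F] under [mu r] is that of [phi (X r) exp (- h)] under [nu0], where
    [X r] is a vector of coordinates rotating with [r].  Differentiating, each
    component moves with speed [- la k] times the coordinate in the orthogonal
    direction, so the derivative is minus the sum over [j] of the integrals of
    [la k * coord ('i * c) k * (d_j phi) (X t) * exp (- h)].

    Such a coordinate factor is removed by Stein's formula
    ([gaussian_integration_by_parts]): against a Gaussian vector, multiplication
    by a component is differentiation along a row of the covariance.
    Differentiating [d_j phi] produces second derivatives of [phi] paired with
    the coefficients [Re ('i * c j * conj (c l))], which are antisymmetric in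
    [j, l]; the Hessian being symmetric, these terms cancel
    ([hessian_cancellation]).  This is the invariance of [nu0] under the group.
    What remains comes from differentiating [exp (- h)] and is the integral of
    [(d_j phi) (X t) exp (- h)] against the coordinates of [nabla h], that is,
    the right-hand side after transport by the group.

    Differentiating [exp (- h)] is justified twice over by approximation.  It is
    first replaced by [rho y h] with [rho y x = 1 / (exp x + y)], which is bounded
    and Lipschitz together with its derivative, so that [h] may be approximated in
    the graph norm by cylindrical functions, for which Stein's formula applies
    ([cylinder_by_parts], [malliavin_by_parts]).  Then [y] tends to [0] by dominated
    convergence, as [rho y x] and its derivative are bounded by [exp (- x)]
    ([exponential_by_parts]).

    Stein's formula is itself derived from the characteristic function alone,
    through the fact that trigonometric functions determine the integrals of all
    bounded continuous functions ([characteristic_function_unique]). *)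

(** * Bernstein averages and trigonometric approximation *)

Section bernstein.
Context (R : realType).
Implicit Types (p B : R) (g : nat -> R).

(** The expectation of [g] at a binomial variable with [N] trials and success
    probability [p], computed by conditioning on the first trial. *)
Fixpoint bern p N g : R :=
  if N is N'.+1 then
    (1 - p) * bern p N' g + p * bern p N' (fun k => g k.+1)
  else g 0%N.

Lemma bern_affine p N a b g :
  bern p N (fun k => a + b * g k) = a + b * bern p N g.
Proof.
elim: N g => [//|N IH] g /=.
rewrite IH (IH (fun k => g k.+1)); ring.
Qed.

Lemma ler_bern p N g g' : 0 <= p <= 1 -> (forall k, g k <= g' k) ->
  bern p N g <= bern p N g'.
Proof.
move=> /andP[p0 p1]; elim: N g g' => [|N IH] g g' gg' //=.
by rewrite lerD// ler_wpM2l// ?subr_ge0// IH.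
Qed.

(** Variance [N p (1 - p)] plus squared bias: the input for Chebyshev's
    inequality in [bern_cvg]. *)
Lemma bern_sqr p N a :
  bern p N (fun k => (k%:R - a) ^+ 2) = N%:R * p * (1 - p) + (N%:R * p - a) ^+ 2.
Proof.
elim: N a => [|N IH] a /=; first by ring.
rewrite IH (_ : (fun k => _) = (fun k : nat => (k%:R - (a - 1)) ^+ 2)).
  by rewrite IH -(natr1 N); ring.
by apply/funext => k; rewrite -(natr1 k); ring.
Qed.

Lemma bern_normr_le p N g B : 0 <= p <= 1 -> (forall k, `|g k| <= B) ->
  `|bern p N g| <= B.
Proof.
move=> p01 gB.
have cstE c : bern p N (fun=> c) = c.
  by have := bern_affine p N c 0 g; under eq_fun do rewrite mul0r addr0;
    rewrite mul0r addr0.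
rewrite ler_norml -{1}(cstE (- B)) -{2}(cstE B).
by rewrite !ler_bern// => k; have := gB k; rewrite ler_norml => /andP[].
Qed.

(** Bernstein's form of the weak law of large numbers: outside a neighbourhood
    of [p] the oscillation of [f] is dominated by a multiple of the squared
    deviation, whose average is of order [1 / N]. *)
Lemma bern_cvg p (f : R -> R) B : 0 <= p <= 1 -> (forall x, `|f x| <= B) ->
  {for p, continuous f} ->
  bern p N.+1 (fun k => f (k%:R / N.+1%:R)) @[N --> \oo] --> f p.
Proof.
move=> p01 fB cf; apply/cvgrPdist_le => /= eps eps0.
have B0 : 0 <= B by exact: le_trans (fB 0).
have [d /= d0 fd] : exists2 d : R, 0 < d &
    forall x, `|p - x| < d -> `|f p - f x| <= eps / 2.
  have /cvgrPdist_le/(_ (eps / 2)) := cf; rewrite divr_gt0// => /(_ isT).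
  by move=> /nbhs_ballP[d /= d0 fd]; exists d => // x xd; exact: fd.
have step N (k : nat) : (0 < N)%N -> `|f p - f (k%:R / N%:R)| <=
    eps / 2 + (2 * B / (d * N%:R) ^+ 2) * (k%:R - N%:R * p) ^+ 2.
  move=> N0; have N0' : 0 < N%:R :> R by rewrite ltr0n.
  have dN : 0 < d * N%:R by rewrite mulr_gt0.
  have [near|far] := ltP `|p - k%:R / N%:R| d.
    rewrite (le_trans (fd _ near))// lerDl mulr_ge0 ?sqr_ge0//.
    by rewrite divr_ge0 ?sqr_ge0// mulr_ge0.
  rewrite -[leLHS]add0r lerD//; first exact: ltW (divr_gt0 _ _).
  have : 1 <= ((k%:R - N%:R * p) / (d * N%:R)) ^+ 2.
    rewrite -[leRHS]real_normK ?num_real// exprn_ege1//.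
    rewrite normrM normfV (gtr0_norm dN) ler_pdivlMr// mul1r.
    rewrite (_ : k%:R - _ = - ((p - k%:R / N%:R) * N%:R)); last first.
      by field; rewrite gt_eqF.
    by rewrite normrN normrM (gtr0_norm N0') ler_pM2r.
  move=> h1; apply: le_trans (ler_normB _ _) _.
  apply: (@le_trans _ _ (2 * B * 1)).
    by rewrite mulr1 (_ : 2 * B = B + B) ?lerD//; ring.
  by rewrite -[leRHS]mulrA [_^-1 * _]mulrC -expr_div_n ler_wpM2l// mulr_ge0.
have bound N : (0 < N)%N ->
    `|f p - bern p N (fun k => f (k%:R / N%:R))| <=
      eps / 2 + 2 * B / d ^+ 2 * N%:R^-1.
  move=> N0; have N0' : 0 < N%:R :> R by rewrite ltr0n.
  rewrite (_ : f p - _ = bern p N (fun k => f p + -1 * f (k%:R / N%:R))).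
    rewrite (@le_trans _ _ (bern p N (fun k => eps / 2 +
       (2 * B / (d * N%:R) ^+ 2) * (k%:R - N%:R * p) ^+ 2)))//.
      rewrite ler_norml; apply/andP; split.
        rewrite -[leLHS]mulN1r -[leLHS]add0r -bern_affine ler_bern// => k.
        rewrite add0r 2!mulN1r lerNl.
        by apply: le_trans (ler_norm _) _; rewrite normrN; exact: step.
      rewrite ler_bern// => k; rewrite mulN1r.
      by apply: le_trans (ler_norm _) _; exact: step.
    rewrite bern_affine bern_sqr subrr expr0n addr0 lerD2l.
    rewrite exprMn invfM.
    rewrite (_ : _ * _ = 2 * B / d ^+ 2 * N%:R^-1 * (p * (1 - p))); last first.
      by field; rewrite !gt_eqF.
    rewrite -[leRHS]mulr1 ler_wpM2l//.
      apply: mulr_ge0; last by rewrite invr_ge0 ler0n.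
      by apply: divr_ge0; [exact: mulr_ge0|exact: sqr_ge0].
    by move: p01 => /andP[p0 p1]; rewrite mulr_ile1// ?subr_ge0// gerBl.
  by rewrite bern_affine mulN1r.
have : (fun N => 2 * B / d ^+ 2 * @harmonic R N) @ \oo --> 0.
  rewrite -[X in _ --> X](mulr0 (2 * B / d ^+ 2)).
  by apply: cvgM; [exact: cvg_cst|exact: cvg_harmonic].
move/cvgrPdist_le => /(_ (eps / 2)); rewrite divr_gt0// => /(_ isT).
apply: filterS => N; rewrite sub0r normrN => hN.
apply: le_trans (bound N.+1 isT) _.
rewrite [leRHS](splitr eps) lerD2l; exact: le_trans (ler_norm _) hN.
Qed.

End bernstein.

Section trigonometric_closure.
Context (R : realType) (M : nat).

Lemma cvg_scaled_sin (x : R) :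
  n.+1%:R * sin (n.+1%:R^-1 * x) @[n --> \oo] --> x.
Proof.
have dsin : is_derive (0 : R^o) 1 (fun t : R^o => sin (t * x) : R^o) x.
  apply: is_derive_eq; rewrite mul0r cos0 /GRing.scale /=.
  by rewrite mul1r mulr1 mul0r ?addr0 ?add0r.
have /cvg_ex[l dl] := @ex_derive _ _ _ _ _ _ _ dsin.
have := @derive_val _ _ _ _ _ _ _ dsin; rewrite /derive (cvg_lim _ dl)// => lx.
rewrite {}lx {l} in dl.
move/cvgr_dnbhsP : dl => /(_ (@harmonic R)) dl.
have {dl} := dl (conj (fun n => lt0r_neq0 (harmonic_gt0 n)) cvg_harmonic).
apply: cvg_trans; apply: near_eq_cvg; apply: nearW => n /=.
by rewrite invrK mul0r sin0 subr0 addr0 /GRing.scale /= mulr1.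
Qed.

(** A neighbourhood of a row vector contains a finite product of neighbourhoods
    of its entries. *)
Lemma cvg_row (T : Type) (F : set_system T) {FF : Filter F}
    (g : T -> 'rV[R]_M) (l : 'rV[R]_M) :
  (forall j, g t 0 j @[t --> F] --> l 0 j) -> g @ F --> l.
Proof.
move=> gl A [P nP PA]; apply: (@filterS _ _ _ (fun t => forall i j, P i j (g t i j))).
  by move=> t Pt; exact: PA.
apply: filter_forall => i; apply: filter_forall => j.
by rewrite (ord1 i); have := nP 0 j; exact: gl.
Qed.

(** A class of functions on [R^M] stable under linear combinations,
    multiplication by [sin (a x_i)] and bounded pointwise limits contains every
    bounded continuous function.  The coordinates are released one at a time:
    the frozen coordinate [t] in [f (.., t, ..)] is replaced by the Bernstein
    average of its values at sampled points, taken at the success probability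
    [(1 + sin (x_i / L)) / 2]; this converges to the value at [L sin (x_i / L)],
    which in turn tends to the value at [x_i] as [L] grows. *)
Lemma bounded_continuous_in_trig_closure (G : set ('rV[R]_M -> R)) :
  (forall c, G (cst c)) ->
  (forall f g, G f -> G g -> G (fun x => f x + g x)) ->
  (forall f c, G f -> G (fun x => c * f x)) ->
  (forall f i a, G f -> G (fun x => sin (a * x 0 i) * f x)) ->
  (forall (f_ : nat -> 'rV[R]_M -> R) (f : 'rV[R]_M -> R) (B : R), (forall n, G (f_ n)) ->
     (forall n x, `|f_ n x| <= B) ->
     (forall x, f_ n x @[n --> \oo] --> f x) -> G f) ->
  forall (f : 'rV[R]_M -> R) (B : R), continuous f -> (forall x, `|f x| <= B) -> G f.
Proof.
move=> Gcst GD GZ Gsin Glim f B cf fB.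
pose mix n (c x : 'rV[R]_M) : 'rV[R]_M :=
  \row_j (if (j < n)%N then x 0 j else c 0 j).
pose upd (c : 'rV[R]_M) i t : 'rV[R]_M :=
  \row_j (if j == i then t else c 0 j).
suff P n : (n <= M)%N -> forall c, G (f \o mix n c).
  have := P M (leqnn M) 0; rewrite (_ : f \o _ = f)//; apply/funext => x /=.
  by congr f; apply/rowP => j; rewrite mxE ltn_ord.
elim: n => [_ c|n IH nM c].
  rewrite (_ : _ \o _ = cst (f c)); first exact: Gcst.
  by apply/funext => x /=; congr f; apply/rowP => j; rewrite mxE.
pose i := Ordinal nM.
have cupd x : continuous (fun t => f (mix n (upd c i t) x)).
  move=> t; apply: (@cvg_comp _ _ _ (fun t => mix n (upd c i t) x) f); last exact: cf.
  apply: cvg_row => j; under eq_fun do rewrite mxE; rewrite mxE.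
  case: ifP => _; first exact: cvg_cst.
  under eq_fun do rewrite mxE; rewrite mxE.
  by case: ifP => _; [exact: cvg_id|exact: cvg_cst].
pose p L (x : 'rV[R]_M) : R := (1 + sin (L.+1%:R^-1 * x 0 i)) / 2.
have p01 L x : 0 <= p L x <= 1.
  have := sin_geN1 (L.+1%:R^-1 * x 0 i); have := sin_le1 (L.+1%:R^-1 * x 0 i).
  rewrite /p; lra.
pose s L t : R := L.+1%:R * (2 * t - 1).
have Gbern L N (g : nat -> 'rV[R]_M -> R) : (forall k, G (g k)) ->
    G (fun x => bern (p L x) N (fun k => g k x)).
  elim: N g => [|N IHN] g Gg /=; first exact: Gg.
  have Gp h : G h -> G (fun x => p L x * h x).
    move=> Gh; rewrite (_ : (fun _ => _) = (fun x =>
      2^-1 * h x + 2^-1 * (sin (L.+1%:R^-1 * x 0 i) * h x))).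
      by apply: GD; apply: GZ => //; exact: Gsin.
    by apply/funext => x; rewrite /p; field.
  rewrite (_ : (fun _ => _) = (fun x => bern (p L x) N (g^~ x) +
      (p L x * (bern (p L x) N (fun k => g k.+1 x)) +
       - 1 * (p L x * bern (p L x) N (g^~ x))))).
    apply: (GD); first exact: IHN.
    by apply: (GD); [|apply: GZ]; apply: Gp; exact: IHN.
  by apply/funext => x; ring.
have GL L : G (fun x => f (mix n (upd c i (s L (p L x))) x)).
  apply: (Glim (fun N x => bern (p L x) N.+1
    (fun k => f (mix n (upd c i (s L (k%:R / N.+1%:R))) x))) _ B).
  - by move=> N; apply: (Gbern L N.+1) => k; exact: IH (ltnW nM) _.
  - by move=> N x; exact: bern_normr_le.
  - move=> x; pose h t := f (mix n (upd c i (s L t)) x).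
    have ch : {for p L x, continuous h}.
      apply: (@continuous_comp _ _ _ (s L)
        (fun t => f (mix n (upd c i t) x))); last exact: cupd.
      apply: cvgM; first exact: cvg_cst.
      by apply: cvgB; [apply: cvgM; [exact: cvg_cst|exact: cvg_id]|exact: cvg_cst].
    exact: (@bern_cvg _ (p L x) h B (p01 L x) (fun t => fB _) ch).
apply: (Glim _ _ B GL) => // x.
rewrite (_ : (f \o mix n.+1 c) x = f (mix n (upd c i (x 0 i)) x)).
  apply: (@cvg_comp _ _ _ (fun L => s L (p L x)) (fun t => f (mix n (upd c i t) x))
    _ (nbhs (x 0 i))); last exact: cupd.
  have := @cvg_scaled_sin (x 0 i); apply: cvg_trans.
  by apply: near_eq_cvg; apply: nearW => L; rewrite /s /p; field.
congr f; apply/rowP => j; rewrite !mxE ltnS; case: (ltngtP (j : nat) n) => [jn|jn|jn].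
- by [].
- by case: eqP => // ji; move: jn; rewrite ji ltnn.
- by rewrite (_ : j = i) ?eqxx//; exact/val_inj.
Qed.

End trigonometric_closure.

(** * Integrals determined by trigonometric functions *)

Section integration.
Context d (T : measurableType d) (R : realType).
Variable P : {measure set T -> \bar R}.
Implicit Types f g k : T -> R.

Lemma integrableRD f g : P.-integrable setT (EFin \o f) ->
  P.-integrable setT (EFin \o g) ->
  P.-integrable setT (EFin \o (fun x => f x + g x)).
Proof. by move=> fi gi; exact: eq_integrable (integrableD _ fi gi). Qed.

Lemma integrableRB f g : P.-integrable setT (EFin \o f) ->
  P.-integrable setT (EFin \o g) ->
  P.-integrable setT (EFin \o (fun x => f x - g x)).
Proof. by move=> fi gi; exact: eq_integrable (integrableB _ fi gi). Qed.

Lemma integrableRZ c f : P.-integrable setT (EFin \o f) ->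
  P.-integrable setT (EFin \o (fun x => c * f x)).
Proof. by move=> fi; exact: eq_integrable (integrableZl _ c fi). Qed.

Lemma le_dominated_integrable f g : measurable_fun setT f ->
  (forall x, `|f x| <= g x) -> P.-integrable setT (EFin \o g) ->
  P.-integrable setT (EFin \o f).
Proof.
move=> mf fg; apply: le_integrable => //; first exact/measurable_EFinP.
by move=> x _ /=; rewrite lee_fin (le_trans (fg x))// ler_norm.
Qed.

Lemma integrable_bounded_mul k f (B : R) : P.-integrable setT (EFin \o k) ->
  measurable_fun setT f -> (forall x, `|f x| <= B) ->
  P.-integrable setT (EFin \o (fun x => k x * f x)).
Proof.
move=> ik mf fB; have mk : measurable_fun setT k.
  by apply/measurable_EFinP; exact: measurable_int ik.
apply: (@le_dominated_integrable _ (fun x => B * `|k x|)).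
- exact: measurable_funM.
- by move=> x; rewrite normrM mulrC ler_wpM2r.
- exact/integrableRZ/integrable_norm.
Qed.

Lemma dominated_cvg_Rintegral (f_ : nat -> T -> R) f g :
  (forall n, measurable_fun setT (f_ n)) ->
  (forall n x, `|f_ n x| <= g x) -> P.-integrable setT (EFin \o g) ->
  (forall x, f_ n x @[n --> \oo] --> f x) ->
  P.-integrable setT (EFin \o f) /\
  \int[P]_x f_ n x @[n --> \oo] --> \int[P]_x f x.
Proof.
move=> mf_ f_g ig f_f.
have mf : measurable_fun setT f 
  by apply: (measurable_fun_cvg mf_) => x _; exact: f_f.
have [|||||ifn _ h] := @dominated_convergence _ _ _ P _ measurableT
  (fun n x => (f_ n x)%:E) (EFin \o f) (EFin \o g).
- by move=> n; apply/measurable_EFinP.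
- exact/measurable_EFinP.
- by apply/aeW => x _; apply: cvg_EFin; [exact: nearW|exact: f_f].
- by [].
- by apply/aeW => x n _; rewrite lee_fin.
split => //; apply: fine_cvg; rewrite fineK//; exact: integrable_fin_num.
Qed.

End integration.

Lemma measurable_sin (R : realType) : measurable_fun setT (@sin R).
Proof. by apply: continuous_measurable_fun; exact: continuous_sin. Qed.

Lemma measurable_cos (R : realType) : measurable_fun setT (@cos R).
Proof. by apply: continuous_measurable_fun; exact: continuous_cos. Qed.

Section characteristic_function.
Context d (T : measurableType d) (R : realType) (M : nat).
Variable P : {measure set T -> \bar R}.
Implicit Types (Y : T -> 'rV[R]_M) (k : T -> R).

(** The measurable compositions form a class closed under the operations of
    [bounded_continuous_in_trig_closure]; this avoids any description of the
    Borel sets of the space of row vectors. *)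
Lemma measurable_row_comp Y (f : 'rV[R]_M -> R) (B : R) :
  (forall i, measurable_fun setT (fun t => Y t 0 i)) ->
  continuous f -> (forall x, `|f x| <= B) -> measurable_fun setT (f \o Y).
Proof.
move=> mY cf fB; pose G := [set f : 'rV[R]_M -> R | measurable_fun setT (f \o Y)].
suff : G f by []; apply: bounded_continuous_in_trig_closure cf fB; rewrite /G => //=.
- by move=> c; exact: measurable_cst.
- by move=> f' g mf mg; exact: (measurable_funD mf mg).
- by move=> f' c mf; exact: (measurable_funM (measurable_cst c) mf).
- move=> f' i a mf; apply: measurable_funM; last exact: mf.
  apply: (measurableT_comp (@measurable_sin R) (measurable_funM (measurable_cst a) (mY i))).
- move=> f_ f' C mf_ _ f_f; apply: (measurable_fun_cvg mf_) => x _; exact: f_f.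
Qed.

Lemma measurable_row_dot Y (xi : 'rV[R]_M) :
  (forall i, measurable_fun setT (fun t => Y t 0 i)) ->
  measurable_fun setT (fun t => \sum_i xi 0 i * Y t 0 i).
Proof.
by move=> mY; apply: measurable_sum => i; exact: measurable_funM.
Qed.

(** The products [f (Y) cos (<xi, Y> + a)] for which the two sides agree form a
    class as in [bounded_continuous_in_trig_closure], by the product-to-sum
    formulas. *)
Lemma characteristic_function_unique (k1 k2 : T -> R) (Y1 Y2 : T -> 'rV[R]_M) :
  P.-integrable setT (EFin \o k1) -> P.-integrable setT (EFin \o k2) ->
  (forall i, measurable_fun setT (fun t => Y1 t 0 i)) ->
  (forall i, measurable_fun setT (fun t => Y2 t 0 i)) ->
  (forall (xi : 'rV[R]_M) (a : R),
     \int[P]_t (k1 t * cos (\sum_i xi 0 i * Y1 t 0 i + a)) =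
     \int[P]_t (k2 t * cos (\sum_i xi 0 i * Y2 t 0 i + a))) ->
  forall (f : 'rV[R]_M -> R) (B : R),
    continuous f -> (forall x, `|f x| <= B) ->
    \int[P]_t (k1 t * f (Y1 t)) = \int[P]_t (k2 t * f (Y2 t)).
Proof.
move=> ik1 ik2 mY1 mY2 eqcos f B cf fB.
pose D (xi x : 'rV[R]_M) : R := \sum_i xi 0 i * x 0 i.
pose W (a : R) (xi : 'rV[R]_M) (f : 'rV[R]_M -> R) (x : 'rV[R]_M) : R := f x * cos (D xi x + a).
pose G := [set f : 'rV[R]_M -> R | [/\ measurable_fun setT (f \o Y1),
  measurable_fun setT (f \o Y2), (exists B : R, forall x, `|f x| <= B) &
  forall xi a, \int[P]_t (k1 t * W a xi f (Y1 t)) =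
    \int[P]_t (k2 t * W a xi f (Y2 t))]].
suff [_ _ _ /(_ 0 0) Gf] : G f.
  have W0 x : W 0 0 f x = f x.
    rewrite /W /D addr0 big1 ?cos0 ?mulr1// => i _.
    by rewrite mxE mul0r.
  by under eq_Rintegral do rewrite -W0; under [RHS]eq_Rintegral do rewrite -W0.
have mcos xi a Y : (forall i, measurable_fun setT (fun t => Y t 0 i)) ->
    measurable_fun setT (fun t => cos (D xi (Y t) + a)).
  move=> mY; exact: (measurableT_comp (@measurable_cos R)
    (measurable_funD (measurable_row_dot xi mY) (measurable_cst a))).
have mW xi a (h : 'rV[R]_M -> R) Y : (forall i, measurable_fun setT (fun t => Y t 0 i)) ->
    measurable_fun setT (h \o Y) -> measurable_fun setT (W a xi h \o Y).
  by move=> mY mh; exact: (measurable_funM mh (mcos xi a Y mY)).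
have WB xi a (h : 'rV[R]_M -> R) (C : R) : (forall x, `|h x| <= C) -> forall x, `|W a xi h x| <= C.
  move=> hC x; rewrite /W normrM (le_trans _ (hC x))// ler_piMr//.
  by rewrite ler_norml cos_geN1 cos_le1.
have iW xi a (h : 'rV[R]_M -> R) k Y : P.-integrable setT (EFin \o k) ->
    (forall i, measurable_fun setT (fun t => Y t 0 i)) ->
    measurable_fun setT (h \o Y) -> (exists C : R, forall x, `|h x| <= C) ->
    P.-integrable setT (EFin \o (fun t => k t * W a xi h (Y t))).
  move=> ik mY mh [C hC].
  apply: (@integrable_bounded_mul _ _ _ P k (W a xi h \o Y) C) => //.
    exact: mW.
  by move=> x; exact: WB.
apply: bounded_continuous_in_trig_closure cf fB.
- move=> c; split; [exact: measurable_cst|exact: measurable_cst|by exists `|c| |].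
  move=> xi a; rewrite /W; under eq_Rintegral do rewrite mulrCA.
  under [RHS]eq_Rintegral do rewrite mulrCA.
  rewrite !RintegralZl ?eqcos//.
    apply: (@integrable_bounded_mul _ _ _ P k2 (fun t => cos (D xi (Y2 t) + a)) 1) => //.
      exact: mcos.
    by move=> t; rewrite ler_norml cos_geN1 cos_le1.
  apply: (@integrable_bounded_mul _ _ _ P k1 (fun t => cos (D xi (Y1 t) + a)) 1) => //.
    exact: mcos.
  by move=> t; rewrite ler_norml cos_geN1 cos_le1.
- move=> f1 f2 [m11 m12 [B1 b1] e1] [m21 m22 [B2 b2] e2]; split.
  + exact: (measurable_funD m11 m21).
  + exact: (measurable_funD m12 m22).
  + by exists (B1 + B2) => x; rewrite (le_trans (ler_normD _ _))// lerD.
  + move=> xi a.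
    have WD k Y : P.-integrable setT (EFin \o k) ->
        (forall i, measurable_fun setT (fun t => Y t 0 i)) ->
        measurable_fun setT (f1 \o Y) -> measurable_fun setT (f2 \o Y) ->
        \int[P]_t (k t * W a xi (fun x => f1 x + f2 x) (Y t)) =
        \int[P]_t (k t * W a xi f1 (Y t)) + \int[P]_t (k t * W a xi f2 (Y t)).
      move=> ik mY m1 m2; rewrite -RintegralD//.
      - by apply: eq_Rintegral => t _; rewrite /W; ring.
      - by apply: iW => //; exists B1.
      - by apply: iW => //; exists B2.
    by rewrite !WD// e1 e2.
- move=> h c [m1 m2 [C hC] e]; split.
  + exact: (measurable_funM (measurable_cst c) m1).
  + exact: (measurable_funM (measurable_cst c) m2).
  + by exists (`|c| * C) => x; rewrite normrM ler_wpM2l.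
  + move=> xi a.
    have WZ k Y : P.-integrable setT (EFin \o k) ->
        (forall i, measurable_fun setT (fun t => Y t 0 i)) ->
        measurable_fun setT (h \o Y) ->
        \int[P]_t (k t * W a xi (fun x => c * h x) (Y t)) =
        c * \int[P]_t (k t * W a xi h (Y t)).
      move=> ik mY mh; rewrite -RintegralZl//.
        by apply: eq_Rintegral => t _; rewrite /W; ring.
      by apply: iW => //; exists C.
    by rewrite !WZ// e.
- move=> h i b [m1 m2 [C hC] e].
  have msin Y : (forall i, measurable_fun setT (fun t => Y t 0 i)) ->
      measurable_fun setT (h \o Y) ->
      measurable_fun setT ((fun x : 'rV_M => sin (b * x 0 i) * h x) \o Y).
    move=> mY mh; apply: measurable_funM => //.
    exact: (measurableT_comp (@measurable_sin R) (measurable_funM (measurable_cst b) (mY i))).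
  split; [exact: msin|exact: msin| |].
  + exists C => x; rewrite normrM (le_trans _ (hC x))// ler_piMl//.
    by rewrite ler_norml sin_geN1 sin_le1.
    (* sin (b x_i) cos (<xi, x> + a) is half a difference of two cosines. *)
  + move=> xi a; pose ei : 'rV[R]_M := b *: delta_mx 0 i.
    have De x : D ei x = b * x 0 i.
      rewrite /D (bigD1 i)//= big1 ?addr0 ?mxE ?eqxx ?mulr1// => j ji.
      by rewrite !mxE eqxx /= (negbTE ji) mulr0 mul0r.
    have DD eta eta' x : D (eta + eta') x = D eta x + D eta' x.
      by rewrite /D -big_split; apply: eq_bigr => j _; rewrite mxE mulrDl.
    have DN eta x : D (- eta) x = - D eta x.
      by rewrite /D -sumrN; apply: eq_bigr => j _; rewrite mxE mulNr.
    have WM k Y : P.-integrable setT (EFin \o k) ->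
        (forall i, measurable_fun setT (fun t => Y t 0 i)) ->
        measurable_fun setT (h \o Y) ->
        \int[P]_t (k t * W a xi (fun x => sin (b * x 0 i) * h x) (Y t)) =
        2^-1 * \int[P]_t (k t * W (a - pi / 2) (xi + ei) h (Y t)) -
        2^-1 * \int[P]_t (k t * W (a - pi / 2) (xi - ei) h (Y t)).
      move=> ik mY mh.
      have iWh xi' : P.-integrable setT
          (EFin \o (fun t => k t * W (a - pi / 2) xi' h (Y t))).
        by apply: iW => //; exists C.
      rewrite -!RintegralZl// -RintegralB//; [|exact: integrableRZ..].
      apply: eq_Rintegral => t _; rewrite /W !DD DN De !addrA.
      have cospi x : cos (x - pi / 2) = sin x.
        by rewrite cosB cos_pihalf sin_pihalf mulr0 add0r mulr1.
      rewrite !cospi -addrA [b * _ + a]addrC addrA sinD.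
      by rewrite addrAC sinB; field.
    by rewrite !WM// !e.
- move=> f_ h C Gf_ f_C f_h.
  have mlim Y : (forall n, measurable_fun setT (f_ n \o Y)) ->
      measurable_fun setT (h \o Y).
    by move=> mf_; apply: measurable_fun_cvg mf_ _ => t _; exact: f_h.
  have m1 n : measurable_fun setT (f_ n \o Y1) by case: (Gf_ n).
  have m2 n : measurable_fun setT (f_ n \o Y2) by case: (Gf_ n).
  split; [exact: mlim|exact: mlim| |].
  + exists C => x; apply: (cvgr_to_le (cvg_norm (f_h x))).
    exact: nearW.
  + move=> xi a.
    have Wlim k Y : P.-integrable setT (EFin \o k) ->
        (forall i, measurable_fun setT (fun t => Y t 0 i)) ->
        (forall n, measurable_fun setT (f_ n \o Y)) ->
        \int[P]_t (k t * W a xi (f_ n) (Y t)) @[n --> \oo] -->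
        \int[P]_t (k t * W a xi h (Y t)).
      move=> ik mY mf_.
      have [||||_] := @dominated_cvg_Rintegral _ _ _ P
        (fun n t => k t * W a xi (f_ n) (Y t)) (fun t => k t * W a xi h (Y t))
        (fun t => C * `|k t|).
      - move=> n; apply: measurable_funM; last exact: mW.
        by apply/measurable_EFinP; exact: measurable_int ik.
      - by move=> n t; rewrite normrM mulrC ler_wpM2r// WB.
      - exact/integrableRZ/integrable_norm.
      - move=> t; apply: cvgM; first exact: cvg_cst.
        by apply: cvgM; [exact: f_h|exact: cvg_cst].
      - by [].
    have := Wlim k1 Y1 ik1 mY1 m1.
    rewrite (_ : (fun n => _) = (fun n => \int[P]_t (k2 t * W a xi (f_ n) (Y2 t)))).
      move=> l1; exact: cvg_unique l1 (Wlim k2 Y2 ik2 mY2 m2).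
    by apply/funext => n; case: (Gf_ n).
Qed.

End characteristic_function.

(** * Integration over the unit interval and under the integral sign *)

Section calculus_tools.
Context (R : realType).

Lemma FTC_unit (f g : R -> R) : (forall z, is_derive (z : R^o) 1 (f : R^o -> R^o) (g z)) ->
  continuous g ->
  \int[@lebesgue_measure R]_(z in `[0%R, 1%R]) g z = f 1 - f 0.
Proof.
move=> df cg; have cf : continuous f.
  move=> x; apply: differentiable_continuous; apply/derivable1_diffP.
  exact: ex_derive.
rewrite /Rintegral (@continuous_FTC2 _ g f 0 1)//.
- exact: continuous_subspaceT.
- split; first by move=> x _; exact: ex_derive.
  + exact/cvg_at_right_filter/cf.
  + exact/cvg_at_left_filter/cf.
- by move=> x _; rewrite derive1E derive_val.
Qed.

Lemma Rintegral_unit_cst (c : R) :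
  \int[@lebesgue_measure R]_(z in `[0%R, 1%R]) c = c.
Proof.
transitivity (1 * c - 0 * c); last by rewrite mul1r mul0r subr0.
apply: (@FTC_unit (fun z => z * c) (cst c)); last exact: cst_continuous.
by move=> z; apply: is_derive_eq; rewrite /GRing.scale /=; ring.
Qed.

Lemma is_derive_line (V : normedModType R) (f : V -> R) (x v : V) (z d : R) :
  is_derive (x + z *: v) v (f : V -> R^o) d ->
  is_derive (z : R^o) 1 (fun y : R^o => f (x + y *: v) : R^o) d.
Proof.
move=> df.
have E : (fun h : R => h^-1 *: ((fun y : R^o => f (x + y *: v) : R^o) (h *: 1 + z) -
    (fun y : R^o => f (x + y *: v) : R^o) z)) =
    (fun h : R => h^-1 *: ((f : V -> R^o) (h *: v + (x + z *: v)) - (f : V -> R^o) (x + z *: v))).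
  apply/funext => h; congr (_ *: (f _ - _)).
  by rewrite scalerDl [h *: 1]mulr1 addrCA.
split.
  by have := @ex_derive _ _ _ _ _ _ _ df; rewrite /derivable /= E.
by rewrite /derive E; exact: derive_val.
Qed.

End calculus_tools.

Section integration_tools.
Context d (T : measurableType d) (R : realType).

Lemma is_derive_Rintegral (P : {measure set T -> \bar R}) (f f' : R -> T -> R)
    (G : T -> R) (a : R) :
  (forall x, P.-integrable setT (EFin \o f x)) ->
  (forall x y, is_derive (x : R^o) 1 (f^~ y : R^o -> R^o) (f' x y)) ->
  P.-integrable setT (EFin \o G) -> (forall x y, `|f' x y| <= G y) ->
  is_derive (a : R^o) 1 (fun x : R^o => \int[P]_y f x y : R^o)
    (\int[P]_y f' a y).
Proof.
move=> fint df Gint f'G.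
have d1E x y : partial1of2 f x y = f' x y.
  by rewrite partial1of2E derive_val.
have aI : `]a - 1, a + 1[%classic a.
  by rewrite /= in_itv/=; apply/andP; split; lra.
have G0 y : 0 <= G y by exact: le_trans (f'G a y).
have ub x y : `]a - 1, a + 1[%classic x -> setT y -> `|partial1of2 f x y| <= G y.
  by move=> _ _; rewrite d1E.
have derf x y : `]a - 1, a + 1[%classic x -> setT y -> derivable (f ^~ y) x 1.
  by move=> _ _; exact: ex_derive.
have intf x : `]a - 1, a + 1[%classic x -> P.-integrable setT (EFin \o f x) by [].
apply: DeriveDef; first exact: (derivable_under_integral measurableT aI intf derf G0 Gint ub).
rewrite -derive1E (differentiation_under_integral measurableT aI intf derf G0 Gint ub).
by apply: eq_Rintegral => y _; exact: d1E.
Qed.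

Local Notation unit_weight := (\1_(`[0%R, 1%R]%classic : set R) : R -> R).

(** The uniform law on the unit interval is handled through its density, so that
    a product with Lebesgue measure provides the auxiliary variable of Stein's
    formula. *)
Lemma fubini_unit (P : probability T R) (k : T -> R) (f : T * R -> R) (B : R) :
  P.-integrable setT (EFin \o k) ->
  measurable_fun setT f -> (forall x, `|f x| <= B) ->
  (P \x @lebesgue_measure R)%E.-integrable setT
    (EFin \o (fun x => k x.1 * unit_weight x.2 * f x)) /\
  \int[(P \x @lebesgue_measure R)%E]_x (k x.1 * unit_weight x.2 * f x) =
  \int[P]_t (k t * \int[@lebesgue_measure R]_(z in `[0%R, 1%R]) f (t, z)).
Proof.
move=> ik mf fB; pose I01 : set R := `[0%R, 1%R]%classic.
have mI : measurable I01 by exact: measurable_itv.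
have I01_fin : (@lebesgue_measure R I01 < +oo)%E.
  by rewrite /I01 lebesgue_measure_itv/= lte_fin ltr01 -EFinB ltry.
have mk : measurable_fun setT k by apply/measurable_EFinP; exact: measurable_int ik.
have mF : measurable_fun setT (fun x => k x.1 * unit_weight x.2 * f x).
  apply: measurable_funM => //; apply: measurable_funM.
    exact: (measurableT_comp mk measurable_fst).
  exact: (measurableT_comp (measurable_indic mI) measurable_snd).
have mft t : measurable_fun setT (fun z => f (t, z)).
  exact: (measurableT_comp mf (pair1_measurable t)).
have ift t : (@lebesgue_measure R).-integrable I01 (EFin \o (fun z => f (t, z))).
  apply: measurable_bounded_integrable => //.
  - exact: measurable_funS (mft t).
  - by exists B; split; [exact: num_real|move=> M BM z _; exact: le_trans (fB _) (ltW BM)].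
have int_z c (g : R -> R) : (@lebesgue_measure R).-integrable I01 (EFin \o g) ->
    (\int[@lebesgue_measure R]_z (c * unit_weight z * g z)%:E =
     (c * \int[@lebesgue_measure R]_(z in I01) g z)%:E)%E.
  move=> ig; rewrite -RintegralZl// [in RHS]/Rintegral fineK; last first.
    by apply: integrable_fin_num => //; exact: eq_integrable (integrableZl _ c ig).
  rewrite [RHS]integral_mkcond; apply: eq_integral => z _.
  rewrite patchE indicE; case: ifPn => _; first by rewrite mulr1.
  by rewrite mulr0 mul0r.
have iF : (P \x @lebesgue_measure R)%E.-integrable setT
    (EFin \o (fun x => k x.1 * unit_weight x.2 * f x)).
  have ikB : P.-integrable setT (EFin \o (fun t => B * `|k t|)).
    exact/integrableRZ/integrable_norm.
  have icst : (@lebesgue_measure R).-integrable I01 (EFin \o cst 1).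
    by apply: measurable_bounded_integrable => //; exists 1; split => // M M1 z _ /=;
      rewrite normr1 ltW.
  have u0 z : 0 <= unit_weight z :> R by rewrite indicE ler0n.
  have B0 : 0 <= B by exact: le_trans (fB point).
  have G0 x : 0 <= B * `|k x.1| * unit_weight x.2 * 1.
    by rewrite mulr1; apply: mulr_ge0 => //; exact: mulr_ge0.
  have h := @le_dominated_integrable _ _ R (P \x @lebesgue_measure R)%E
    (fun x => k x.1 * unit_weight x.2 * f x)
    (fun x => (B * `|k x.1|) * unit_weight x.2 * 1).
  apply: h => //.
  - by move=> x; rewrite mulr1 !normrM (ger0_norm (u0 _)) mulrC -mulrA ler_wpM2r.
  - apply/integrable12ltyP.
      apply/measurable_EFinP; apply: measurable_funM => //.
      apply: measurable_funM; last exact: (measurableT_comp (measurable_indic mI) measurable_snd).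
      apply: measurable_funM => //; apply: measurableT_comp => //.
      exact: (measurableT_comp mk measurable_fst).
    have /integrableP[_] := ikB; apply: le_lt_trans.
    rewrite le_eqVlt; apply/orP; left; apply/eqP; apply: eq_integral => t _ /=.
    under eq_integral do rewrite (ger0_norm (G0 (t, _)))/=.
    rewrite (int_z (B * `|k t|) (cst 1))// (@FTC_unit _ id (cst 1)).
    - by rewrite subr0 mulr1 (ger0_norm (mulr_ge0 B0 (normr_ge0 (k t)))).
    - exact: cst_continuous.
split => //.
rewrite /Rintegral -integral12_prod_meas1//; congr fine.
by apply: eq_integral => t _; rewrite /fubini_F/= int_z.
Qed.

End integration_tools.

(** * Gaussian vectors and Stein's formula *)

(** The phase [a] makes the cosine identity carry the whole characteristic
    function, real and imaginary parts at once. *)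
Definition gaussian_vector d (T : measurableType d) (R : realType) (M : nat)
    (P : {measure set T -> \bar R}) (X : T -> 'rV[R]_M) (C : 'M[R]_M) : Prop :=
  [/\ forall i, measurable_fun setT (fun t => X t 0 i), C^T = C &
      forall (xi : 'rV[R]_M) (a : R),
        \int[P]_t cos (\sum_i xi 0 i * X t 0 i + a) =
        expR (- ((xi *m C *m xi^T) 0 0 / 2)) * cos a].

Section gaussian_vector.
Context d (T : measurableType d) (R : realType) (M : nat).
Context (P : probability T R) (X : T -> 'rV[R]_M) (C : 'M[R]_M).
Hypothesis gX : gaussian_vector P X C.
Implicit Types (xi : 'rV[R]_M) (a tau : R) (i : 'I_M).

Let mX i : measurable_fun setT (fun t => X t 0 i).
Proof. by case: gX. Qed.

Let charX xi a : \int[P]_t cos (\sum_i xi 0 i * X t 0 i + a) =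
  expR (- ((xi *m C *m xi^T) 0 0 / 2)) * cos a.
Proof. by case: gX. Qed.

Lemma covariance_shift xi i tau :
  ((xi + tau *: delta_mx 0 i) *m C *m (xi + tau *: delta_mx 0 i)^T) 0 0 =
  (xi *m C *m xi^T) 0 0 + 2 * tau * (xi *m C) 0 i + tau ^+ 2 * C i i.
Proof.
case: gX => _ CT _.
have CE (eta : 'rV[R]_M) : ((delta_mx 0 i : 'rV_M) *m C *m eta^T) 0 0 = (eta *m C) 0 i.
  rewrite -rowE !mxE; apply: eq_bigr => j _.
  by rewrite !mxE mulrC -{1}CT mxE.
have EC (eta : 'rV[R]_M) : (eta *m C *m (delta_mx 0 i : 'rV_M)^T) 0 0 = (eta *m C) 0 i.
  by rewrite trmx_delta -colE mxE.
have addE (A B : 'M[R]_1) : (A + B) 0 0 = A 0 0 + B 0 0 by rewrite mxE.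
have scaleE (c : R) (A : 'M[R]_1) : (c *: A) 0 0 = c * A 0 0 by rewrite mxE.
have deltaE : ((delta_mx 0 i : 'rV_M) *m C) 0 i = C i i by rewrite -rowE mxE.
rewrite linearD linearZ /= !mulmxDl !mulmxDr -!scalemxAl -!scalemxAr.
rewrite !addE !scaleE !EC CE deltaE; ring.
Qed.

Lemma dot_shift xi i tau (x : 'rV[R]_M) :
  \sum_j (xi + tau *: delta_mx 0 i) 0 j * x 0 j =
  \sum_j xi 0 j * x 0 j + tau * x 0 i.
Proof.
have -> : tau * x 0 i = \sum_j (tau *: delta_mx 0 i : 'rV_M) 0 j * x 0 j.
  rewrite (bigD1 i)//= big1 ?addr0 ?mxE ?eqxx ?mulr1// => j ji.
  by rewrite !mxE eqxx /= (negbTE ji) mulr0 mul0r.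
by rewrite -big_split; apply: eq_bigr => j _; rewrite mxE mulrDl.
Qed.

Lemma bounded_integrable (f : T -> R) (B : R) : measurable_fun setT f ->
  (forall t, `|f t| <= B) -> P.-integrable setT (EFin \o f).
Proof.
move=> mf fB; apply: measurable_bounded_integrable => //.
  by apply: le_lt_trans (probability_le1 P measurableT) _; rewrite ltry.
by exists B; split; [exact: num_real|move=> K BK z _; exact: le_trans (fB _) (ltW BK)].
Qed.

(** Fatou's lemma for [2 n^2 (1 - cos (X_i / n))], which tends to [X_i^2] while
    its expectation [2 n^2 (1 - exp (- C_ii / (2 n^2)))] stays below [C_ii]. *)
Lemma gaussian_sqr_integrable i : P.-integrable setT (EFin \o (fun t => X t 0 i ^+ 2)).
Proof.
pose g n t : R := 2 * n.+1%:R ^+ 2 * (1 - cos (n.+1%:R^-1 * X t 0 i)).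
have mg n : measurable_fun setT (g n).
  apply: measurable_funM => //; apply: measurable_funB => //.
  exact: (measurableT_comp (@measurable_cos R) (measurable_funM (measurable_cst _) (mX i))).
have g0 n t : 0 <= g n t.
  by rewrite /g mulr_ge0 ?mulr_ge0 ?sqr_ge0// subr_ge0 cos_le1.
have gE t : g n t @[n --> \oo] --> X t 0 i ^+ 2.
  have c : (2 * (n.+1%:R * sin (n.+1%:R^-1 * (X t 0 i / 2)))) ^+ 2 @[n --> \oo]
      --> (2 * (X t 0 i / 2)) ^+ 2.
    under eq_fun do rewrite expr2; rewrite expr2.
    by apply: cvgM; apply: cvgM; [exact: cvg_cst|exact: cvg_scaled_sin|
      exact: cvg_cst|exact: cvg_scaled_sin].
  move: c; rewrite (_ : 2 * (X t 0 i / 2) = X t 0 i); last by field.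
  apply: cvg_trans; apply: near_eq_cvg; apply: nearW => n.
  rewrite /g; set th := _ * (_ / 2).
  have -> : n.+1%:R^-1 * X t 0 i = th + th by rewrite /th; field.
  by rewrite cosD -!expr2 cos2sin2; ring.
have ig n : (\int[P]_t (g n t)%:E <= (C i i)%:E)%E.
  have N0 : 0 < n.+1%:R :> R by rewrite ltr0n.
  have mc : measurable_fun setT (fun t => cos (n.+1%:R^-1 * X t 0 i)).
    exact: (measurableT_comp (@measurable_cos R) (measurable_funM (measurable_cst _) (mX i))).
  have ic : P.-integrable setT (EFin \o (fun t => cos (n.+1%:R^-1 * X t 0 i))).
    apply: (@bounded_integrable _ 1) => // t.
    by rewrite ler_norml cos_geN1 cos_le1.
  have i1 : P.-integrable setT (EFin \o cst 1) 
    by apply: (@bounded_integrable _ 1) => // t; rewrite normr1.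
  have i2 := integrableRB i1 ic.
  have i3 : P.-integrable setT (EFin \o g n) := integrableRZ (2 * n.+1%:R ^+ 2) i2.
  rewrite -[leLHS]fineK; last exact: integrable_fin_num.
  rewrite lee_fin -/(Rintegral _ _ _) RintegralZl// RintegralB//.
  rewrite Rintegral_cst// mul1r (_ : fine _ = 1); last by have /= -> := @probability_setT _ _ _ P.
  have := charX (0 + n.+1%:R^-1 *: delta_mx 0 i) 0.
  under eq_Rintegral.
    move=> t _; rewrite dot_shift big1 ?add0r ?addr0; last by move=> j _; rewrite mxE mul0r.
    over.
  move=> ->; rewrite covariance_shift !mul0mx !mxE mulr0 !add0r cos0 mulr1.
  have := expR_ge1Dx (- (n.+1%:R^-1 ^+ 2 * C i i / 2)); set E := expR _ => hE.
  rewrite (_ : C i i = 2 * n.+1%:R ^+ 2 * (n.+1%:R^-1 ^+ 2 * C i i / 2)); last first.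
    by field; rewrite gt_eqF.
  by rewrite ler_wpM2l ?mulr_ge0 ?sqr_ge0// lerBlDr addrC -lerBlDr.
have fat := @fatou _ _ _ P _ measurableT (fun n t => (g n t)%:E)
  (fun n => (measurable_EFinP _ _).2 (mg n)).
apply/integrableP; split.
  apply/measurable_EFinP; exact: measurable_funX.
under eq_integral do rewrite gee0_abs ?lee_fin ?sqr_ge0//.
apply: (@le_lt_trans _ _ (C i i)%:E); last exact: ltry.
rewrite (_ : \int[P]_x (EFin \o _) x = \int[P]_t limn_einf (fun n => (g n t)%:E))%E.
  apply: le_trans (fat _) _; first by move=> n x _; rewrite lee_fin.
  rewrite limn_einf_lim; apply: lime_le; first exact: is_cvg_einfs.
  apply: nearW => n; apply: le_trans (ig n).
  by apply: ereal_inf_lbound; exists n => /=.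
apply: eq_integral => t _; apply/esym; apply: (cvg_limn_einf_sup _).1.
by apply: cvg_EFin; [exact: nearW|exact: gE].
Qed.

Lemma gaussian_integrable i : P.-integrable setT (EFin \o (fun t => X t 0 i)).
Proof.
apply: (@le_dominated_integrable _ _ _ _ _ (fun t => 1 + X t 0 i ^+ 2)) => //.
  move=> t; have := sqr_ge0 (`|X t 0 i| - 1); have := real_normK (num_real (X t 0 i)).
  have := normr_ge0 (X t 0 i).
  by move: `|X t 0 i| => y y0 <- ; nra.
apply: integrableRD; last exact: gaussian_sqr_integrable.
by apply: (@bounded_integrable (cst 1) 1) => // t; rewrite normr1.
Qed.

(** The derivative of the characteristic function in the direction [i]. *)
Lemma gaussian_sin_expectation i xi a :
  \int[P]_t (X t 0 i * sin (\sum_j xi 0 j * X t 0 j + a)) =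
  (xi *m C) 0 i * expR (- ((xi *m C *m xi^T) 0 0 / 2)) * cos a.
Proof.
have D1 : is_derive (0 : R^o) 1 (fun tau : R^o => \int[P]_t
    cos (\sum_j xi 0 j * X t 0 j + a + tau * X t 0 i) : R^o)
    (\int[P]_t (-1 * (X t 0 i * sin (\sum_j xi 0 j * X t 0 j + a + 0 * X t 0 i)))).
  apply: (@is_derive_Rintegral _ _ _ _
    (fun tau t => cos (\sum_j xi 0 j * X t 0 j + a + tau * X t 0 i))
    (fun tau t => -1 * (X t 0 i * sin (\sum_j xi 0 j * X t 0 j + a + tau * X t 0 i)))
    (fun t => `|X t 0 i|)).
  - move=> tau; apply: (@bounded_integrable _ 1).
      apply: (measurableT_comp (@measurable_cos R)).
      apply: measurable_funD; last exact: measurable_funM.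
      by apply: measurable_funD => //; exact: measurable_row_dot.
    by move=> t; rewrite ler_norml cos_geN1 cos_le1.
  - move=> tau t; apply: is_derive_eq; rewrite /GRing.scale /=; ring.
  - exact: integrable_norm (gaussian_integrable i).
  - move=> tau t; rewrite mulN1r normrN normrM ler_piMr//.
    by rewrite ler_norml sin_geN1 sin_le1.
have D2 : is_derive (0 : R^o) 1 (fun tau : R^o => expR
    (- (((xi *m C *m xi^T) 0 0 + 2 * tau * (xi *m C) 0 i + tau ^+ 2 * C i i) / 2))
    * cos a : R^o)
    (- ((xi *m C) 0 i * expR (- ((xi *m C *m xi^T) 0 0 / 2)) * cos a)).
  apply: is_derive_eq; rewrite /GRing.scale /= !(mul0r, mulr0, addr0, expr0n) /=.
  by field.
have FE : (fun tau : R^o => \int[P]_t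
    cos (\sum_j xi 0 j * X t 0 j + a + tau * X t 0 i) : R^o) = (fun tau : R^o => expR
    (- (((xi *m C *m xi^T) 0 0 + 2 * tau * (xi *m C) 0 i + tau ^+ 2 * C i i) / 2))
    * cos a : R^o).
  apply/funext => tau; rewrite -covariance_shift -charX.
  apply: eq_Rintegral => t _; congr cos.
  by rewrite dot_shift addrAC.
have := @derive_val _ _ _ _ _ _ _ D2; rewrite -FE (@derive_val _ _ _ _ _ _ _ D1).
under eq_Rintegral do rewrite mul0r addr0.
rewrite RintegralZl ?mulN1r//; first exact: oppr_inj.
apply: (@integrable_bounded_mul _ _ _ P _ _ 1); first exact: gaussian_integrable.
  apply: (measurableT_comp (@measurable_sin R)).
  by apply: measurable_funD => //; exact: measurable_row_dot.
by move=> t; rewrite ler_norml sin_geN1 sin_le1.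
Qed.

Local Notation unit_weight := (\1_(`[0%R, 1%R]%classic : set R) : R -> R).

Let dot (xi x : 'rV[R]_M) := \sum_j xi 0 j * x 0 j.

Let dotBZ xi x c y : dot xi (x - c *: y) = dot xi x - c * dot xi y.
Proof.
rewrite /dot mulr_sumr -sumrB; apply: eq_bigr => j _; rewrite !mxE; ring.
Qed.

Section direction.
Variable i : 'I_M.
Hypothesis Ci : 0 < C i i.

Let b : 'rV[R]_M := (C i i)^-1 *: row i C.

(** With an independent uniform variable [z] in [[0, 1]], [Y] moves [X] along the
    regression line of [X] on its [i]-th component, from [X] itself at [z = 0] to
    the part of [X] independent of [X_i] at [z = 1]. *)
Let Y (x : T * R) : 'rV[R]_M := X x.1 - (x.2 * X x.1 0 i) *: b.

Let k (t : T) : R := (C i i)^-1 * X t 0 i ^+ 2.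

Let ik : P.-integrable setT (EFin \o k).
Proof. exact/integrableRZ/gaussian_sqr_integrable. Qed.

Let dotb xi : dot xi b = (C i i)^-1 * (xi *m C) 0 i.
Proof.
rewrite /dot mxE mulr_sumr; apply: eq_bigr => j _; rewrite !mxE.
by case: gX => _ CT _; rewrite -{2}CT mxE; ring.
Qed.

Let mY j : measurable_fun setT (fun x => Y x 0 j).
Proof.
rewrite (_ : (fun x => _) = (fun x : T * R => X x.1 0 j - x.2 * X x.1 0 i * b 0 j)).
  have m1 l : measurable_fun setT (fun x : T * R => X x.1 0 l).
    exact: (measurableT_comp (mX l) measurable_fst).
  apply: measurable_funB => //; apply: measurable_funM => //.
  exact: (measurable_funM measurable_snd).
by apply/funext => x; rewrite !mxE.
Qed.

Let cos_bound (f : T * R -> R) x : `|cos (f x)| <= 1.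
Proof. by rewrite ler_norml cos_geN1 cos_le1. Qed.

Let mcos xi a : measurable_fun setT (fun x => cos (dot xi (Y x) + a)).
Proof.
apply: (measurableT_comp (@measurable_cos R)); apply: measurable_funD => //.
exact: measurable_row_dot.
Qed.

(** Under the weight [X_i^2 / C_ii], the interpolation [Y] has the law of [X].
    For the characteristic function, the integral in [z] is explicit and leads
    back to [gaussian_sin_expectation]; it divides by [<xi, b>], whence the
    hypothesis. *)
Let gaussian_cos_average_neq0 xi a : (xi *m C) 0 i != 0 ->
  \int[(P \x @lebesgue_measure R)%E]_x
    (k x.1 * unit_weight x.2 * cos (dot xi (Y x) + a)) =
  expR (- ((xi *m C *m xi^T) 0 0 / 2)) * cos a.
Proof.
move=> xi0; pose be := dot xi b.
have be0 : be != 0 by rewrite /be dotb mulf_neq0// invr_eq0 gt_eqF.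
have [_ ->] := fubini_unit ik (mcos xi a) (cos_bound (fun x => dot xi (Y x) + a)).
rewrite (_ : (fun t => _) = (fun t => (C i i * be)^-1 *
  (X t 0 i * sin (dot xi (X t) + a) -
   X t 0 i * sin (dot (xi + (- be) *: delta_mx 0 i) (X t) + a)))); last first.
  apply/funext => t; set om : R := X t 0 i; set c : R := dot xi (X t) + a.
  have -> : dot (xi + (- be) *: delta_mx 0 i) (X t) = dot xi (X t) + - be * om.
    exact: dot_shift.
  have cc : continuous (fun z : R => cos (c - z * om * be)).
    move=> z; apply: (@cvg_comp _ _ _ (fun z : R => c - z * om * be) (@cos R) _
      (nbhs (c - z * om * be))); last exact: continuous_cos.
    apply: cvgB; first exact: cvg_cst.
    by apply: cvgM; [apply: cvgM; [exact: cvg_id|]|]; exact: cvg_cst.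
  have E : \int[@lebesgue_measure R]_(z in `[0%R, 1%R]) (om * cos (c - z * om * be)) =
      be^-1 * (sin c - sin (c - om * be)).
    pose F z := - be^-1 * sin (c - z * om * be).
    transitivity (F 1 - F 0); last by rewrite /F mul1r !mul0r subr0; ring.
    apply: FTC_unit.
    - move=> z; apply: is_derive_eq; rewrite /GRing.scale /=; field.
      exact: be0.
    - by move=> z; apply: cvgM; [exact: cvg_cst|exact: cc].
  have cI : (@lebesgue_measure R).-integrable `[0%R, 1%R]
      (EFin \o (fun z => cos (c - z * om * be))).
    apply: continuous_compact_integrable; first exact: segment_compact.
    exact: continuous_subspaceT.
  rewrite (_ : \int[_]_(z in _) _ =
      \int[@lebesgue_measure R]_(z in `[0%R, 1%R]) cos (c - z * om * be)); last first.
    by apply: eq_Rintegral => z _; rewrite /Y dotBZ /= /c; congr cos; rewrite /om /be; ring.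
  rewrite RintegralZl// in E.
  rewrite /k -/om expr2 -mulrA -[om * om * _]mulrA E invfM.
  by rewrite (_ : _ + - be * om + a = c - om * be); [ring|rewrite /c; ring].
have isin eta : P.-integrable setT (EFin \o (fun t => X t 0 i * sin (dot eta (X t) + a))).
  apply: (@integrable_bounded_mul _ _ _ P _ _ 1); first exact: gaussian_integrable.
    apply: (measurableT_comp (@measurable_sin R)).
    by apply: measurable_funD => //; exact: measurable_row_dot.
  by move=> t; rewrite ler_norml sin_geN1 sin_le1.
rewrite RintegralZl//; last exact: integrableRB.
rewrite RintegralB// !gaussian_sin_expectation.
have -> : ((xi + (- be) *: delta_mx 0 i) *m C) 0 i = 0.
  rewrite mulmxDl -scalemxAl -rowE.
  rewrite mxE [X in _ + X]mxE [X in _ * X]mxE /be dotb.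
  by field; rewrite gt_eqF.
by rewrite /be dotb; field; rewrite xi0 gt_eqF.
Qed.

Let weight_integrable (h : T -> R) : P.-integrable setT (EFin \o h) ->
  (P \x @lebesgue_measure R)%E.-integrable setT
    (EFin \o (fun x => h x.1 * unit_weight x.2)).
Proof.
move=> ih; have [|] := @fubini_unit _ _ _ _ _ (cst 1) 1 ih (measurable_cst _).
  by move=> x; rewrite normr1.
by move=> + _; apply: eq_integrable => // x _ /=; rewrite mulr1.
Qed.

(** The degenerate directions are limits of the others. *)
Let gaussian_cos_average xi a :
  \int[(P \x @lebesgue_measure R)%E]_x
    (k x.1 * unit_weight x.2 * cos (dot xi (Y x) + a)) =
  expR (- ((xi *m C *m xi^T) 0 0 / 2)) * cos a.
Proof.
have [xi0|] := eqVneq ((xi *m C) 0 i) 0; last exact: gaussian_cos_average_neq0.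
(* Perturbing [xi] in the direction [i] changes [(xi C)_i] by [C_ii / n]. *)
pose xi_ n := xi + n.+1%:R^-1 *: delta_mx 0 i.
have xi_0 n : (xi_ n *m C) 0 i != 0.
  rewrite mulmxDl -scalemxAl -rowE mxE [X in _ + X]mxE [X in _ * X]mxE xi0 add0r.
  by rewrite mulf_neq0 ?invr_eq0 ?gt_eqF.
have mk : measurable_fun setT k by apply/measurable_EFinP; exact: measurable_int ik.
have [||||_] := @dominated_cvg_Rintegral _ _ _ (P \x @lebesgue_measure R)%E
  (fun n x => k x.1 * unit_weight x.2 * cos (dot (xi_ n) (Y x) + a))
  (fun x => k x.1 * unit_weight x.2 * cos (dot xi (Y x) + a))
  (fun x => k x.1 * unit_weight x.2).
- move=> n; apply: measurable_funM; last exact: mcos.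
  by have := weight_integrable ik => /measurable_int/measurable_EFinP.
- move=> n x; have w0 : 0 <= k x.1 * unit_weight x.2.
    by rewrite mulr_ge0 ?indicE ?ler0n// mulr_ge0 ?sqr_ge0// invr_ge0 ltW.
  by rewrite normrM (ger0_norm w0) ler_piMr// (cos_bound (fun x => dot (xi_ n) (Y x) + a)).
- exact: weight_integrable.
- move=> x; apply: cvgM; first exact: cvg_cst.
  apply: (@cvg_comp _ _ _ (fun n => dot (xi_ n) (Y x) + a) (@cos R) _
    (nbhs (dot xi (Y x) + a))); last exact: continuous_cos.
  apply: cvgD; last exact: cvg_cst.
  rewrite (_ : (fun n => _) = (fun n => dot xi (Y x) + n.+1%:R^-1 * Y x 0 i)).
    rewrite -[X in _ --> X](_ : dot xi (Y x) + 0 * Y x 0 i = _); last first.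
      by rewrite mul0r addr0.
    apply: cvgD; first exact: cvg_cst.
    by apply: cvgM; [exact: cvg_harmonic|exact: cvg_cst].
  by apply/funext => n; exact: dot_shift.
- under eq_fun do rewrite gaussian_cos_average_neq0//.
  move=> h; apply: (cvg_unique _ h) => //.
  apply: cvgM; last exact: cvg_cst.
  apply: (@cvg_comp _ _ _ (fun n => - ((xi_ n *m C *m (xi_ n)^T) 0 0 / 2)) (@expR R) _
    (nbhs (- ((xi *m C *m xi^T) 0 0 / 2)))); last exact: continuous_expR.
  have h2 : (fun n => (xi_ n *m C *m (xi_ n)^T) 0 0) @ \oo --> (xi *m C *m xi^T) 0 0.
    rewrite (_ : (fun n => _) = (fun n => (xi *m C *m xi^T) 0 0 +
        n.+1%:R^-1 * n.+1%:R^-1 * C i i)); last first.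
      by apply/funext => n; rewrite covariance_shift xi0 mulr0 addr0 expr2.
    rewrite -[X in _ --> X](_ : (xi *m C *m xi^T) 0 0 + 0 * 0 * C i i = _); last first.
      by rewrite !mul0r addr0.
    apply: cvgD; first exact: cvg_cst.
    by apply: cvgM; [apply: cvgM; exact: cvg_harmonic|exact: cvg_cst].
  by apply: cvgN; apply: cvgM; [exact: h2|exact: cvg_cst].
Qed.

(** [X_i] is centred and independent of [X - X_i b]. *)
Let shift_mean_zero (f : 'rV[R]_M -> R) (B : R) : continuous f ->
  (forall x, `|f x| <= B) ->
  \int[P]_t (X t 0 i * f (X t - X t 0 i *: b)) = 0.
Proof.
move=> cf fB.
have mZ j : measurable_fun setT (fun t => (X t - X t 0 i *: b) 0 j).
  rewrite (_ : (fun t => _) = (fun t => X t 0 j - X t 0 i * b 0 j)).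
    by apply: measurable_funB => //; exact: measurable_funM.
  by apply/funext => t; rewrite !mxE.
have i0 : P.-integrable setT (EFin \o (cst 0 : T -> R)).
  by apply: (@bounded_integrable _ 0) => // t; rewrite normr0.
rewrite (@characteristic_function_unique _ _ _ _ P (fun t => X t 0 i) (cst 0)
  (fun t => X t - X t 0 i *: b) X (gaussian_integrable i) i0 mZ mX _ f B)//.
  by under eq_Rintegral do rewrite mul0r; rewrite Rintegral_cst// mul0r.
move=> xi a.
under [RHS]eq_Rintegral do rewrite mul0r.
rewrite Rintegral_cst// mul0r.
have := gaussian_sin_expectation i (xi + (- dot xi b) *: delta_mx 0 i) (a + pi / 2).
have -> : ((xi + (- dot xi b) *: delta_mx 0 i) *m C) 0 i = 0.
  rewrite mulmxDl -scalemxAl -rowE mxE [X in _ + X]mxE [X in _ * X]mxE dotb.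
  by field; rewrite gt_eqF.
rewrite !mul0r => E; rewrite -[RHS]E; apply: eq_Rintegral => t _.
rewrite dot_shift -/(dot _ _) addrA sinD cos_pihalf sin_pihalf mulr0 add0r mulr1.
congr (_ * cos _); rewrite -/(dot xi (X t - X t 0 i *: b)) dotBZ -/(dot xi (X t)); ring.
Qed.

(** Since [X] has the law of [Y] under the weight [X_i^2 / C_ii], the expectation
    of [g (X)] is that of [X_i^2 / C_ii] times the integral of [g (Y)] in [z].
    As [g] is the derivative of [f] along the direction of interpolation, this
    integral is a difference of values of [f], which turns the product into
    [X_i (f (X) - f (X - X_i b))]; the second term has mean zero. *)
Lemma gaussian_integration_by_parts (f g : 'rV[R]_M -> R) (Bf Bg : R) :
  continuous f -> (forall x, `|f x| <= Bf) ->
  continuous g -> (forall x, `|g x| <= Bg) ->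
  (forall x, is_derive x (row i C) (f : _ -> R^o) (g x)) ->
  \int[P]_t (X t 0 i * f (X t)) = \int[P]_t g (X t).
Proof.
move=> cf fB cg gB dfg.
have i1 : P.-integrable setT (EFin \o (cst 1 : T -> R)).
  by apply: (@bounded_integrable _ 1) => // t; rewrite normr1.
have mgX (Z : T * R -> 'rV[R]_M) : (forall j, measurable_fun setT (fun x => Z x 0 j)) ->
    measurable_fun setT (g \o Z).
  by move=> mZ; exact: (measurable_row_comp mZ cg gB).
have mX1 l : measurable_fun setT (fun x : T * R => X x.1 0 l).
  exact: (measurableT_comp (mX l) measurable_fst).
have iu := weight_integrable i1.
have key : \int[(P \x @lebesgue_measure R)%E]_x (cst 1 x.1 * unit_weight x.2 * g (X x.1)) =
    \int[(P \x @lebesgue_measure R)%E]_x (k x.1 * unit_weight x.2 * g (Y x)).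
  apply: (characteristic_function_unique iu (weight_integrable ik) mX1 mY _ cg gB) => // xi a.
  rewrite gaussian_cos_average -charX.
  have mc : measurable_fun setT (fun x : T * R => cos (dot xi (X x.1) + a)).
    apply: (measurableT_comp (@measurable_cos R)); apply: measurable_funD => //.
    exact: (measurable_row_dot _ mX1).
  have [_ ->] := fubini_unit i1 mc (cos_bound (fun x => dot xi (X x.1) + a)).
  apply: eq_Rintegral => t _; rewrite mul1r.
  by rewrite /= Rintegral_unit_cst.
have [_ E1] := fubini_unit i1 (mgX (X \o fst) mX1) (fun x => gB (X x.1)).
have [_ E2] := fubini_unit ik (mgX Y mY) (fun x => gB (Y x)).
rewrite E1 E2 in key.
have inner t : k t * \int[@lebesgue_measure R]_(z in `[0%R, 1%R]) g (Y (t, z)) =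
    X t 0 i * (f (X t) - f (X t - X t 0 i *: b)).
  pose ka : R := - (X t 0 i * (C i i)^-1).
  pose F y := f (X t + y *: row i C).
  have YE z : Y (t, z) = X t + (ka * z) *: row i C.
    rewrite /Y /= /b scalerA -scaleNr; congr (_ + _ *: _); rewrite /ka; ring.
  have dF z : is_derive (z : R^o) 1 (fun z : R^o => F (ka * z) : R^o) (ka * g (Y (t, z))).
    have dF' : is_derive (ka * z : R^o) 1 (F : R^o -> R^o) (g (Y (t, z))).
      by apply: is_derive_line; rewrite YE; exact: dfg.
    have dlin : is_derive (z : R^o) 1 (fun z : R^o => ka * z : R^o) ka.
      by apply: is_derive_eq; rewrite /GRing.scale /=; ring.
    rewrite mulrC; exact: (@is_derive1_comp _ F (fun z => ka * z) z _ _ dF' dlin).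
  have cY : continuous (fun z => g (Y (t, z))).
    move=> z; apply: (@cvg_comp _ _ _ (fun z => Y (t, z)) g _ (nbhs (Y (t, z))));
      last exact: cg.
    apply: cvg_row => j; rewrite /Y /=.
    have E (y : R) : (X t - (y * X t 0 i) *: b) 0 j = X t 0 j - y * X t 0 i * b 0 j.
      by rewrite !mxE.
    rewrite E; under eq_fun do rewrite E.
    apply: cvgB; first exact: cvg_cst.
    by apply: cvgM; [apply: cvgM; [exact: cvg_id|exact: cvg_cst]|exact: cvg_cst].
  have := @FTC_unit _ _ _ dF (fun z => cvgM (@cvg_cst _ ka _ (nbhs z) _) (cY z)).
  rewrite RintegralZl//; last first.
    apply: continuous_compact_integrable; first exact: segment_compact.
    exact: continuous_subspaceT.
  rewrite /F mulr1 mulr0 scale0r addr0 => E.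
  have -> : X t - X t 0 i *: b = X t + ka *: row i C.
    by rewrite /b scalerA -scaleNr.
  rewrite /k -opprB -E /ka; ring.
have ibX (h : T -> R) : measurable_fun setT h -> (forall t, `|h t| <= Bf) ->
    P.-integrable setT (EFin \o (fun t => X t 0 i * h t)).
  by move=> mh hB; apply: integrable_bounded_mul mh hB; exact: gaussian_integrable.
have fin1 : P.-integrable setT (EFin \o (fun t => X t 0 i * f (X t))).
  by apply: ibX => //; exact: measurable_row_comp cf fB.
have fin2 : P.-integrable setT (EFin \o (fun t => X t 0 i * f (X t - X t 0 i *: b))).
  apply: ibX => //; apply: (measurable_row_comp _ cf fB) => j.
  rewrite (_ : (fun t => _) = (fun t => X t 0 j - X t 0 i * b 0 j)).
    by apply: measurable_funB => //; exact: measurable_funM.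
  by apply/funext => t; rewrite !mxE.
transitivity (\int[P]_t (X t 0 i * f (X t) - X t 0 i * f (X t - X t 0 i *: b))).
  by rewrite RintegralB// (shift_mean_zero cf fB) subr0.
transitivity (\int[P]_t (k t * \int[@lebesgue_measure R]_(z in `[0%R, 1%R]) g (Y (t, z)))).
  by apply: eq_Rintegral => t _; rewrite inner mulrBr.
rewrite -key; apply: eq_Rintegral => t _; rewrite mul1r /=.
by rewrite Rintegral_unit_cst.
Qed.

End direction.

End gaussian_vector.

(** * Partial derivatives: chain rule and symmetry of the Hessian *)

Section partial_derivatives.
Context (R : realType) (m : nat).
Implicit Types (phi : 'rV[R]_m -> R) (x : 'rV[R]_m).

Definition partial (j : 'I_m) phi x : R := 'D_(delta_mx 0 j) (phi : _ -> R^o) x.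

Definition C1 phi : Prop := forall j,
  (forall x, derivable (phi : _ -> R^o) x (delta_mx 0 j)) /\
  continuous (partial j phi).

Lemma mean_value_partial phi j x t :
  (forall x, derivable (phi : _ -> R^o) x (delta_mx 0 j)) ->
  exists2 c, `|c| <= `|t| &
    phi (x + t *: delta_mx 0 j) - phi x =
    t * partial j phi (x + c *: delta_mx 0 j).
Proof.
move=> dphi.
pose F y := phi (x + y *: delta_mx 0 j).
have dF z : is_derive (z : R^o) 1 (F : R^o -> R^o) (partial j phi (x + z *: delta_mx 0 j)).
  by apply: is_derive_line; exact: derivableP.
have cF : continuous F.
  move=> y; apply: differentiable_continuous; apply/derivable1_diffP.
  exact: ex_derive.
have F0 : F 0 = phi x by rewrite /F scale0r addr0.
have [t0|t0|->] := ltgtP t 0.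
- have [|c + E] := @MVT_segment _ F _ _ _ (ltW t0) (fun z _ => dF z).
    exact: continuous_subspaceT.
  rewrite in_itv /= => /andP[tc c0]; exists c.
    by rewrite (ler0_norm c0) (ltr0_norm t0) lerN2.
  by rewrite -F0 -opprB E sub0r; ring.
- have [|c + E] := @MVT_segment _ F _ _ _ (ltW t0) (fun z _ => dF z).
    exact: continuous_subspaceT.
  rewrite in_itv /= => /andP[tc c0]; exists c.
    by rewrite (ger0_norm tc) (gtr0_norm t0).
  by rewrite -F0 E subr0; ring.
- by exists 0 => //; rewrite scale0r addr0 subrr mul0r.
Qed.

(** The increment vanishes at [t], so the difference quotient is the quotient of
    [u] times [a], whatever the value of [a] at [t]. *)
Lemma is_derive_increment_mul (u a : R -> R) (t d al : R) :
  is_derive (t : R^o) 1 (u : R^o -> R^o) d -> a s @[s --> t] --> al ->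
  is_derive (t : R^o) 1 (fun s : R^o => (u s - u t) * a s : R^o) (d * al).
Proof.
move=> du aal.
have ql : (fun h : R => h^-1 *: (((u (h *: 1 + t) - u t) * a (h *: 1 + t) : R^o) -
    ((u t - u t) * a t : R^o))) @ 0^' --> d * al.
  rewrite (_ : (fun h => _) = (fun h : R =>
      (h^-1 *: ((u (h *: 1 + t) : R^o) - (u t : R^o))) * a (h *: 1 + t))).
    apply: cvgM.
      have := @ex_derive _ _ _ _ _ _ _ du; rewrite -(@derive_val _ _ _ _ _ _ _ du).
      by [].
    apply: (@cvg_comp _ _ _ (fun h : R => h *: 1 + t) a _ (nbhs t)) => //.
    apply: (@cvg_within_filter _ _ _ (nbhs (0:R))).
    rewrite (_ : (fun h : R => h *: 1 + t) = (fun h => h + t)); last first.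
      by apply/funext => h; rewrite [h *: 1]mulr1.
    have : (h + t) @[h --> (0 : R)] --> 0 + t.
      by apply: cvgD; [exact: cvg_id|exact: cvg_cst].
    by rewrite add0r.
  by apply/funext => h; rewrite subrr mul0r subr0 /GRing.scale /= mulrA.
split; first by apply/cvg_ex; exists (d * al).
exact: cvg_lim ql.
Qed.

(** The coordinates are released one at a time: the mean value theorem in the
    released coordinate gives a factor [partial i phi] at an intermediate point
    tending to [y t]. *)
Lemma is_derive_curve phi (y : R -> 'rV[R]_m) (y' : 'I_m -> R) (t : R) :
  C1 phi ->
  (forall j, is_derive (t : R^o) 1 (fun s : R^o => y s 0 j : R^o) (y' j)) ->
  is_derive (t : R^o) 1 (fun s : R^o => phi (y s) : R^o)
    (\sum_j partial j phi (y t) * y' j).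
Proof.
move=> C1phi dy.
(* The first [n] coordinates follow the curve, the others stay at time [t]. *)
pose mix n s : 'rV[R]_m := \row_j (if (j < n)%N then y s 0 j else y t 0 j).
suff S n : (n <= m)%N -> is_derive (t : R^o) 1 (fun s : R^o => phi (mix n s) : R^o)
    (\sum_(j < m | (j < n)%N) partial j phi (y t) * y' j).
  have := S m (leqnn m).
  rewrite (_ : (fun s => _) = (fun s => phi (y s))); last first.
    by apply/funext => s; congr phi; apply/rowP => j; rewrite mxE ltn_ord.
  by under eq_bigl do rewrite ltn_ord.
have cy j : y s 0 j @[s --> t] --> y t 0 j.
  have := @ex_derive _ _ _ _ _ _ _ (dy j).
  by move/derivable1_diffP/differentiable_continuous.
elim: n => [_|n IH nm].
  rewrite big_pred0//.
  rewrite (_ : (fun s => _) = cst (phi (y t))); first exact: is_derive_cst.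
  by apply/funext => s; congr phi; apply/rowP => j; rewrite mxE.
pose i := Ordinal nm.
have /choice[th thP] : forall s, exists c, `|c| <= `|y s 0 i - y t 0 i| /\
    phi (mix n.+1 s) - phi (mix n s) =
    (y s 0 i - y t 0 i) * partial i phi (mix n s + c *: delta_mx 0 i).
  move=> s; have [c cle E] := mean_value_partial (mix n s) (y s 0 i - y t 0 i) (C1phi i).1.
  exists c; split => //; rewrite -E; congr (phi _ - _).
  apply/rowP => j; rewrite !mxE ltnS eqxx /=.
  case: (ltngtP (j : nat) n) => jn.
  - by rewrite (_ : (j == i) = false) ?mulr0 ?addr0//; apply/negbTE/eqP => ji; move: jn; rewrite ji ltnn.
  - by rewrite (_ : (j == i) = false) ?mulr0 ?addr0//; apply/negbTE/eqP => ji; move: jn; rewrite ji ltnn.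
  - by rewrite (_ : j = i) ?eqxx ?mulr1 1?addrC ?subrK//; exact/val_inj.
have th0 : th s @[s --> t] --> 0.
  apply: norm_cvg0; apply: (@squeeze_cvgr _ _ _ _ (cst 0) (fun s => `|y s 0 i - y t 0 i|)).
  - by apply: nearW => s; rewrite normr_ge0 /=; case: (thP s).
  - exact: cvg_cst.
  - have : `|y s 0 i - y t 0 i| @[s --> t] --> `|y t 0 i - y t 0 i|.
      by apply: cvg_norm; apply: cvgB; [exact: cy|exact: cvg_cst].
    by rewrite subrr normr0.
have a_cvg : partial i phi (mix n s + th s *: delta_mx 0 i) @[s --> t] --> partial i phi (y t).
  apply: (@cvg_comp _ _ _ (fun s => mix n s + th s *: delta_mx 0 i) (partial i phi) _
    (nbhs (y t))); last exact: ((C1phi i).2 (y t)).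
  apply: cvg_row => j.
  have mixj : mix n s 0 j @[s --> t] --> y t 0 j.
    under eq_fun do rewrite mxE.
    by case: (j < n)%N; [exact: cy|exact: cvg_cst].
  have : mix n s 0 j + th s * (delta_mx 0 i : 'rV[R]_m) 0 j @[s --> t] -->
      y t 0 j + 0 * (delta_mx 0 i : 'rV[R]_m) 0 j.
    by apply: cvgD => //; apply: cvgM; [exact: th0|exact: cvg_cst].
  rewrite mul0r addr0 (_ : (fun s => (mix n s + _) 0 j) =
    (fun s => mix n s 0 j + th s * (delta_mx 0 i : 'rV[R]_m) 0 j))//.
  by apply/funext => s; rewrite mxE [X in _ + X]mxE.
have -> : (fun s : R^o => phi (mix n.+1 s) : R^o) = (fun s => phi (mix n s)) +
    (fun s => (y s 0 i - y t 0 i) * partial i phi (mix n s + th s *: delta_mx 0 i)).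
  by apply/funext => s; have [_ E] := thP s; rewrite [RHS]/GRing.add /= -E addrC subrK.
have -> : \sum_(j < m | (j < n.+1)%N) partial j phi (y t) * y' j =
    \sum_(j < m | (j < n)%N) partial j phi (y t) * y' j + y' i * partial i phi (y t).
  rewrite (bigD1 i)//= addrC [X in _ + X]mulrC; congr (_ + _); apply: eq_bigl => j.
  rewrite ltnS; case: (ltngtP (j : nat) n) => jn //=.
  - by apply/eqP => ji; move: jn; rewrite ji ltnn.
  - by rewrite (_ : j = i) ?eqxx//; exact/val_inj.
apply: is_deriveD; first exact: (IH (ltnW nm)).
exact: (is_derive_increment_mul (dy i) a_cvg).
Qed.

Lemma is_derive_translate phi x v c (d : R) :
  is_derive (x + c) v (phi : _ -> R^o) d ->
  is_derive x v (fun z => phi (z + c) : R^o) d.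
Proof.
move=> df.
have E : (fun h : R => h^-1 *: ((phi (h *: v + x + c) : R^o) - (phi (x + c) : R^o))) =
    (fun h : R => h^-1 *: ((phi (h *: v + (x + c)) : R^o) - (phi (x + c) : R^o))).
  by apply/funext => h; rewrite addrA.
split; first by have := @ex_derive _ _ _ _ _ _ _ df; rewrite /derivable /= E.
by rewrite /derive E; exact: derive_val.
Qed.

(** The mean value theorem applied first to the increment of [phi] in the
    direction [j], then to its [i]-th partial derivative. *)
Lemma second_difference phi (i j : 'I_m) x (t : R) : 0 <= t -> C1 phi -> C1 (partial i phi) ->
  exists2 p : 'rV[R]_m, forall l, `|p 0 l - x 0 l| <= t + t &
    phi (x + t *: delta_mx 0 i + t *: delta_mx 0 j) - phi (x + t *: delta_mx 0 i) -
    (phi (x + t *: delta_mx 0 j) - phi x) =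
    t ^+ 2 * partial j (partial i phi) p.
Proof.
move=> t0 C1phi C1i.
pose psi z := phi (z + t *: delta_mx 0 j) - phi z.
have dpsi z : is_derive z (delta_mx 0 i) (psi : _ -> R^o)
    (partial i phi (z + t *: delta_mx 0 j) - partial i phi z).
  apply: is_deriveB; last exact: derivableP ((C1phi i).1 z).
  by apply: is_derive_translate; exact: derivableP ((C1phi i).1 _).
have [a ale E1] := mean_value_partial x t (fun z => @ex_derive _ _ _ _ _ _ _ (dpsi z)).
have [b ble E2] := mean_value_partial (x + a *: delta_mx 0 i) t (C1i j).1.
exists (x + a *: delta_mx 0 i + b *: delta_mx 0 j).
  have d1 k l : `|(delta_mx 0 k : 'rV[R]_m) 0 l| <= 1.
    by rewrite mxE; case: (_ && _); rewrite ?normr1 ?normr0.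
  move=> l; rewrite -addrA [X in X - _]mxE addrAC subrr add0r mxE.
  rewrite (le_trans (ler_normD _ _))//; apply: lerD; rewrite mxE normrM.
    rewrite -(ger0_norm t0) (le_trans _ ale)// ler_piMr//.
  rewrite -(ger0_norm t0) (le_trans _ ble)// ler_piMr//.
have Epsi z : partial i psi z = partial i phi (z + t *: delta_mx 0 j) - partial i phi z.
  exact: derive_val.
by rewrite -[LHS]/(psi (x + t *: delta_mx 0 i) - psi x) E1 Epsi E2 mulrA expr2.
Qed.

(** The second difference is symmetric in the two directions, and tends to either
    iterated derivative after division by the square of the step. *)
Lemma partial_comm phi (i j : 'I_m) x : C1 phi -> C1 (partial i phi) -> C1 (partial j phi) ->
  partial j (partial i phi) x = partial i (partial j phi) x.
Proof.
move=> C1phi C1i C1j.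
have /choice[pq pqP] : forall n, exists pq : 'rV[R]_m * 'rV[R]_m,
    [/\ forall l, `|pq.1 0 l - x 0 l| <= n.+1%:R^-1 + n.+1%:R^-1,
      forall l, `|pq.2 0 l - x 0 l| <= n.+1%:R^-1 + n.+1%:R^-1 &
      partial j (partial i phi) pq.1 = partial i (partial j phi) pq.2].
  move=> n; have t0 : 0 < n.+1%:R^-1 :> R by rewrite invr_gt0 ltr0n.
  have [p pP Ep] := second_difference j x (ltW t0) C1phi C1i.
  have [q qP Eq] := second_difference i x (ltW t0) C1phi C1j.
  exists (p, q); split; [exact: pP|exact: qP|].
  apply: (@mulfI _ (n.+1%:R^-1 ^+ 2)); first by rewrite expf_neq0// gt_eqF.
  (* The second difference is symmetric in [i] and [j]. *)
  have swap (A B D E : R) : A - B - (D - E) = A - D - (B - E) by ring.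
  apply: etrans (esym Ep) (etrans _ Eq); apply: etrans (swap _ _ _ _) _.
  by congr (phi _ - _ - _); rewrite addrAC.
have to_x (p : nat -> 'rV[R]_m) :
    (forall n l, `|p n 0 l - x 0 l| <= n.+1%:R^-1 + n.+1%:R^-1) -> p @ \oo --> x.
  move=> px; apply: cvg_row => l; apply/subr_cvg0; apply: norm_cvg0.
  apply: (@squeeze_cvgr _ _ _ _ (cst 0) (fun n => @harmonic R n + @harmonic R n)).
  - by apply: nearW => n; rewrite normr_ge0 /= px.
  - exact: cvg_cst.
  - by rewrite -[X in _ --> X]addr0; apply: cvgD; exact: cvg_harmonic.
have lim_to (g : 'rV[R]_m -> R) (p : nat -> 'rV[R]_m) : continuous g ->
    p @ \oo --> x -> g (p n) @[n --> \oo] --> g x.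
  by move=> cg px; apply: (@cvg_comp _ _ _ p g _ (nbhs x)) => //; exact: cg.
have l1 := lim_to _ _ (C1i j).2 (to_x (fun n => (pq n).1) (fun n => let: And3 h _ _ := pqP n in h)).
have l2 := lim_to _ _ (C1j i).2 (to_x (fun n => (pq n).2) (fun n => let: And3 _ h _ := pqP n in h)).
apply: (cvg_unique (@norm_hausdorff _ R^o) l1).
apply: cvg_trans l2; apply: near_eq_cvg; apply: nearW => n.
by case: (pqP n) => _ _ ->.
Qed.

End partial_derivatives.

Section smooth_functions.
Context (R : realType) (m : nat).
Implicit Types (phi : 'rV[R]_m -> R) (x : 'rV[R]_m).

(** The derivative applied first is the last of the list, so derivatives of
    [partial j phi] are derivatives of [phi] along a longer list. *)
Lemma iter_partial_rcons phi js j :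
  iter_partial phi (rcons js j) = iter_partial (partial j phi) js.
Proof. by rewrite /iter_partial foldr_rcons. Qed.

Lemma smooth_C1 phi : smooth phi -> C1 phi.
Proof.
move=> sphi j; split; first by have [_] := sphi [::]; exact.
by have [] := sphi [:: j].
Qed.

Lemma smooth_partial phi j : smooth phi -> smooth (partial j phi).
Proof. by move=> sphi js; have := sphi (rcons js j); rewrite iter_partial_rcons. Qed.

Lemma smooth_continuous phi : smooth phi -> continuous phi.
Proof. by move=> sphi; have [] := sphi [::]. Qed.

Lemma smooth_bounded_partial phi j : smooth_bounded phi -> smooth_bounded (partial j phi).
Proof.
move=> [sphi bphi]; split; first exact: smooth_partial.
by move=> js; have := bphi (rcons js j); rewrite iter_partial_rcons.
Qed.

(** Every derivative vanishes off the closure of the support, on which it is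
    bounded by compactness. *)
Lemma smooth_compact_bounded phi : smooth_compact phi -> smooth_bounded phi.
Proof.
move=> [sphi cS]; split => // js; set S := closure _ in cS.
have g0 x : ~ S x -> iter_partial phi js x = 0.
  elim: js x => [|j js IH] x Sx /=.
    by apply: contrapT => /eqP phix; apply: Sx; exact: subset_closure.
  rewrite (@near_eq_derive _ _ _ _ (cst 0)) ?derive_cst//.
  apply: filterS (open_nbhs_nbhs (conj (closed_openC (@closed_closure _ _)) Sx)).
  by move=> z; exact: IH.
have [cg _] := sphi js.
have /compact_bounded[B [_ gB]] := continuous_compact (continuous_subspaceT cg) cS.
exists (`|B| + 1) => x.
have [Sx|Sx] := pselect (S x); last by rewrite (g0 x Sx) normr0 addr_ge0.
apply: gB; last by exists x.
by rewrite (le_lt_trans (ler_norm B))// ltrDl.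
Qed.

End smooth_functions.

(** * Stein's formula for a product of two cylindrical factors *)

Section bounded_continuous.
Context (T : topologicalType) (R : realType).
Implicit Types f g : T -> R.

Definition bounded_continuous f :=
  continuous (f : T -> R^o) /\ exists B : R, forall x, `|f x| <= B.

Lemma bounded_continuous_cst c : bounded_continuous (fun=> c).
Proof. by split=> [x|]; [exact: cvg_cst|exists `|c|]. Qed.

Lemma bounded_continuousD f g : bounded_continuous f -> bounded_continuous g ->
  bounded_continuous (fun x => f x + g x).
Proof.
move=> [cf [B fB]] [cg [B' gB]]; split=> [x|].
  by apply: (@cvgD _ R^o); [exact: cf|exact: cg].
by exists (B + B') => x; rewrite (le_trans (ler_normD _ _))// lerD.
Qed.

Lemma bounded_continuousM f g : bounded_continuous f -> bounded_continuous g ->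
  bounded_continuous (fun x => f x * g x).
Proof.
move=> [cf [B fB]] [cg [B' gB]]; split=> [x|].
  by apply: cvgM; [exact: cf|exact: cg].
by exists (B * B') => x; rewrite normrM ler_pM.
Qed.

Lemma bounded_continuous_sum (I : Type) (r : seq I) (F : I -> T -> R) :
  (forall i, bounded_continuous (F i)) -> bounded_continuous (fun x => \sum_(i <- r) F i x).
Proof.
move=> bF; elim: r => [|i r IH].
  by under eq_fun do rewrite big_nil; exact: bounded_continuous_cst.
by under eq_fun do rewrite big_cons; exact: bounded_continuousD.
Qed.

End bounded_continuous.

Lemma bounded_continuous_comp (S T : topologicalType) (R : realType) (f : T -> R) (g : S -> T) :
  continuous g -> bounded_continuous f -> bounded_continuous (fun x => f (g x)).
Proof.
move=> cg [cf [B fB]]; split; last by exists B => x; exact: fB.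
by move=> x; apply: (@continuous_comp _ _ _ g f); [exact: cg|exact: cf].
Qed.

Section product_rule.
Context (R : realType) (M m n : nat) (p : 'I_m -> 'I_M) (q : 'I_n -> 'I_M).
Variables (phi : 'rV[R]_m -> R) (eta : 'rV[R]_n -> R) (psi psi' : R -> R).
Hypotheses (phiC1 : C1 phi) (etaC1 : C1 eta).
Hypothesis psi_derive : forall x, is_derive (x : R^o) 1 (psi : R^o -> R^o) (psi' x).

Lemma colsub_continuous N (r : 'I_N -> 'I_M) :
  continuous (colsub r : 'rV[R]_M -> 'rV[R]_N).
Proof.
move=> x; apply: (@cvg_row _ _ _ (nbhs x) _) => j; rewrite mxE.
under eq_fun do rewrite mxE.
exact: coord_continuous.
Qed.

Lemma is_derive_of_line (f : 'rV[R]_M -> R) (x v : 'rV[R]_M) (d : R) :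
  is_derive (0 : R^o) 1 (fun h : R^o => f (x + h *: v) : R^o) d ->
  is_derive x v (f : _ -> R^o) d.
Proof.
move=> df.
have E : (fun h : R => h^-1 *: ((f (h *: v + x) : R^o) - (f x : R^o))) =
    (fun h : R => h^-1 *: ((fun y : R^o => f (x + y *: v) : R^o) (h *: 1 + 0) -
    (fun y : R^o => f (x + y *: v) : R^o) 0)).
  apply/funext => h; congr (_ *: (f _ - f _)); last by rewrite scale0r addr0.
  by rewrite addr0 [h *: 1]mulr1 addrC.
split; first by have := @ex_derive _ _ _ _ _ _ _ df; rewrite /derivable /= E.
by rewrite /derive E; exact: derive_val.
Qed.

Lemma is_derive_product (x v : 'rV[R]_M) :
  is_derive x v ((fun x => phi (colsub p x) * psi (eta (colsub q x))) : _ -> R^o)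
    ((\sum_j partial j phi (colsub p x) * v 0 (p j)) * psi (eta (colsub q x)) +
     phi (colsub p x) * (psi' (eta (colsub q x)) *
       \sum_i partial i eta (colsub q x) * v 0 (q i))).
Proof.
have line N (r : 'I_N -> 'I_M) j : is_derive (0 : R^o) 1
    (fun h : R^o => (colsub r (x + h *: v)) 0 j : R^o) (v 0 (r j)).
  under eq_fun do rewrite !mxE.
  by apply: is_derive_eq; rewrite /GRing.scale /=; ring.
have d1 := is_derive_curve (y := fun h => colsub p (x + h *: v)) phiC1 (line _ p).
have d2 := is_derive_curve (y := fun h => colsub q (x + h *: v)) etaC1 (line _ q).
have d3 := is_derive1_comp (psi_derive _) d2.
have d4 := is_deriveM d1 d3.
apply: is_derive_of_line; apply: is_derive_eq; rewrite /= !scale0r !addr0 /GRing.scale /=.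
by rewrite addrC [X in X + _]mulrC.
Qed.

End product_rule.

Section gaussian_product.
Context d (T : measurableType d) (R : realType) (M m n : nat).
Context (P : probability T R) (X : T -> 'rV[R]_M) (C : 'M[R]_M).
Hypothesis gX : gaussian_vector P X C.
Variables (i0 : 'I_M) (p : 'I_m -> 'I_M) (q : 'I_n -> 'I_M).
Variables (phi : 'rV[R]_m -> R) (eta : 'rV[R]_n -> R) (psi psi' : R -> R).
Hypothesis i0_gt0 : 0 < C i0 i0.
Hypotheses (phiC1 : C1 phi) (etaC1 : C1 eta).
Hypothesis phib : bounded_continuous phi.
Hypothesis dphib : forall j, bounded_continuous (partial j phi).
Hypothesis etab : bounded_continuous eta.
Hypothesis detab : forall i, bounded_continuous (partial i eta).
Hypotheses (psib : bounded_continuous psi) (psi'b : bounded_continuous psi').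
Hypothesis psi_derive : forall x, is_derive (x : R^o) 1 (psi : R^o -> R^o) (psi' x).

Lemma gaussian_product_by_parts :
  \int[P]_t (X t 0 i0 * (phi (colsub p (X t)) * psi (eta (colsub q (X t))))) =
  \int[P]_t ((\sum_j partial j phi (colsub p (X t)) * C i0 (p j)) * psi (eta (colsub q (X t))) +
     phi (colsub p (X t)) * (psi' (eta (colsub q (X t))) *
       \sum_i partial i eta (colsub q (X t)) * C i0 (q i))).
Proof.
have cp := @colsub_continuous R M m p; have cq := @colsub_continuous R M n q.
have bp (g : 'rV[R]_m -> R) := @bounded_continuous_comp _ _ R g _ cp.
have bq (g : 'rV[R]_n -> R) := @bounded_continuous_comp _ _ R g _ cq.
have bpsi (g : R -> R) : bounded_continuous g ->
    bounded_continuous (fun x => g (eta (colsub q x))).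
  move=> bg; apply: (bounded_continuous_comp (g := fun x => eta (colsub q x))) => //.
  by case: (bq _ etab).
pose f x := phi (colsub p x) * psi (eta (colsub q x)).
pose g x := (\sum_j partial j phi (colsub p x) * C i0 (p j)) * psi (eta (colsub q x)) +
     phi (colsub p x) * (psi' (eta (colsub q x)) *
       \sum_i partial i eta (colsub q x) * C i0 (q i)).
have [cf [Bf fB]] : bounded_continuous f.
  by apply: bounded_continuousM; [exact: bp|exact: bpsi].
have [cg [Bg gB]] : bounded_continuous g.
  apply: bounded_continuousD; apply: bounded_continuousM.
  - apply: bounded_continuous_sum => j; apply: bounded_continuousM; first exact: bp.
    exact: bounded_continuous_cst.
  - exact: bpsi.
  - exact: bp.
  - apply: bounded_continuousM; first exact: bpsi.
    apply: bounded_continuous_sum => j; apply: bounded_continuousM; first exact: bq.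
    exact: bounded_continuous_cst.
apply: (gaussian_integration_by_parts gX i0_gt0 cf fB cg gB) => x.
have -> : g x = (\sum_j partial j phi (colsub p x) * row i0 C 0 (p j)) * psi (eta (colsub q x)) +
     phi (colsub p x) * (psi' (eta (colsub q x)) *
       \sum_i partial i eta (colsub q x) * row i0 C 0 (q i)).
  by rewrite /g; congr (_ * _ + _ * (_ * _)); apply: eq_bigr => j _; rewrite mxE.
exact: is_derive_product.
Qed.

End gaussian_product.

(** * Square-integrable functions *)

Section square_integrable.
Context d (T : measurableType d) (R : realType) (P : probability T R).
Implicit Types f g q : T -> R.
Local Notation norm2 f := (Lnorm P 2%:E (EFin \o f)).

Lemma Lfun2P f : f \in Lfun P 2%:E <-> measurable_fun setT f /\ (norm2 f < +oo)%E.
Proof.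
split=> [|[mf ff]]; first by rewrite inE => /andP[/[!inE]].
by rewrite inE; apply/andP; split; rewrite inE.
Qed.

(** The integral of a nonnegative function is a supremum over simple functions
    below it, so monotonicity extends to non-measurable functions; norms of
    differences of vector-valued functions are bounded in this way. *)
Lemma Lnorm2_le f q : (forall t, `|f t| <= `|q t|) -> (norm2 f <= norm2 q)%E.
Proof.
move=> fq; rewrite unlock; apply: gt0_ler_poweR; rewrite ?invr_ge0//.
- by rewrite in_itv/= leey integral_ge0.
- by rewrite in_itv/= leey integral_ge0.
rewrite !ge0_integralTE; [|by move=> x; exact: poweR_ge0..].
apply: ge_ereal_sup => _ [g /= gf <-]; apply: ereal_sup_ubound; exists g => //= x.
apply: le_trans (gf x) _.
by rewrite /= lee_fin ge0_ler_powR// nnegrE.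
Qed.

Lemma Lfun2_le f g : measurable_fun setT f -> (forall t, `|f t| <= `|g t|) ->
  g \in Lfun P 2%:E -> f \in Lfun P 2%:E.
Proof.
move=> mf fg /Lfun2P[_ gf]; apply/Lfun2P; split=> //.
exact: le_lt_trans (Lnorm2_le fg) gf.
Qed.

Lemma Lfun2_sqr f : measurable_fun setT f ->
  P.-integrable setT (EFin \o (fun t => f t ^+ 2)) -> f \in Lfun P 2%:E.
Proof.
move=> mf /integrableP[_ ff]; apply/Lfun2P; split=> //.
rewrite unlock poweR_lty//; apply: le_lt_trans ff; rewrite le_eqVlt; apply/orP; left; apply/eqP.
by apply: eq_integral => t _; rewrite /= powR_mulrn// normrX.
Qed.

Lemma Lfun2_integrable f g : f \in Lfun P 2%:E -> g \in Lfun P 2%:E ->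
  P.-integrable setT (EFin \o (fun t => f t * g t)).
Proof. by move=> f2 g2; apply/Lfun1_integrable; exact: Lfun2_mul_Lfun1. Qed.

Lemma Lfun2Z f (B : R) : f \in Lfun P 2%:E -> (fun t => B * f t) \in Lfun P 2%:E.
Proof.
move=> f2; rewrite (_ : (fun t => _) = B \o* f); last by apply/funext => t /=; rewrite mulrC.
by apply: Lfun_scale; rewrite ?ler1n.
Qed.

Lemma Lfun2_bounded_mul f g (B : R) : measurable_fun setT g -> (forall t, `|g t| <= B) ->
  f \in Lfun P 2%:E -> (fun t => f t * g t) \in Lfun P 2%:E.
Proof.
move=> mg gB f2; have /Lfun2P[mf _] := f2.
apply: (Lfun2_le _ _ (Lfun2Z B f2)); first exact: measurable_funM.
by move=> t; rewrite !normrM mulrC ler_wpM2r// (le_trans (gB t))// ler_norm.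
Qed.

(** Cauchy-Schwarz for [f] and [g / B]; the norm of the latter is controlled by
    that of [q] through [Lnorm2_le], so [q] may be a norm of vectors. *)
Lemma small_pairing f g q (B eps : R) : f \in Lfun P 2%:E -> measurable_fun setT g ->
  0 < B -> (forall t, `|g t| <= B * `|q t|) -> (norm2 q < eps%:E)%E ->
  P.-integrable setT (EFin \o (fun t => f t * g t)) /\
  `|\int[P]_t (f t * g t)| <= B * fine (norm2 f) * eps.
Proof.
move=> f2 mg B0 gq qeps; pose g' t := g t / B.
have mg' : measurable_fun setT g' by apply: measurable_funM.
have ng' : (norm2 g' <= eps%:E)%E.
  apply: le_trans (ltW qeps); apply: Lnorm2_le => t.
  by rewrite /g' normrM normfV (gtr0_norm B0) ler_pdivrMr// mulrC.
have g2 : g' \in Lfun P 2%:E by apply/Lfun2P; split=> //; exact: le_lt_trans ng' (ltry eps).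
have ifg' := Lfun2_integrable f2 g2.
have E : (fun t => f t * g t) = (fun t => B * (f t * g' t)).
  by apply/funext => t; rewrite /g'; field; rewrite gt_eqF.
rewrite E; split; first exact: integrableRZ.
rewrite RintegralZl// normrM (gtr0_norm B0) -mulrA ler_pM2l//.
apply: le_trans (le_normr_Rintegral measurableT ifg') _.
have /Lfun2P[mf ff] := f2.
have nf : norm2 f \is a fin_num.
  by rewrite ge0_fin_numE ?Lnorm_ge0.
have in_ : P.-integrable setT (EFin \o (fun t => `|f t * g' t|)) by exact: integrable_norm.
rewrite -lee_fin EFinM (fineK nf) fineK; last exact: integrable_fin_num.
apply: (@le_trans _ _ (norm2 f * norm2 g')%E); last first.
  by apply: lee_wpmul2l => //; exact: Lnorm_ge0.
apply: le_trans (@hoelder _ _ _ P f g' 2 2 mf mg' _ _ _) => //; last first.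
  by rewrite [RHS]splitr !div1r.
by rewrite Lnorm1.
Qed.

End square_integrable.

(** * Integration by parts along the rotated directions *)

Definition coord_covariance (R : realType) (la : nat -> R) M (c : 'I_M -> R[i])
    (k : 'I_M -> nat) : 'M[R]_M :=
  \matrix_(i, j) (if k i == k j then complex.Re (c i * conjc (c j)) / la (k i) else 0).

Lemma Rintegral_sum d (T : measurableType d) (R : realType) (P : {measure set T -> \bar R})
    (I : Type) (r : seq I) (F : I -> T -> R) :
  (forall i, P.-integrable setT (EFin \o F i)) ->
  \int[P]_t (\sum_(i <- r) F i t) = \sum_(i <- r) \int[P]_t F i t.
Proof.
move=> iF; elim: r => [|i r IH].
  under eq_Rintegral do rewrite big_nil.
  by rewrite big_nil Rintegral_cst// mul0r.
under eq_Rintegral do rewrite big_cons.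
rewrite big_cons -IH RintegralD//.
have := @integrable_sum _ _ _ P setT measurableT I r xpredT (fun i => EFin \o F i) (fun i _ => iF i).
by apply: eq_integrable => // t _; rewrite /= sumEFin.
Qed.

Section gaussian_family.
Context d (T : measurableType d) (R : realType) (P : probability T R).
Variables (ell : R[i] -> nat -> T -> R) (la : nat -> R).
Hypothesis la_gt0 : forall k, 0 < la k.
Hypothesis ell_gaussian : forall M (c : 'I_M -> R[i]) (k : 'I_M -> nat),
  gaussian_vector P (fun t => \row_i ell (c i) (k i) t) (coord_covariance la c k).
Local Notation norm2 f := (Lnorm P 2%:E (EFin \o f)).

(** The covariance of two coordinates multiplied by the common eigenvalue. *)
Definition pairing (a : R[i]) (k : nat) (b : R[i]) (l : nat) : R :=
  if k == l then complex.Re (a * conjc b) else 0.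

Definition family n (b : 'I_n -> R[i]) (l : 'I_n -> nat) (t : T) : 'rV[R]_n :=
  \row_i ell (b i) (l i) t.

Lemma family_measurable n (b : 'I_n -> R[i]) l i :
  measurable_fun setT (fun t => family b l t 0 i).
Proof. by case: (ell_gaussian b l). Qed.

Lemma ell_Lfun2 c k : ell c k \in Lfun P 2%:E.
Proof.
have gX := ell_gaussian (fun _ : 'I_1 => c) (fun=> k).
apply: Lfun2_sqr.
  by have [+ _ _] := gX => /(_ ord0); under eq_fun do rewrite mxE.
by have := gaussian_sqr_integrable gX ord0; under eq_fun do rewrite mxE.
Qed.

Lemma family_bounded_measurable n (b : 'I_n -> R[i]) l (g : 'rV[R]_n -> R) :
  bounded_continuous g -> measurable_fun setT (fun t => g (family b l t)) /\
  exists B : R, forall t, `|g (family b l t)| <= B.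
Proof.
move=> [cg [B gB]]; split; last by exists B => t; exact: gB.
by apply: (measurable_row_comp _ cg gB) => i; exact: family_measurable.
Qed.

Lemma family_product_integrable m n (a : 'I_m -> R[i]) k (b : 'I_n -> R[i]) l g1 g2 :
  bounded_continuous g1 -> bounded_continuous g2 ->
  P.-integrable setT (EFin \o (fun t => g1 (family a k t) * g2 (family b l t))).
Proof.
move=> /(family_bounded_measurable a k)[m1 [B1 b1]] /(family_bounded_measurable b l)[m2 [B2 b2]].
apply: (@bounded_integrable _ _ _ P _ (B1 * B2)); first exact: measurable_funM.
by move=> t; rewrite normrM ler_pM.
Qed.

Lemma bounded_continuous_lincomb n (g : 'I_n -> 'rV[R]_n -> R) (r : 'I_n -> R) :
  (forall i, bounded_continuous (g i)) -> bounded_continuous (fun x => \sum_i g i x * r i).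
Proof.
move=> bg; apply: bounded_continuous_sum => i; apply: bounded_continuousM => //.
exact: bounded_continuous_cst.
Qed.

(** Stein's formula for the joint vector of the distinguished component and the
    two families, placed side by side in a single index set. *)
Lemma family_product_by_parts (w : R[i]) (kw m n : nat) (phi : 'rV[R]_m -> R)
    (a : 'I_m -> R[i]) (k : 'I_m -> nat) (eta : 'rV[R]_n -> R)
    (b : 'I_n -> R[i]) (l : 'I_n -> nat) (psi psi' : R -> R) :
  0 < complex.Re (w * conjc w) -> C1 phi -> C1 eta ->
  bounded_continuous phi -> (forall j, bounded_continuous (partial j phi)) ->
  bounded_continuous eta -> (forall i, bounded_continuous (partial i eta)) ->
  bounded_continuous psi -> bounded_continuous psi' ->
  (forall x, is_derive (x : R^o) 1 (psi : R^o -> R^o) (psi' x)) ->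
  la kw * \int[P]_t (ell w kw t * (phi (family a k t) * psi (eta (family b l t)))) =
  \int[P]_t ((\sum_j partial j phi (family a k t) * pairing w kw (a j) (k j)) *
      psi (eta (family b l t)) +
    phi (family a k t) * (psi' (eta (family b l t)) *
      \sum_i partial i eta (family b l t) * pairing w kw (b i) (l i))).
Proof.
move=> w0 phiC1 etaC1 phib dphib etab detab psib psi'b dpsi.
(* Index [0] is the distinguished component; then come the arguments of [phi] and
   those of [eta]. *)
pose cs (i : 'I_(1 + (m + n))) := match fintype.split i with
  | inl _ => w | inr i' => match fintype.split i' with inl j => a j | inr i => b i end end.
pose ks (i : 'I_(1 + (m + n))) := match fintype.split i with
  | inl _ => kw | inr i' => match fintype.split i' with inl j => k j | inr i => l i end end.
pose i0 : 'I_(1 + (m + n)) := lshift (m + n) ord0.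
pose p (j : 'I_m) : 'I_(1 + (m + n)) := rshift 1 (lshift n j).
pose q (i : 'I_n) : 'I_(1 + (m + n)) := rshift 1 (rshift m i).
have s0 : fintype.split i0 = inl ord0 := unsplitK (inl ord0).
have s1 (i : 'I_(m + n)) : fintype.split (rshift 1 i) = inr i := unsplitK (inr i).
have s2 (j : 'I_m) : fintype.split (lshift n j) = inl j := unsplitK (inl j).
have s3 (i : 'I_n) : fintype.split (rshift m i) = inr i := unsplitK (inr i).
have cs0 : cs i0 = w by rewrite /cs s0.
have ks0 : ks i0 = kw by rewrite /ks s0.
have csp j : cs (p j) = a j by rewrite /cs s1 s2.
have ksp j : ks (p j) = k j by rewrite /ks s1 s2.
have csq i : cs (q i) = b i by rewrite /cs s1 s3.
have ksq i : ks (q i) = l i by rewrite /ks s1 s3.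
have gX := ell_gaussian cs ks.
have i0_gt0 : 0 < coord_covariance la cs ks i0 i0.
  by rewrite mxE eqxx cs0 ks0 divr_gt0.
have := gaussian_product_by_parts gX (i0 := i0) p q i0_gt0 phiC1 etaC1 phib dphib etab detab psib psi'b dpsi.
have Ep t : colsub p (\row_i ell (cs i) (ks i) t) = family a k t.
  by apply/rowP => j; rewrite !mxE csp ksp.
have Eq t : colsub q (\row_i ell (cs i) (ks i) t) = family b l t.
  by apply/rowP => j; rewrite !mxE csq ksq.
have cE i : coord_covariance la cs ks i0 i = (la kw)^-1 * pairing w kw (cs i) (ks i).
  rewrite mxE cs0 ks0 /pairing; case: ifP => _; last by rewrite mulr0.
  by rewrite mulrC.
under eq_Rintegral => t _ do rewrite mxE cs0 ks0 Ep Eq.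
move=> ->; rewrite -RintegralZl//.
  apply: eq_Rintegral => t _; rewrite Ep Eq.
  under eq_bigr do rewrite cE csp ksp mulrCA.
  under [X in _ + _ * (_ * X)]eq_bigr do rewrite cE csq ksq mulrCA.
  by rewrite -!mulr_sumr; field; rewrite gt_eqF.
have c1 := bounded_continuous_lincomb (fun j => coord_covariance la cs ks i0 (p j)) dphib.
have c2 := bounded_continuous_lincomb (fun i => coord_covariance la cs ks i0 (q i)) detab.
have cpsi (g : R -> R) : bounded_continuous g -> bounded_continuous (fun x => g (eta x)).
  by apply: bounded_continuous_comp; case: etab.
have I1 := family_product_integrable a k b l c1 (cpsi _ psib).
have I2 := family_product_integrable a k b l phib (bounded_continuousM (cpsi _ psi'b) c2).
by have := integrableRD I1 I2; apply: eq_integrable => // t _; rewrite /= Ep Eq.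
Qed.

Variables (m : nat) (phi : 'rV[R]_m -> R) (a : 'I_m -> R[i]) (k : 'I_m -> nat).
Hypothesis phi_smooth : smooth_bounded phi.
Hypothesis a_neq0 : forall j, 0 < complex.Re (a j * conjc (a j)).

Local Notation X := (family a k).

Lemma smooth_bounded_continuous N (g : 'rV[R]_N -> R) : smooth_bounded g -> bounded_continuous g.
Proof.
move=> [sg bg]; split; first exact: smooth_continuous.
by have [B] := bg [::]; exists B.
Qed.

(** [Re ('i * x * conj y)] is the symplectic form. *)
Lemma rotated_pairing (x y : R[i]) (j l : nat) :
  pairing ('i * x) j y l = - pairing ('i * y) l x j.
Proof.
rewrite /pairing eq_sym; case: ifP => _; last by rewrite oppr0.
by rewrite -complexiE; case: x y => x1 x2 [y1 y2] /=; ring.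
Qed.

(** A symmetric matrix is orthogonal to an antisymmetric one. *)
Lemma hessian_cancellation x :
  \sum_j \sum_l partial l (partial j phi) x * pairing ('i * a j) (k j) (a l) (k l) = 0.
Proof.
have C1p j : C1 (partial j phi) by apply: smooth_C1; apply: smooth_partial; case: phi_smooth.
have C1phi : C1 phi by apply: smooth_C1; case: phi_smooth.
set S := (LHS); suff : S = - S by move/eqP; rewrite -addr_eq0 -mulr2n mulrn_eq0 => /eqP.
rewrite {1}/S exchange_big /= /S -sumrN; apply: eq_bigr => j _.
rewrite -sumrN; apply: eq_bigr => l _.
rewrite (rotated_pairing (a l) (a j)).
rewrite (partial_comm x C1phi (C1p l) (C1p j)).
exact: mulrN.
Qed.

(** After Stein's formula the second derivatives of [phi] cancel in the sum over
    [j], pointwise. *)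
Lemma cylinder_by_parts n (eta : 'rV[R]_n -> R) (b : 'I_n -> R[i]) (l : 'I_n -> nat)
    (psi psi' : R -> R) :
  smooth_bounded eta -> bounded_continuous psi -> bounded_continuous psi' ->
  (forall x, is_derive (x : R^o) 1 (psi : R^o -> R^o) (psi' x)) ->
  \sum_j la (k j) * \int[P]_t (ell ('i * a j) (k j) t *
      (partial j phi (X t) * psi (eta (family b l t)))) =
  \sum_j \int[P]_t (partial j phi (X t) * (psi' (eta (family b l t)) *
      \sum_i partial i eta (family b l t) * pairing ('i * a j) (k j) (b i) (l i))).
Proof.
move=> seta psib psi'b dpsi.
have bcp j := smooth_bounded_partial j phi_smooth.
have bce i := smooth_bounded_partial i seta.
have wpos j : 0 < complex.Re ('i * a j * conjc ('i * a j)).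
  have := a_neq0 j; rewrite -complexiE; case: (a j) => x y /=; congr (0 < _); ring.
have cpsi (g : R -> R) : bounded_continuous g -> bounded_continuous (fun x => g (eta x)).
  by apply: bounded_continuous_comp; exact: (smooth_bounded_continuous seta).1.
pose A j t := (\sum_l0 partial l0 (partial j phi) (X t) * pairing ('i * a j) (k j) (a l0) (k l0)) *
      psi (eta (family b l t)).
pose B j t := partial j phi (X t) * (psi' (eta (family b l t)) *
      \sum_i partial i eta (family b l t) * pairing ('i * a j) (k j) (b i) (l i)).
have iA j : P.-integrable setT (EFin \o A j).
  have bA := bounded_continuous_lincomb
    (fun l0 => pairing ('i * a j) (k j) (a l0) (k l0))
    (fun l0 => smooth_bounded_continuous (smooth_bounded_partial l0 (bcp j))).
  exact: (family_product_integrable a k b l bA (cpsi _ psib)).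
have iB j : P.-integrable setT (EFin \o B j).
  have bB := bounded_continuousM (cpsi _ psi'b) (bounded_continuous_lincomb
    (fun i => pairing ('i * a j) (k j) (b i) (l i))
    (fun i => smooth_bounded_continuous (bce i))).
  exact: (family_product_integrable a k b l (smooth_bounded_continuous (bcp j)) bB).
transitivity (\sum_j (\int[P]_t A j t + \int[P]_t B j t)).
  apply: eq_bigr => j _.
  have C1j : C1 (partial j phi) by apply: smooth_C1; case: (bcp j).
  have C1e : C1 eta by apply: smooth_C1; case: seta.
  rewrite (@family_product_by_parts _ _ _ _ _ a k _ b l psi psi' (wpos j) C1j C1e
    (smooth_bounded_continuous (bcp j))
    (fun l0 => smooth_bounded_continuous (smooth_bounded_partial l0 (bcp j)))
    (smooth_bounded_continuous seta) (fun i => smooth_bounded_continuous (bce i)) psib psi'b dpsi).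
  exact: (RintegralD measurableT (iA j) (iB j)).
rewrite big_split /= -(Rintegral_sum _ iA).
rewrite (_ : (fun t => \sum_j A j t) = cst 0); last first.
  apply/funext => t; rewrite /A -mulr_suml hessian_cancellation mul0r //.
by rewrite Rintegral_cst// mul0r add0r.
Qed.

End gaussian_family.

(** * Passage to the limit in the graph norm *)

Section stability.
Context d (T : measurableType d) (R : realType) (P : probability T R).
Implicit Types f u h kap D q : T -> R.
Local Notation norm2 f := (Lnorm P 2%:E (EFin \o f)).

Lemma Lfun2_cst (r : R) : (fun=> r) \in Lfun P 2%:E.
Proof.
apply: Lfun2_sqr => //.
by apply: (@bounded_integrable _ _ _ P _ `|r ^+ 2|) => // t.
Qed.

Lemma Lfun2_integrable1 f : f \in Lfun P 2%:E -> P.-integrable setT (EFin \o f).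
Proof.
move=> f2; have := Lfun2_integrable f2 (Lfun2_cst 1).
by apply: eq_integrable => // t _; rewrite /= mulr1.
Qed.

Variables (u h hN : T -> R) (C : R) (psi : R -> R) (L eps : R).
Hypotheses (mu_ : measurable_fun setT u) (C0 : 0 < C) (uC : forall t, `|u t| <= C).
Hypotheses (mh : measurable_fun setT h) (mhN : measurable_fun setT hN).
Hypothesis hhN : (norm2 (fun t => h t - hN t)%R < eps%:E)%E.
Hypothesis psib : bounded_continuous psi.
Hypothesis L0 : 0 < L.
Hypothesis psi_lipschitz : forall x y, `|psi x - psi y| <= L * `|x - y|.

Lemma bounded_continuous_measurable (g : R -> R) (f : T -> R) :
  bounded_continuous g -> measurable_fun setT f -> measurable_fun setT (fun t => g (f t)).
Proof.
by move=> [cg _] mf; apply: measurableT_comp => //; exact: continuous_measurable_fun.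
Qed.

(** Like [stability_right], this bounds the error made by replacing [h] by [hN] with
    a constant that does not depend on [hN]. *)
Lemma stability_left f : f \in Lfun P 2%:E ->
  `|\int[P]_t (f t * (u t * psi (h t))) - \int[P]_t (f t * (u t * psi (hN t)))| <=
  C * L * fine (norm2 f) * eps.
Proof.
move=> f2; have mp := bounded_continuous_measurable psib.
have [_ [B psiB]] := psib.
have ig h' : measurable_fun setT h' ->
    P.-integrable setT (EFin \o (fun t => f t * (u t * psi (h' t)))).
  move=> mh'; apply: (integrable_bounded_mul (B := C * B) (Lfun2_integrable1 f2)).
    by apply: measurable_funM => //; exact: mp.
  by move=> t; rewrite normrM ler_pM.
have [] := @small_pairing _ _ _ P f (fun t => u t * (psi (h t) - psi (hN t)))
  (fun t => h t - hN t) (C * L) eps f2.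
- by apply: measurable_funM => //; apply: measurable_funB; exact: mp.
- exact: mulr_gt0.
- by move=> t; rewrite normrM -mulrA ler_pM.
- exact: hhN.
move=> _; congr (`|_| <= _); rewrite -RintegralB//; [|exact: ig..].
by apply: eq_Rintegral => t _; ring.
Qed.

Lemma stability_right kap D q (B Bpsi : R) : kap \in Lfun P 2%:E -> measurable_fun setT D ->
  0 < B -> (forall t, `|kap t - D t| <= B * `|q t|) -> (norm2 q < eps%:E)%E ->
  0 < Bpsi -> (forall x, `|psi x| <= Bpsi) ->
  `|\int[P]_t (u t * (psi (h t) * kap t)) - \int[P]_t (u t * (psi (hN t) * D t))| <=
  (C * L * fine (norm2 kap) + C * Bpsi * B * fine (norm2 (fun=> 1))) * eps.
Proof.
move=> kap2 mD B0 kD qeps Bpsi0 psiB; have mp := bounded_continuous_measurable psib.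
have /Lfun2P[mk _] := kap2.
have ig h' : measurable_fun setT h' ->
    P.-integrable setT (EFin \o (fun t => kap t * (u t * psi (h' t)))).
  move=> mh'; apply: (integrable_bounded_mul (B := C * Bpsi) (Lfun2_integrable1 kap2)).
    by apply: measurable_funM => //; exact: mp.
  by move=> t; rewrite normrM ler_pM.
have [] := @small_pairing _ _ _ P _ (fun t => u t * (psi (hN t) * (kap t - D t)))
  q (C * Bpsi * B) eps (Lfun2_cst 1).
- by apply: measurable_funM => //; apply: measurable_funM; [exact: mp|exact: measurable_funB].
- by rewrite !mulr_gt0.
- by move=> t; rewrite !normrM -!mulrA ler_pM// ler_pM.
- exact: qeps.
under eq_Rintegral do rewrite mul1r; under [X in EFin \o X]eq_fun do rewrite mul1r.
move=> ie be.
have E1 : \int[P]_t (u t * (psi (h t) * kap t)) = \int[P]_t (kap t * (u t * psi (h t))).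
  by apply: eq_Rintegral => t _; ring.
have E2 : \int[P]_t (u t * (psi (hN t) * D t)) = \int[P]_t (kap t * (u t * psi (hN t))) -
    \int[P]_t (u t * (psi (hN t) * (kap t - D t))).
  rewrite -RintegralB//; last exact: ig.
  by apply: eq_Rintegral => t _; ring.
rewrite E1 E2 opprB addrCA addrC; apply: le_trans (ler_normD _ _) _.
by rewrite mulrDl; apply: lerD => //; exact: stability_left.
Qed.

End stability.

Section malliavin.
Context d (T : measurableType d) (R : realType) (P : probability T R).
Variables (ell : R[i] -> nat -> T -> R) (la : nat -> R).
Hypothesis la_gt0 : forall k, 0 < la k.
Hypothesis ell_gaussian : forall M (c : 'I_M -> R[i]) (k : 'I_M -> nat),
  gaussian_vector P (fun t => \row_i ell (c i) (k i) t) (coord_covariance la c k).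
Variables (m : nat) (phi : 'rV[R]_m -> R) (a : 'I_m -> R[i]) (k : 'I_m -> nat).
Hypothesis phi_smooth : smooth_bounded phi.
Hypothesis a_neq0 : forall j, 0 < complex.Re (a j * conjc (a j)).
Variables (h : T -> R) (kap : 'I_m -> T -> R) (B : R).
Local Notation norm2 f := (Lnorm P 2%:E (EFin \o f)).
Local Notation X := (family ell a k).
Hypothesis mh : measurable_fun setT h.
Hypothesis kap2 : forall j, kap j \in Lfun P 2%:E.
Hypothesis B0 : 0 < B.
Hypothesis approx : forall eps : R, 0 < eps ->
  exists n (b : 'I_n -> R[i]) (l : 'I_n -> nat) (eta : 'rV[R]_n -> R),
  [/\ smooth_bounded eta, (norm2 (fun t => h t - eta (family ell b l t))%R < eps%:E)%E &
    exists2 q : T -> R, (norm2 q < eps%:E)%E & forall j t,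
    `|kap j t - \sum_i partial i eta (family ell b l t) *
        pairing ('i * a j) (k j) (b i) (l i)| <= B * `|q t|].

(** Both sides of [cylinder_by_parts] are within a fixed multiple of [eps] of the
    corresponding sides for [h] and its gradient, for every [eps]. *)
Lemma malliavin_by_parts (psi psi' : R -> R) (L : R) :
  bounded_continuous psi -> bounded_continuous psi' ->
  (forall x, is_derive (x : R^o) 1 (psi : R^o -> R^o) (psi' x)) ->
  0 < L -> (forall x y, `|psi x - psi y| <= L * `|x - y|) ->
  (forall x y, `|psi' x - psi' y| <= L * `|x - y|) ->
  \sum_j la (k j) * \int[P]_t (ell ('i * a j) (k j) t * (partial j phi (X t) * psi (h t))) =
  \sum_j \int[P]_t (partial j phi (X t) * (psi' (h t) * kap j t)).
Proof.
move=> bpsi bpsi' dpsi L0 psiL psi'L.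
have bcp j := smooth_bounded_partial j phi_smooth.
have pos_bound (g : R -> R) : bounded_continuous g ->
    exists2 Bg, 0 < Bg & forall x, `|g x| <= Bg.
  move=> [_ [Bg gB]]; exists (`|Bg| + 1) => [|x]; first by rewrite ltr_wpDl.
  by rewrite (le_trans (gB x))// (le_trans (ler_norm _))// lerDl.
have /choice[Cp CpP] : forall j, exists Cj : R, 0 < Cj /\ forall t, `|partial j phi (X t)| <= Cj.
  move=> j; have [_ [Bj jB]] := smooth_bounded_continuous (bcp j).
  exists (`|Bj| + 1); split=> [|t]; first by rewrite ltr_wpDl.
  by rewrite (le_trans (jB _))// (le_trans (ler_norm _))// lerDl.
have mp j : measurable_fun setT (fun t => partial j phi (X t)).
  by have [] := family_bounded_measurable ell_gaussian a k (smooth_bounded_continuous (bcp j)).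
have [Bpsi' Bpsi'0 psi'B] := pos_bound _ bpsi'.
pose K1 j := Cp j * L * fine (norm2 (ell ('i * a j) (k j))).
pose K2 j := Cp j * L * fine (norm2 (kap j)) + Cp j * Bpsi' * B * fine (norm2 (fun=> 1)).
pose K := \sum_j (la (k j) * K1 j + K2 j).
have K0 : 0 <= K.
  apply: sumr_ge0 => j _; have [C0 _] := CpP j.
  by rewrite !(addr_ge0, mulr_ge0)// ?fine_ge0 ?Lnorm_ge0// ltW.
set lhs := LHS; set rhs := RHS.
(* [K] is fixed before [e], so [e] may tend to [0]. *)
suff dK e : 0 < e -> `|lhs - rhs| <= K * e.
  apply/eqP; rewrite -subr_eq0 -normr_eq0 eq_le normr_ge0 andbT.
  apply/ler_addgt0Pr => e e0; rewrite add0r.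
  have K1' : 0 < K + 1 by rewrite ltr_wpDl.
  apply: le_trans (dK (e / (K + 1)) _) _; first exact: divr_gt0.
  by rewrite mulrA ler_pdivrMr// mulrC ler_pM2l// lerDl.
move=> e0; have [n [b [l [eta [seta heta [q qe kq]]]]]] := approx e0.
have E := cylinder_by_parts la_gt0 ell_gaussian k phi_smooth a_neq0 b l seta bpsi bpsi' dpsi.
have meta : measurable_fun setT (fun t => eta (family ell b l t)).
  by have [] := family_bounded_measurable ell_gaussian b l (smooth_bounded_continuous seta).
set lhs' := (X in X = _) in E; set rhs' := (X in _ = X) in E.
have -> : lhs - rhs = (lhs - lhs') - (rhs - rhs') by rewrite E; ring.
apply: le_trans (ler_normB _ _) _.
rewrite /lhs /lhs' /rhs /rhs' -!sumrB /K mulr_suml.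
apply: le_trans (lerD (ler_norm_sum _ _ _) (ler_norm_sum _ _ _)) _.
rewrite -big_split /=; apply: ler_sum => j _; rewrite mulrDl; apply: lerD.
  rewrite -mulrBr normrM gtr0_norm// -mulrA ler_pM2l//.
  apply: stability_left => //; try exact: (CpP j).1; try exact: (CpP j).2.
  exact: ell_Lfun2.
have [C0 CP] := CpP j.
have mD : measurable_fun setT (fun t => \sum_i partial i eta (family ell b l t) *
    pairing ('i * a j) (k j) (b i) (l i)).
  apply: measurable_sum => i; apply: measurable_funM => //.
  by have [] := family_bounded_measurable ell_gaussian b l
    (smooth_bounded_continuous (smooth_bounded_partial i seta)).
exact: (stability_right (mp j) C0 CP mh meta heta bpsi' L0 psi'L (kap2 j) mD B0 (kq j) qe
  Bpsi'0 psi'B).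
Qed.

End malliavin.

(** * Passage to the exponential weight *)

Section regularized_exponential.
Context (R : realType).
Implicit Types x y : R.

Definition rho y x : R := (expR x + y)^-1.
(** The derivative of [rho y], written as a polynomial in [rho y] so that bounds
    and Lipschitz estimates are inherited from it. *)
Definition rho' y x : R := y * rho y x ^+ 2 - rho y x.

Lemma rho_gt0 y x : 0 < y -> 0 < rho y x.
Proof. by move=> y0; rewrite invr_gt0 addr_gt0// expR_gt0. Qed.

Lemma rho_le_expR y x : 0 < y -> rho y x <= expR (- x).
Proof.
by move=> y0; rewrite expRN lef_pV2 ?posrE ?addr_gt0 ?expR_gt0// lerDl ltW.
Qed.

Lemma rho_le1 y x : 0 < y -> y * rho y x <= 1.
Proof.
by move=> y0; rewrite ler_pdivrMr ?addr_gt0 ?expR_gt0// mul1r lerDr expR_ge0.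
Qed.

Lemma rho_bounded y x : 0 < y -> `|rho y x| <= y^-1.
Proof.
move=> y0; rewrite gtr0_norm ?rho_gt0// -[y^-1]mul1r ler_pdivlMr// mulrC.
exact: rho_le1.
Qed.

Lemma normr_rho'_le y x : 0 < y -> `|rho' y x| <= rho y x.
Proof.
move=> y0; have := rho_gt0 x y0; have := rho_le1 x y0; rewrite /rho' ler_norml.
by set r := rho y x => r1 r0; nra.
Qed.

Lemma is_derive_rho y x : 0 < y -> is_derive (x : R^o) 1 (rho y : R^o -> R^o) (rho' y x).
Proof.
move=> y0; have e0 : expR x + y != 0 by rewrite gt_eqF// addr_gt0// expR_gt0.
have d := is_deriveV (f := (fun x : R^o => expR x + y : R^o)) e0.
apply: is_derive_eq; rewrite /GRing.scale /= /rho' /rho.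
by rewrite -exprVn; field.
Qed.

Lemma continuous_rho y : 0 < y -> continuous (rho y : R^o -> R^o).
Proof.
move=> y0 x; apply: differentiable_continuous; apply/derivable1_diffP.
exact: (@ex_derive _ _ _ _ _ _ _ (is_derive_rho x y0)).
Qed.

Lemma rho_lipschitz y x1 x2 : 0 < y -> `|rho y x1 - rho y x2| <= y^-1 * `|x1 - x2|.
Proof.
move=> y0; wlog x12 : x1 x2 / x2 <= x1.
  by move=> W; case/orP: (le_total x2 x1) => /W //; rewrite distrC [X in _ * X]distrC.
(* The mean value theorem, with [|rho'| <= rho <= 1 / y]. *)
have [|c _ ->] := @MVT_segment _ (rho y) _ _ _ x12 (fun x _ => is_derive_rho x y0).
  exact/continuous_subspaceT/continuous_rho.
rewrite normrM ler_wpM2r// (le_trans (normr_rho'_le c y0))//.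
exact: le_trans (ler_norm _) (rho_bounded c y0).
Qed.

Lemma rho'_lipschitz y x1 x2 : 0 < y -> `|rho' y x1 - rho' y x2| <= y^-1 * `|x1 - x2|.
Proof.
move=> y0; apply: le_trans (rho_lipschitz x1 x2 y0).
rewrite (_ : rho' y x1 - rho' y x2 = (rho y x1 - rho y x2) * (y * rho y x1 + y * rho y x2 - 1)).
  rewrite normrM -[leRHS]mulr1 ler_wpM2l// ler_norml.
  have := rho_le1 x1 y0; have := rho_le1 x2 y0.
  have := mulr_gt0 y0 (rho_gt0 x1 y0); have := mulr_gt0 y0 (rho_gt0 x2 y0).
  by move=> *; apply/andP; split; lra.
by rewrite /rho'; ring.
Qed.

Lemma rho_bounded_continuous y : 0 < y -> bounded_continuous (rho y).
Proof. by move=> y0; split; [exact: continuous_rho|exists y^-1 => x; exact: rho_bounded]. Qed.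

Lemma rho'_bounded_continuous y : 0 < y -> bounded_continuous (rho' y).
Proof.
move=> y0; have br := rho_bounded_continuous y0; rewrite /rho'.
apply: bounded_continuousD.
  apply: bounded_continuousM; first exact: bounded_continuous_cst.
  by under eq_fun do rewrite expr2; exact: bounded_continuousM.
under eq_fun do rewrite -mulN1r.
by apply: bounded_continuousM => //; exact: bounded_continuous_cst.
Qed.

Lemma rho_cvg x : rho n.+1%:R^-1 x @[n --> \oo] --> expR (- x).
Proof.
rewrite expRN /rho; apply: cvgV; first by rewrite gt_eqF// expR_gt0.
rewrite -[X in _ --> X]addr0; apply: cvgD; first exact: cvg_cst.
exact: cvg_harmonic.
Qed.

Lemma rho'_cvg x : rho' n.+1%:R^-1 x @[n --> \oo] --> - expR (- x).
Proof.
rewrite -[X in _ --> X]add0r -(mul0r (expR (- x) ^+ 2)); apply: cvgB; last exact: rho_cvg.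
apply: cvgM; first exact: cvg_harmonic.
by rewrite expr2; under eq_fun do rewrite expr2; apply: cvgM; exact: rho_cvg.
Qed.

End regularized_exponential.

Section exponential_by_parts.
Context d (T : measurableType d) (R : realType) (P : probability T R).
Variables (ell : R[i] -> nat -> T -> R) (la : nat -> R).
Hypothesis la_gt0 : forall k, 0 < la k.
Hypothesis ell_gaussian : forall M (c : 'I_M -> R[i]) (k : 'I_M -> nat),
  gaussian_vector P (fun t => \row_i ell (c i) (k i) t) (coord_covariance la c k).
Variables (m : nat) (phi : 'rV[R]_m -> R) (a : 'I_m -> R[i]) (k : 'I_m -> nat).
Hypothesis phi_smooth : smooth_bounded phi.
Hypothesis a_neq0 : forall j, 0 < complex.Re (a j * conjc (a j)).
Variables (h : T -> R) (kap : 'I_m -> T -> R) (B : R).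
Local Notation norm2 f := (Lnorm P 2%:E (EFin \o f)).
Local Notation X := (family ell a k).
Hypothesis mh : measurable_fun setT h.
Hypothesis kap2 : forall j, kap j \in Lfun P 2%:E.
Hypothesis B0 : 0 < B.
Hypothesis approx : forall eps : R, 0 < eps ->
  exists n (b : 'I_n -> R[i]) (l : 'I_n -> nat) (eta : 'rV[R]_n -> R),
  [/\ smooth_bounded eta, (norm2 (fun t => h t - eta (family ell b l t))%R < eps%:E)%E &
    exists2 q : T -> R, (norm2 q < eps%:E)%E & forall j t,
    `|kap j t - \sum_i partial i eta (family ell b l t) *
        pairing ('i * a j) (k j) (b i) (l i)| <= B * `|q t|].
Hypothesis exp2 : (fun t => expR (- h t)) \in Lfun P 2%:E.

Lemma weighted_cvg (u f : T -> R) (C : R) (g : R -> R -> R) (g0 : R -> R) :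
  measurable_fun setT u -> (forall t, `|u t| <= C) -> f \in Lfun P 2%:E ->
  (forall y, 0 < y -> bounded_continuous (g y)) ->
  (forall y x, 0 < y -> `|g y x| <= expR (- x)) ->
  (forall x, g n.+1%:R^-1 x @[n --> \oo] --> g0 x) ->
  \int[P]_t (f t * (u t * g n.+1%:R^-1 (h t))) @[n --> \oo] -->
  \int[P]_t (f t * (u t * g0 (h t))).
Proof.
move=> mu_ uC f2 bg gexp gcvg; have /Lfun2P[mf _] := f2.
have C0 (t : T) : 0 <= C := le_trans (normr_ge0 _) (uC t).
have := @dominated_cvg_Rintegral _ _ _ P (fun n t => f t * (u t * g n.+1%:R^-1 (h t)))
  (fun t => f t * (u t * g0 (h t))) (fun t => C * `|f t * expR (- h t)|).
case=> //.
- move=> n; apply: measurable_funM => //; apply: measurable_funM => //.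
  exact: bounded_continuous_measurable (bg _ _) mh.
- move=> n t; rewrite !normrM mulrCA ler_pM// ler_wpM2l//.
  by rewrite (le_trans (gexp _ _ _))// ler_norm.
- exact/integrableRZ/integrable_norm/Lfun2_integrable.
- by move=> t; apply: cvgMr; apply: cvgMr; exact: gcvg.
Qed.

(** The choice [y = 1 / (n + 1)] in [malliavin_by_parts], and dominated
    convergence. *)
Lemma exponential_by_parts :
  \sum_j la (k j) * \int[P]_t (ell ('i * a j) (k j) t * (partial j phi (X t) * expR (- h t))) =
  - \sum_j \int[P]_t (kap j t * (partial j phi (X t) * expR (- h t))).
Proof.
have bmp j := family_bounded_measurable ell_gaussian a k
  (smooth_bounded_continuous (smooth_bounded_partial j phi_smooth)).
have y0 n : 0 < (n.+1%:R^-1 : R) by rewrite invr_gt0.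
have cl : \sum_j la (k j) * \int[P]_t (ell ('i * a j) (k j) t * (partial j phi (X t) * rho n.+1%:R^-1 (h t)))
    @[n --> \oo] -->
    \sum_j la (k j) * \int[P]_t (ell ('i * a j) (k j) t * (partial j phi (X t) * expR (- h t))).
  apply: cvg_big => [|j _]; first exact: add_continuous.
  apply: cvgMr; have [mp [C pC]] := bmp j.
  have := @weighted_cvg _ _ C (@rho R) (fun x => expR (- x)) mp pC
    (ell_Lfun2 ell_gaussian ('i * a j) (k j)).
  apply=> [y y1|y x y1|x]; first exact: rho_bounded_continuous.
    by rewrite gtr0_norm ?rho_gt0// rho_le_expR.
  exact: rho_cvg.
have cr : \sum_j \int[P]_t (kap j t * (partial j phi (X t) * rho' n.+1%:R^-1 (h t)))
    @[n --> \oo] --> \sum_j \int[P]_t (kap j t * (partial j phi (X t) * (- expR (- h t)))).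
  apply: cvg_big => [|j _]; first exact: add_continuous.
  have [mp [C pC]] := bmp j.
  have := @weighted_cvg _ _ C (@rho' R) (fun x => - expR (- x)) mp pC (kap2 j).
  apply=> [y y1|y x y1|x]; first exact: rho'_bounded_continuous.
    by rewrite (le_trans (normr_rho'_le _ y1))// rho_le_expR.
  exact: rho'_cvg.
rewrite -sumrN; under [RHS]eq_bigr => j _.
  rewrite -mulN1r -RintegralZl//; last first.
    have [mp [C pC]] := bmp j.
    apply: Lfun2_integrable => //.
    under eq_fun do rewrite mulrC.
    exact: (Lfun2_bounded_mul mp pC).
  under eq_Rintegral => t _ do rewrite mulN1r -!mulrN.
  over.
apply: (cvg_unique (@norm_hausdorff _ R^o) cl).
apply: cvg_trans cr; apply: near_eq_cvg; apply: nearW => n /=.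
rewrite (malliavin_by_parts la_gt0 ell_gaussian phi_smooth a_neq0 mh kap2 B0 approx
  (rho_bounded_continuous (y0 n)) (rho'_bounded_continuous (y0 n))
  (fun x => is_derive_rho x (y0 n)) (L := n.+1%:R^-1^-1)).
- by apply: eq_bigr => j _; apply: eq_Rintegral => t _; ring.
- by rewrite invr_gt0.
- by move=> x y; exact: rho_lipschitz.
- by move=> x y; exact: rho'_lipschitz.
Qed.

End exponential_by_parts.

(** * Measures with a density *)

Section density.
Context d (T : measurableType d) (R : realType) (P Q : probability T R) (w : T -> R).
Hypothesis iw : P.-integrable setT (EFin \o w).
Hypothesis w0 : forall x, 0 <= w x.
Hypothesis Qw : forall A, measurable A -> Q A = (\int[P]_(x in A) (w x)%:E)%E.

(** The density agrees almost everywhere with the Radon-Nikodym derivative,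
    having the same integrals over measurable sets. *)
Lemma ge0_integral_density (f : T -> \bar R) : (forall x, 0 <= f x)%E ->
  measurable_fun setT f -> (\int[Q]_x f x = \int[P]_x (f x * (w x)%:E))%E.
Proof.
move=> f0 mf.
have mw : measurable_fun setT (EFin \o w) := measurable_int _ iw.
have QP : Q `<< P.
  move=> A nA B mB BA; rewrite Qw//; apply: null_set_integral => //.
  - exact: measurable_funTS.
  - exact: nA.
rewrite -(Radon_Nikodym_SigmaFinite.change_of_variables QP)//.
have iD := Radon_Nikodym_SigmaFinite.f_integrable QP.
apply: ae_eq_integral => //.
- by apply: emeasurable_funM => //; exact: measurable_int iD.
- exact: emeasurable_funM.
have : ae_eq P setT (Radon_Nikodym_SigmaFinite.f Q P) (EFin \o w).
  apply: integral_ae_eq => // E _ mE.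
  by transitivity (Q E); [exact/esym/(Radon_Nikodym_SigmaFinite.f_integral QP)|exact: Qw].
by apply: filterS => x /= + _ => /(_ I) ->.
Qed.

Lemma density_integral (g : T -> R) : measurable_fun setT g ->
  P.-integrable setT (EFin \o (fun x => g x * w x)) ->
  Q.-integrable setT (EFin \o g) /\ \int[Q]_x g x = \int[P]_x (g x * w x).
Proof.
move=> mg igw.
have mw : measurable_fun setT w by apply/measurable_EFinP; exact: measurable_int iw.
have ge0 (f : T -> R) : measurable_fun setT f -> (forall x, 0 <= f x <= `|g x|) ->
    Q.-integrable setT (EFin \o f) /\ P.-integrable setT (EFin \o (fun x => f x * w x)) /\
    \int[Q]_x f x = \int[P]_x (f x * w x).
  move=> mf f0g.
  have f0 x : 0 <= f x by have /andP[] := f0g x.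
  have ifw : P.-integrable setT (EFin \o (fun x => f x * w x)).
    apply: (@le_dominated_integrable _ _ _ P _ (fun x => `|g x * w x|));
      last exact: integrable_norm.
      exact: measurable_funM.
    move=> x /=; rewrite !normrM ler_pM//.
    by have /andP[_] := f0g x; rewrite ger0_norm.
  have mEf : measurable_fun setT (EFin \o f) by exact/measurable_EFinP.
  have E := ge0_integral_density (f := EFin \o f) f0 mEf.
  split; last by split=> //; rewrite /Rintegral E.
  apply/integrableP; split; first exact/measurable_EFinP.
  under eq_integral => x _ do rewrite /= ger0_norm//.
  rewrite E; have /integrableP[_] := ifw; congr (_ < _)%E; apply: eq_integral => x _.
  by rewrite /= ger0_norm ?mulr_ge0.
have max_norm (y : R) : 0 <= Num.max y 0 <= `|y|.
  by rewrite le_max lexx orbT ge_max ler_norm normr_ge0.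
have [] := ge0 (fun x => Num.max (g x) 0).
- exact: measurable_maxr.
- by move=> x; exact: max_norm.
move=> i1 [j1 e1].
have [] := ge0 (fun x => Num.max (- g x) 0).
- by apply: measurable_maxr => //; exact: measurableT_comp.
- by move=> x; rewrite -normrN; exact: max_norm.
move=> i2 [j2 e2].
have gE (y : R) : y = Num.max y 0 - Num.max (- y) 0.
  by rewrite /Order.max; case: ifPn; case: ifPn; rewrite -?leNgt; lra.
have gE' : g = fun x => Num.max (g x) 0 - Num.max (- g x) 0 by apply/funext => x; exact: gE.
split; first by rewrite [in X in EFin \o X]gE'; exact: integrableRB.
transitivity (\int[Q]_x (Num.max (g x) 0 - Num.max (- g x) 0)).
  by apply: eq_Rintegral => x _; exact: gE.
rewrite RintegralB// e1 e2 -RintegralB//.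
by apply: eq_Rintegral => x _; rewrite -mulrBl -gE.
Qed.

End density.

(** * Differentiation in time *)

Section rotation.
Context d (T : measurableType d) (R : realType) (P : probability T R).
Variables (ell : R[i] -> nat -> T -> R) (la : nat -> R).
Hypothesis la_gt0 : forall k, 0 < la k.
Hypothesis ell_gaussian : forall M (c : 'I_M -> R[i]) (k : 'I_M -> nat),
  gaussian_vector P (fun t => \row_i ell (c i) (k i) t) (coord_covariance la c k).
Hypothesis ell_opp : forall c k t, ell (- c) k t = - ell c k t.
Hypothesis ell_rot : forall x c k t,
  ell (cis (- x) * c) k t = cos x * ell c k t - sin x * ell ('i * c) k t.
Variables (m : nat) (phi : 'rV[R]_m -> R) (c : 'I_m -> R[i]) (k : 'I_m -> nat).
Hypothesis phi_smooth : smooth_bounded phi.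
Variable w : T -> R.
Hypothesis w2 : w \in Lfun P 2%:E.

Definition rotated (r : R) (j : 'I_m) : R[i] := cis (- (r * la (k j))) * c j.

(** The rotation has angular speed [la k], and its velocity is the coordinate in
    the orthogonal direction ['i * rotated r j]. *)
Lemma is_derive_rotated (r : R) j t :
  is_derive (r : R^o) 1 (fun r : R^o => ell (rotated r j) (k j) t : R^o)
    (- la (k j) * ell ('i * rotated r j) (k j) t).
Proof.
rewrite /rotated; under eq_fun do rewrite ell_rot.
rewrite mulrCA ell_rot mulrA -expr2 sqrCi mulN1r ell_opp.
apply: is_derive_eq; rewrite /GRing.scale /=; ring.
Qed.

(** Differentiation under the integral; the domination uses that a rotated
    coordinate is bounded by the sum of the two initial ones, uniformly in [r]. *)
Lemma is_derive_rotated_integral (r : R) :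
  is_derive (r : R^o) 1
    (fun r : R^o => \int[P]_t (phi (family ell (rotated r) k t) * w t) : R^o)
    (- \sum_j la (k j) * \int[P]_t (ell ('i * rotated r j) (k j) t *
      (partial j phi (family ell (rotated r) k t) * w t))).
Proof.
have bp j := smooth_bounded_continuous (smooth_bounded_partial j phi_smooth).
have /choice[C CP] : forall j, exists C : R, forall x, `|partial j phi x| <= C.
  by move=> j; have [_] := bp j.
have C0 j : 0 <= C j := le_trans (normr_ge0 _) (CP j 0).
have iw := Lfun2_integrable1 w2.
have ell2 := ell_Lfun2 ell_gaussian.
pose f r t := phi (family ell (rotated r) k t) * w t.
pose f' r t := (\sum_j partial j phi (family ell (rotated r) k t) *
  (- la (k j) * ell ('i * rotated r j) (k j) t)) * w t.
pose G t := \sum_j (C j * la (k j)) *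
  (`|ell ('i * c j) (k j) t * w t| + `|ell (c j) (k j) t * w t|).
have iell b l : P.-integrable setT (EFin \o (fun t => `|ell b l t * w t|)).
  by apply: integrable_norm; exact: Lfun2_integrable.
have iG : P.-integrable setT (EFin \o G).
  have := @integrable_sum _ _ _ P setT measurableT _ (index_enum 'I_m) xpredT
    (fun j => EFin \o (fun t => (C j * la (k j)) *
      (`|ell ('i * c j) (k j) t * w t| + `|ell (c j) (k j) t * w t|))) (fun j _ =>
    integrableRZ (C j * la (k j)) (integrableRD (iell _ _) (iell _ _))).
  by apply: eq_integrable => // t _; rewrite /= sumEFin.
have if_ r0 : P.-integrable setT (EFin \o f r0).
  have [mp [B pB]] := family_bounded_measurable ell_gaussian (rotated r0) k
    (smooth_bounded_continuous phi_smooth).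
  by have := integrable_bounded_mul iw mp pB; apply: eq_integrable => // t _; rewrite /= mulrC.
have df r0 t : is_derive (r0 : R^o) 1 (f^~ t : R^o -> R^o) (f' r0 t).
  have C1phi : C1 phi by apply: smooth_C1; case: phi_smooth.
  have d1 j : is_derive (r0 : R^o) 1 (fun r : R^o => family ell (rotated r) k t 0 j : R^o)
      (- la (k j) * ell ('i * rotated r0 j) (k j) t).
    by under eq_fun do rewrite mxE; exact: is_derive_rotated.
  have d2 := is_derive_curve C1phi d1.
  by apply: is_derive_eq; rewrite /GRing.scale /= /f'; ring.
have f'G r0 t : `|f' r0 t| <= G t.
  rewrite /f' mulr_suml; apply: le_trans (ler_norm_sum _ _ _) _; apply: ler_sum => j _.
  rewrite !normrM normrN (gtr0_norm (la_gt0 _)) -!mulrA.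
  apply: ler_pM => //; first by rewrite !mulr_ge0// ltW.
  rewrite ler_pM2l// -normrM.
  rewrite /rotated mulrCA ell_rot mulrBl; apply: le_trans (ler_normB _ _) _.
  rewrite mulrA -expr2 sqrCi mulN1r ell_opp -!mulrA !normrM normrN.
  apply: lerD; first by rewrite -[leRHS]mul1r ler_wpM2r ?mulr_ge0// ler_norml cos_geN1 cos_le1.
  by rewrite -[leRHS]mul1r ler_wpM2r ?mulr_ge0// ler_norml sin_geN1 sin_le1.
have := is_derive_Rintegral r if_ df iG f'G; congr (is_derive _ _ _ _).
have i1 j : P.-integrable setT (EFin \o (fun t => ell ('i * rotated r j) (k j) t *
    (partial j phi (family ell (rotated r) k t) * w t))).
  have [mp [B pB]] := family_bounded_measurable ell_gaussian (rotated r) k (bp j).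
  apply: Lfun2_integrable => //.
  by under eq_fun do rewrite mulrC; exact: (Lfun2_bounded_mul mp pB).
transitivity (\int[P]_t (\sum_j - la (k j) * (ell ('i * rotated r j) (k j) t *
    (partial j phi (family ell (rotated r) k t) * w t)))).
  by apply: eq_Rintegral => t _; rewrite /f' mulr_suml; apply: eq_bigr => j _; ring.
rewrite Rintegral_sum => [|j]; last exact: integrableRZ.
by rewrite -sumrN; apply: eq_bigr => j _; rewrite RintegralZl// mulNr.
Qed.

End rotation.

(** * Real norm and real inner product of a complex Hilbert space *)

Lemma Re_realM (R : realType) (r : R) (z : R[i]) :
  complex.Re (r%:C * z) = r * complex.Re z.
Proof. by case: z => p q /=; rewrite mul0r subr0. Qed.

Section real_norm.
Context (R : realType) (V : normedModType R[i]).
Implicit Types x y : V.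

Lemma rnormE x : `|x| = (rnorm x)%:C.
Proof. by rewrite /rnorm RRe_real// normr_real. Qed.

Lemma rnorm_ge0 x : 0 <= rnorm x.
Proof. by rewrite -ler0c -rnormE. Qed.

Lemma rnormD x y : rnorm (x + y) <= rnorm x + rnorm y.
Proof. by rewrite -lecR rmorphD /= -!rnormE ler_normD. Qed.

Lemma rnormN x : rnorm (- x) = rnorm x.
Proof. by rewrite /rnorm normrN. Qed.

Lemma rnorm0 : rnorm (0 : V) = 0.
Proof. by rewrite /rnorm normr0. Qed.

Lemma rnorm_eq0 x : rnorm x = 0 -> x = 0.
Proof. by move=> x0; apply/eqP; rewrite -normr_eq0 rnormE x0. Qed.

Lemma rdistrC x y : rnorm (x - y) = rnorm (y - x).
Proof. by rewrite -rnormN opprB. Qed.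

Lemma cvg_rnormP (T : Type) (F : set_system T) {FF : Filter F} (f : T -> V) x :
  f @ F --> x <-> (forall e : R, 0 < e -> \forall t \near F, rnorm (x - f t) < e).
Proof.
split=> [/cvgrPdist_lt h e e0|h].
  have := h e%:C; rewrite ltcR => /(_ e0); apply: filterS => t.
  by rewrite rnormE ltcR.
apply/cvgrPdist_lt => e e0.
have [r re] : exists r : R, e = r%:C.
  by apply/complex_realP; rewrite gtr0_real.
move: e0; rewrite re ltcR => /h; apply: filterS => t.
by rewrite rnormE ltcR.
Qed.

Lemma cvg_rnorm (T : Type) (F : set_system T) {FF : Filter F} (f : T -> V) x :
  f @ F --> x -> rnorm (f t) @[t --> F] --> rnorm x.
Proof.
move=> /cvg_rnormP h; apply/cvgrPdist_lt => e /h; apply: filterS => t.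
apply: le_lt_trans; rewrite ler_norml; apply/andP; split.
  rewrite lerNl opprB lerBlDr -rdistrC.
  by have := rnormD (f t - x) x; rewrite subrK.
by rewrite lerBlDr; have := rnormD (x - f t) (f t); rewrite subrK.
Qed.

End real_norm.

Section real_inner_product.
Context (R : realType) (V : completeNormedModType R[i]) (dot : {dot V for Num.conj}).
Hypothesis hdot : inner_product_of_norm dot.
Implicit Types (x y z : V) (a : R[i]).

Local Notation "<[ x , y ]>" := (real_dot dot x y).

Lemma dotDl x y z : dot (x + y) z = dot x z + dot y z.
Proof. exact: linearDl. Qed.

Lemma dotZl a x z : dot (a *: x) z = a * dot x z.
Proof. exact: linearZl_LR. Qed.

Lemma dotDr x y z : dot z (x + y) = dot z x + dot z y.
Proof. exact: linearDr. Qed.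

Lemma dotC x y : dot x y = conjc (dot y x).
Proof. by rewrite hermC expr0 mul1r. Qed.

Lemma dotZr a x z : dot z (a *: x) = conjc a * dot z x.
Proof. by rewrite dotC dotZl rmorphM /= -dotC. Qed.

Lemma dot_suml I (r : seq I) (P : pred I) (F : I -> V) z :
  dot (\sum_(i <- r | P i) F i) z = \sum_(i <- r | P i) dot (F i) z.
Proof. exact: (big_morph (fun x => dot x z) (fun x y => dotDl x y z) (linear0l dot z)). Qed.

Lemma dot_sumr I (r : seq I) (P : pred I) (F : I -> V) z :
  dot z (\sum_(i <- r | P i) F i) = \sum_(i <- r | P i) dot z (F i).
Proof. exact: (big_morph (fun x => dot z x) (fun x y => dotDr x y z) (linear0r dot z)). Qed.

Lemma real_dotC x y : <[x, y]> = <[y, x]>.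
Proof. by rewrite /real_dot dotC; case: (dot y x). Qed.

(** The real inner product against the complex line through [z] determines the
    complex inner product. *)
Lemma dot_real_ext x y z : (forall a, <[x, a *: z]> = <[y, a *: z]>) ->
  dot x z = dot y z.
Proof.
move=> xy; have := xy 1; have := xy 'i; rewrite /real_dot !scale1r !dotZr.
case: (dot x z) => p q; case: (dot y z) => p' q' /=.
by rewrite !mul0r !mulN1r !sub0r !opprK => -> ->.
Qed.

Lemma real_dotDl x y z : <[x + y, z]> = <[x, z]> + <[y, z]>.
Proof. by rewrite /real_dot dotDl raddfD. Qed.

Lemma real_dotDr x y z : <[z, x + y]> = <[z, x]> + <[z, y]>.
Proof. by rewrite real_dotC real_dotDl !(real_dotC z). Qed.

Lemma real_dotNl x z : <[- x, z]> = - <[x, z]>.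
Proof. by rewrite /real_dot linearNl raddfN. Qed.

Lemma real_dotNr x z : <[z, - x]> = - <[z, x]>.
Proof. by rewrite real_dotC real_dotNl real_dotC. Qed.

Lemma real_dotBl x y z : <[x - y, z]> = <[x, z]> - <[y, z]>.
Proof. by rewrite real_dotDl real_dotNl. Qed.

Lemma real_dotZl (r : R) x z : <[r%:C *: x, z]> = r * <[x, z]>.
Proof. by rewrite /real_dot dotZl Re_realM. Qed.

Lemma real_dotZr (r : R) x z : <[z, r%:C *: x]> = r * <[z, x]>.
Proof. by rewrite real_dotC real_dotZl real_dotC. Qed.

Lemma rnorm_sqr x : rnorm x ^+ 2 = <[x, x]>.
Proof.
by rewrite /real_dot -hdot rnormE -rmorphXn.
Qed.

Lemma real_dot_polarization x y :
  <[x, y]> = (rnorm (x + y) ^+ 2 - rnorm (x - y) ^+ 2) / 4.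
Proof.
rewrite !rnorm_sqr !(real_dotBl, real_dotDl, real_dotDr, real_dotNr) (real_dotC y x).
by field.
Qed.

Lemma real_dot_cauchy_schwarz x y : `|<[x, y]>| <= rnorm x * rnorm y.
Proof.
have y2 : <[y, y]> = rnorm y ^+ 2 by rewrite rnorm_sqr.
have [y0|y0] := eqVneq (rnorm y) 0.
  by rewrite (rnorm_eq0 y0) /real_dot linear0r /= normr0 rnorm0 mulr0.
have ypos : 0 < rnorm y by rewrite lt_neqAle eq_sym y0 rnorm_ge0.
have : 0 <= rnorm (x - (<[x, y]> / <[y, y]>)%:C *: y) ^+ 2 by exact: sqr_ge0.
rewrite rnorm_sqr !(real_dotBl, real_dotDr, real_dotNr, real_dotZl, real_dotZr).
rewrite (real_dotC y x) y2 -[<[x, x]>]rnorm_sqr; set p := <[x, y]>.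
rewrite [leRHS](_ : _ = rnorm x ^+ 2 - p ^+ 2 / rnorm y ^+ 2); last by field.
rewrite subr_ge0 ler_pdivrMr ?exprn_gt0// -exprMn => h.
rewrite -[leRHS]ger0_norm ?mulr_ge0 ?rnorm_ge0//.
by rewrite -ler_sqr ?nnegrE// !real_normK ?num_real.
Qed.

Lemma cvg_real_dot (T : Type) (F : set_system T) {FF : Filter F} (f : T -> V) x y :
  f @ F --> x -> <[f t, y]> @[t --> F] --> <[x, y]>.
Proof.
move=> /cvg_rnormP fx; apply/cvgrPdist_le => e e0.
have y1 : 0 < rnorm y + 1 by rewrite ltr_wpDl ?rnorm_ge0.
have := fx (e / (rnorm y + 1)); rewrite divr_gt0// => /(_ isT).
apply: filterS => t ht; rewrite -real_dotBl.
apply: le_trans (real_dot_cauchy_schwarz _ _) _.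
rewrite (@le_trans _ _ (rnorm (x - f t) * (rnorm y + 1)))//.
  by rewrite ler_wpM2l ?rnorm_ge0// lerDl.
by rewrite -ler_pdivlMr// ltW.
Qed.

Lemma real_dot_continuous y : continuous (fun x => <[x, y]>).
Proof. by move=> x; apply: cvg_real_dot; exact: cvg_id. Qed.

End real_inner_product.

Local Notation normc := Normc.normc.

(** * Orthonormal expansions and functional calculus *)

Section orthonormal_expansion.
Context (R : realType) (H : completeNormedModType R[i]) (dot : {dot H for Num.conj}).
Hypothesis hdot : inner_product_of_norm dot.
Variable e : nat -> H.
Hypothesis he : orthonormal_basis dot e.
Implicit Types (x y : H) (a b c : nat -> R[i]).

Lemma dot_sum_basis a m n k :
  dot (\sum_(m <= j < n) a j *: e j) (e k) = if (m <= k < n)%N then a k else 0.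
Proof.
rewrite dot_suml.
under eq_bigr do rewrite dotZl he.1.
case: ifP => mkn.
  rewrite (bigD1_seq k) ?iota_uniq ?mem_index_iota//= eqxx mulr1 big1 ?addr0// => j jk.
  by rewrite (negbTE jk) mulr0.
rewrite big_nat_cond big1// => j /andP[mjn _].
by case: eqP => [jk|_]; [rewrite jk mkn in mjn|rewrite mulr0].
Qed.

Lemma rnorm_sum_basis a m n :
  rnorm (\sum_(m <= j < n) a j *: e j) ^+ 2 = \sum_(m <= j < n) normc (a j) ^+ 2.
Proof.
rewrite (rnorm_sqr hdot) /real_dot.
rewrite dot_sumr raddf_sum big_nat_cond [RHS]big_nat_cond; apply: eq_bigr => j /andP[mjn _].
rewrite dotZr dot_sum_basis mjn; case: (a j) => p q /=.
rewrite sqr_sqrtr ?addr_ge0 ?sqr_ge0//; ring.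
Qed.

(** Comparison of coefficients; it yields the Cauchy criterion for the functional
    calculus from that of the orthonormal expansion. *)
Lemma ler_rnorm_sum_basis a b (B : R) m n : 0 <= B ->
  (forall k, normc (a k) <= B * normc (b k)) ->
  rnorm (\sum_(m <= j < n) a j *: e j) <= B * rnorm (\sum_(m <= j < n) b j *: e j).
Proof.
move=> B0 ab; rewrite -ler_sqr ?nnegrE ?mulr_ge0 ?rnorm_ge0// exprMn !rnorm_sum_basis.
rewrite mulr_sumr; apply: ler_sum => k _; rewrite -exprMn ler_sqr ?nnegrE//.
  by case: (a k) => p q /=; rewrite sqrtr_ge0.
by apply: mulr_ge0 => //; case: (b k) => p q /=; rewrite sqrtr_ge0.
Qed.

Lemma expansion x : series (fun k => dot x (e k) *: e k) @ \oo --> x.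
Proof. by case: he. Qed.

Lemma coefficients_inj x y : (forall k, dot x (e k) = dot y (e k)) -> x = y.
Proof.
move=> xy; have := @expansion x; have := @expansion y; rewrite (_ : (fun k => dot y (e k) *: e k) = (fun k => dot x (e k) *: e k)).
  by move=> ly lx; exact: (cvg_unique (@norm_hausdorff _ H) lx ly).
by apply/funext => k; rewrite xy.

Qed.

Lemma ler_rnorm_coefficients x y (B : R) : 0 <= B ->
  (forall k, normc (dot x (e k)) <= B * normc (dot y (e k))) ->
  rnorm x <= B * rnorm y.
Proof.
move=> B0 xy.
have lx := cvg_rnorm (@expansion x); have ly := cvg_rnorm (@expansion y).
pose S z := series (fun k => dot z (e k) *: e k).
have l : (B * rnorm (S y n) - rnorm (S x n)) @[n --> \oo] --> B * rnorm y - rnorm x.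
  by apply: cvgB; [apply: cvgM; [exact: cvg_cst|exact: ly]|exact: lx].
rewrite -subr_ge0; apply: (cvgr_to_ge l).
by apply: nearW => n; rewrite subr_ge0; exact: ler_rnorm_sum_basis.
Qed.

Section functional_calculus.
Variables (la : nat -> R) (g : R -> R[i]) (B : R).
Hypothesis B0 : 0 <= B.
Hypothesis gB : forall k, normc (g (la k)) <= B.

Local Notation fc := (functional_calculus dot e la g).

(** The partial sums are Cauchy, being dominated by those of the orthonormal
    expansion of [x]. *)
Lemma functional_calculus_cvg x :
  series (fun k => (g (la k) * dot x (e k)) *: e k) @ \oo --> fc x.
Proof.
apply/cauchy_cvgP/cauchy_seriesP => eps eps0.
have [r re] : exists r : R, eps = r%:C by apply/complex_realP; rewrite gtr0_real.
have B1 : 0 < B + 1 by rewrite ltr_wpDl.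
have r0 : 0 < r / (B + 1) by rewrite divr_gt0// -ltcR -re.
have /cauchy_seriesP/(_ (r / (B + 1))%:C) : cauchy (series (fun k => dot x (e k) *: e k) @ \oo).
  by apply: cvg_cauchy; apply/cvg_ex; exists x; exact: expansion.
rewrite ltcR => /(_ r0); apply: filterS => -[m n] /=.
rewrite !rnormE re !ltcR => h.
apply: (@le_lt_trans _ _ (B * rnorm (\sum_(m <= k < n) dot x (e k) *: e k))).
  apply: ler_rnorm_sum_basis => // k; rewrite Normc.normcM ler_wpM2r//.
  by case: (dot _ _) => p q /=; rewrite sqrtr_ge0.
apply: (@le_lt_trans _ _ ((B + 1) * rnorm (\sum_(m <= k < n) dot x (e k) *: e k))).
  by rewrite ler_wpM2r ?rnorm_ge0// lerDl.
by rewrite mulrC -ltr_pdivlMr.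
Qed.

Lemma dot_functional_calculus x k : dot (fc x) (e k) = g (la k) * dot x (e k).
Proof.
rewrite -dotZl; apply: dot_real_ext => c.
have l1 := cvg_real_dot (y := c *: e k) hdot (@functional_calculus_cvg x).
have E : \forall n \near \oo,
    real_dot dot (series (fun k => (g (la k) * dot x (e k)) *: e k) n) (c *: e k) =
    real_dot dot (g (la k) *: x) (c *: e k).
  exists k.+1 => // n /= kn; rewrite /real_dot !dotZr dotZl /series /=.
  by rewrite (dot_sum_basis (fun k => g (la k) * dot x (e k))) leq0n kn.
exact: (cvg_unique (@norm_hausdorff _ R^o) (l1 _) (cvg_near_cst _ E)).
Qed.

Lemma functional_calculusD x y : fc (x + y) = fc x + fc y.
Proof.
apply: coefficients_inj => k.
by rewrite dotDl !dot_functional_calculus dotDl mulrDr.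
Qed.

Lemma functional_calculusZ (c : R[i]) x : fc (c *: x) = c *: fc x.
Proof.
apply: coefficients_inj => k.
by rewrite dotZl !dot_functional_calculus dotZl mulrCA.
Qed.

Lemma functional_calculusB x y : fc (x - y) = fc x - fc y.
Proof. by rewrite functional_calculusD -scaleN1r functional_calculusZ scaleN1r. Qed.

Lemma functional_calculus_basis k (c : R[i]) : fc (c *: e k) = (g (la k) * c) *: e k.
Proof.
apply: coefficients_inj => j.
rewrite dot_functional_calculus !dotZl he.1; case: eqP => [->|_]; last by rewrite !mulr0.
by rewrite !mulr1.
Qed.

End functional_calculus.
End orthonormal_expansion.


(** * Extension by continuity along a dense embedding *)

Section extension.
Context (R : realType) (H K : completeNormedModType R[i]).
Variable iota : {linear H -> K}.
Hypothesis iota_dense : dense (range iota).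

(** The filter along which [extend] takes its limits. *)
Definition trace_filter (u : K) : set_system H :=
  filter_from (nbhs u) (fun B : set K => iota @^-1` B).

Lemma trace_filter_proper u : ProperFilter (trace_filter u).
Proof.
apply: filter_from_proper; first apply: filter_from_filter.
- by exists setT; exact: filterT.
- move=> A B nA nB; exists (A `&` B); first exact: filterI.
  by [].
- move=> A; rewrite nbhsE =>  -[U [oU Uu] UA].
  have [y [Uy [x _ xy]]] := iota_dense (ex_intro _ u Uu) oU.
  by exists x; apply: UA; rewrite /= xy.
Qed.

#[local] Existing Instance trace_filter_proper.

Lemma iota_cvg u : iota @ trace_filter u --> u.
Proof. by move=> A nA; exists A. Qed.

Lemma extend_continuous_cvg (T : topologicalType) (g : H -> T) (G : K -> T) u :
  {for u, continuous G} -> (forall x, G (iota x) = g x) -> g @ trace_filter u --> G u.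
Proof.
move=> cG Gg; rewrite (_ : g = G \o iota); last by apply/funext => x; rewrite /= Gg.
exact: cvg_comp (@iota_cvg u) cG.
Qed.

Lemma extend_lipschitz_cvg (g : H -> K) (L : R) u : 0 <= L ->
  (forall x y, rnorm (g x - g y) <= L * rnorm (iota x - iota y)) ->
  g @ trace_filter u --> (extend iota g u : K).
Proof.
move=> L0 gL; apply: cauchy_cvg; apply: cauchy_exP => eps eps0.
have [r re] : exists r : R, eps = r%:C by apply/complex_realP; rewrite gtr0_real.
have r0 : 0 < r by rewrite -ltcR -re.
have L1 : 0 < 2 * (L + 1) by rewrite mulr_gt0// ltr_wpDl.
have /cvg_rnormP/(_ (r / (2 * (L + 1)))) := @iota_cvg u.
rewrite divr_gt0// => /(_ isT) h.
have [x0 hx0] := filter_ex h.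
exists (g x0); apply: filterS h => x hx; rewrite /= -ball_normE /= rnormE re ltcR.
apply: le_lt_trans (gL _ _) _.
apply: (@le_lt_trans _ _ (L * (r / (L + 1)))).
  rewrite ler_wpM2l// -(subrK u (iota x0)) -addrA.
  apply: le_trans (rnormD _ _) _; rewrite rdistrC.
  by apply: le_trans (ltW (ltrD hx0 hx)) _; rewrite le_eqVlt; apply/orP; left; apply/eqP; field; rewrite gt_eqF// ltr_wpDl.
rewrite mulrA ltr_pdivrMr ?ltr_wpDl// mulrC ltr_pM2l// ltrDl//.
Qed.

Lemma extend_lipschitz_range (g : H -> K) (L : R) x : 0 <= L ->
  (forall x y, rnorm (g x - g y) <= L * rnorm (iota x - iota y)) ->
  extend iota g (iota x) = g x.
Proof.
move=> L0 gL; apply: cvg_lim; first exact: norm_hausdorff.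
apply/cvg_rnormP => r r0; have L1 : 0 < L + 1 by rewrite ltr_wpDl.
have /cvg_rnormP/(_ (r / (L + 1))) := @iota_cvg (iota x).
rewrite divr_gt0// => /(_ isT); apply: filterS => y hy.
apply: le_lt_trans (gL _ _) _.
apply: (@le_lt_trans _ _ ((L + 1) * rnorm (iota x - iota y))).
  by rewrite ler_wpM2r ?rnorm_ge0// lerDl.
by rewrite mulrC -ltr_pdivlMr.
Qed.

Lemma extend_lipschitz (g : H -> K) (L : R) u v : 0 <= L ->
  (forall x y, rnorm (g x - g y) <= L * rnorm (iota x - iota y)) ->
  rnorm (extend iota g u - extend iota g v) <= L * rnorm (u - v).
Proof.
move=> L0 gL; apply/ler_addgt0Pr => eps eps0.
have L1 : 0 < L + 1 by rewrite ltr_wpDl.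
pose d := eps / (2 * (L + 1)).
have d0 : 0 < d by rewrite divr_gt0// mulr_gt0.
have near_ext w : exists2 x, rnorm (w - iota x) < d & rnorm (extend iota g w - g x) < d.
  have /cvg_rnormP/(_ _ d0) h1 := @iota_cvg w.
  have /cvg_rnormP/(_ _ d0) h2 := @extend_lipschitz_cvg g L w L0 gL.
  by have [x [? ?]] := filter_ex (filterI h1 h2); exists x.
have [x ux gx] := near_ext u; have [y vy gy] := near_ext v.
have e1 : rnorm (extend iota g u - extend iota g v) <= d + L * rnorm (iota x - iota y) + d.
  rewrite [X in rnorm X](_ : _ = (extend iota g u - g x) + (g x - g y) +
    (g y - extend iota g v)); last by rewrite !addrA !subrK.
  apply: le_trans (rnormD _ _) _; apply: lerD; last by rewrite rdistrC ltW.
  by apply: le_trans (rnormD _ _) _; apply: lerD; [exact: ltW|exact: gL].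
have e2 : rnorm (iota x - iota y) <= d + rnorm (u - v) + d.
  rewrite [X in rnorm X](_ : _ = (iota x - u) + (u - v) + (v - iota y)); last first.
    by rewrite !addrA !subrK.
  apply: le_trans (rnormD _ _) _; apply: lerD; last exact: ltW.
  by apply: le_trans (rnormD _ _) _; apply: lerD => //; rewrite rdistrC ltW.
apply: le_trans e1 _.
apply: (@le_trans _ _ (d + L * (d + rnorm (u - v) + d) + d)).
  by rewrite lerD2r lerD2l ler_wpM2l.
rewrite (_ : eps = 2 * (L + 1) * d); last by rewrite /d; field; rewrite gt_eqF.
by rewrite le_eqVlt; apply/orP; left; apply/eqP; ring.
Qed.

End extension.

(** * Coordinates on the space of negative order *)

Section negative_space.
Context (R : realType) (H K : completeNormedModType R[i]).
Variables (dot : {dot H for Num.conj}) (dotK : {dot K for Num.conj}).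
Hypothesis hdot : inner_product_of_norm dot.
Hypothesis hdotK : inner_product_of_norm dotK.
Variables (e : nat -> H) (la : nat -> R) (c0 s : R).
Hypothesis he : orthonormal_basis dot e.
Hypothesis c00 : 0 < c0.
Hypothesis la_ge : forall k, c0 <= la k.
Hypothesis hs : 0 <= s.
Variable iota : {linear H -> K}.
Hypothesis hK : is_negative_space dot e la s iota.
Implicit Types (x y : H) (u v : K) (c : R[i]) (k : nat).

Let la_gt0 k : 0 < la k. Proof. exact: lt_le_trans (la_ge k). Qed.

Lemma powR_spectrum_le (p : R) k : p <= 0 -> la k `^ p <= c0 `^ p.
Proof.
move=> p0; rewrite /powR !gt_eqF// ler_expR.
by rewrite ler_wnM2l// ler_ln ?posrE.
Qed.

Let normc_real (r : R) : 0 <= r -> normc r%:C = r.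
Proof. by move=> r0; rewrite /= expr0n addr0 sqrtr_sqr ger0_norm. Qed.

Let normc_cis (r : R) : normc (cis r) = 1.
Proof. by rewrite /= cos2Dsin2 sqrtr1. Qed.

Lemma op_pow_bounded (p : R) k : p <= 0 -> normc (la k `^ p)%:C <= c0 `^ p.
Proof. by move=> p0; rewrite normc_real ?powR_ge0// powR_spectrum_le. Qed.

Lemma dot_op_pow (p : R) x k : p <= 0 ->
  dot (op_pow dot e la p x) (e k) = (la k `^ p)%:C * dot x (e k).
Proof.
move=> p0; apply: (dot_functional_calculus hdot he (powR_ge0 c0 p)) => j.
exact: op_pow_bounded.
Qed.

Lemma dot_unitary_group t x k :
  dot (unitary_group dot e la t x) (e k) = cis (t * la k) * dot x (e k).
Proof.
apply: (dot_functional_calculus hdot he (g := fun l => cis (t * l)) ler01) => j.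
by rewrite normc_cis.
Qed.

Let half_pow_le0 : - (s / 2) <= 0.
Proof. by rewrite oppr_le0 divr_ge0. Qed.

Lemma rnorm_iota x : rnorm (iota x) = rnorm (op_pow dot e la (- (s / 2)) x).
Proof. by case: hK => _ h; rewrite /rnorm h. Qed.

(** By polarization, [iota] turns the inner product of [K] into that of [H]
    composed with [A^(-s/2)] on both sides; on a basis vector this is
    multiplication by [la k `^ (- s)]. *)
Lemma real_dot_iota x c k :
  real_dot dotK (iota x) (iota (c *: e k)) = la k `^ (- s) * real_dot dot x (c *: e k).
Proof.
pose T := op_pow dot e la (- (s / 2)).
have TB j : normc (la j `^ (- (s / 2)))%:C <= c0 `^ (- (s / 2)) by exact: op_pow_bounded.
have p0 := powR_ge0 c0 (- (s / 2)).
have TE y : real_dot dotK (iota x) (iota y) = real_dot dot (T x) (T y).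
  rewrite !real_dot_polarization// -raddfD -raddfB !rnorm_iota.
  by rewrite /op_pow (functional_calculusD hdot he p0)// (functional_calculusB hdot he p0).
rewrite TE /T {2}/op_pow (functional_calculus_basis hdot he p0)// -scalerA real_dotZr.
rewrite /real_dot !dotZr dot_op_pow// mulrCA Re_realM mulrA.
suff -> : la k `^ (- s) = la k `^ (- (s / 2)) * la k `^ (- (s / 2)) by [].
rewrite [- s](_ : _ = - (s / 2) + - (s / 2)); last by field.
by rewrite powRD // (gt_eqF (la_gt0 k)) implybT.
Qed.

(** By [real_dot_iota], the factor [la k `^ s] makes this inner product extend
    [x |-> Re <x, c *: e k>] continuously to [K]. *)
Definition coord c k u : R := real_dot dotK u ((la k `^ s)%:C *: iota (c *: e k)).

Lemma coordE c k u : coord c k u = real_dot dotK u ((la k `^ s)%:C *: iota (c *: e k)).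
Proof. by []. Qed.

Lemma coord_iota c k x : coord c k (iota x) = real_dot dot x (c *: e k).
Proof.
rewrite /coord real_dotZr real_dot_iota mulrA -powRD ?subrr ?powRr0 ?mul1r//.
by rewrite (gt_eqF (la_gt0 k)) implybT.
Qed.

Lemma continuous_coord c k : continuous (coord c k).
Proof. exact: real_dot_continuous. Qed.

Lemma coordB c k u v : coord c k (u - v) = coord c k u - coord c k v.
Proof. exact: real_dotBl. Qed.

Lemma coord_bound c k : exists2 B : R, 0 <= B & forall u, `|coord c k u| <= B * rnorm u.
Proof.
exists (rnorm ((la k `^ s)%:C *: iota (c *: e k))); first exact: rnorm_ge0.
by move=> u; rewrite mulrC; exact: real_dot_cauchy_schwarz.
Qed.

Lemma coord_mulNi c k u : coord c k (- 'i *: u) = coord ('i * c) k u.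
Proof.
transitivity (real_dot dotK u ('i *: ((la k `^ s)%:C *: iota (c *: e k)))); last first.
  by congr (real_dot dotK u _); rewrite !linearZ /= !scalerA; congr (_ *: _); ring.
rewrite /coord /real_dot dotZl [in RHS]dotZr; congr (complex.Re (_ * _)).
by rewrite -complexiE; apply/eqP; rewrite eq_complex /= oppr0 !eqxx.
Qed.

Lemma iota_dense : dense (range iota).
Proof. by case: hK. Qed.

Lemma ler_rnorm_iota x y (B : R) : 0 <= B ->
  (forall k, normc (dot x (e k)) <= B * normc (dot y (e k))) ->
  rnorm (iota x) <= B * rnorm (iota y).
Proof.
move=> B0 xy; rewrite !rnorm_iota; apply: (ler_rnorm_coefficients hdot he) => // k.
rewrite !dot_op_pow// !Normc.normcM mulrCA ler_wpM2l//.
by rewrite normc_real powR_ge0.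
Qed.

Lemma bracket_coord c k u : bracket dot iota u (c *: e k) = coord c k u.
Proof.
apply: cvg_lim; [exact: (@norm_hausdorff _ R^o)|exact: (trace_filter_proper iota_dense)|].
apply: (@extend_continuous_cvg R H K iota R^o (fun x => real_dot dot x (c *: e k) : R^o) (coord c k)).
  exact: continuous_coord.
exact: coord_iota.
Qed.

Lemma bracket_sum m (r : 'I_m -> R) (c : 'I_m -> R[i]) (k : 'I_m -> nat) u :
  bracket dot iota u (\sum_j (r j)%:C *: (c j *: e (k j))) =
  \sum_j r j * coord (c j) (k j) u.
Proof.
apply: cvg_lim; [exact: (@norm_hausdorff _ R^o)|exact: (trace_filter_proper iota_dense)|].
apply: (@extend_continuous_cvg R H K iota R^o
  (fun x => real_dot dot x (\sum_j (r j)%:C *: (c j *: e (k j))) : R^o)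
  (fun u => \sum_j r j * coord (c j) (k j) u : R^o)).
  apply: cvg_big => [|j _]; first exact: add_continuous.
  apply: cvgM; first exact: cvg_cst.
  exact: continuous_coord.
move=> x; rewrite /real_dot dot_sumr raddf_sum; apply: eq_bigr => j _.
by rewrite coord_iota -real_dotZr.
Qed.

Lemma rnorm_iota_le x : rnorm (iota x) <= c0 `^ (- (s / 2)) * rnorm x.
Proof.
rewrite rnorm_iota; apply: (ler_rnorm_coefficients hdot he) => [|k]; first exact: powR_ge0.
rewrite dot_op_pow// Normc.normcM ler_wpM2r ?op_pow_bounded//.
by case: (dot _ _) => p q /=; rewrite sqrtr_ge0.
Qed.

Lemma iota_expansion x :
  iota (series (fun k => dot x (e k) *: e k) n) @[n --> \oo] --> iota x.
Proof.
apply/cvg_rnormP => r r0; have B0 := powR_gt0 (- (s / 2)) c00.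
have /cvg_rnormP/(_ (r / c0 `^ (- (s / 2)))) := @expansion _ _ _ _ he x.
rewrite divr_gt0// => /(_ isT); apply: filterS => n hn.
rewrite -raddfB; apply: le_lt_trans (rnorm_iota_le _) _.
by rewrite mulrC -ltr_pdivlMr.
Qed.

(** A vector orthogonal to all [iota (c *: e k)] is orthogonal to their linear
    combinations, which are dense. *)
Lemma coord_ext u v : (forall c k, coord c k u = coord c k v) -> u = v.
Proof.
move=> uv; apply/eqP; rewrite -subr_eq0; apply/eqP/rnorm_eq0.
set w := u - v.
have w_basis c k : real_dot dotK w (iota (c *: e k)) = 0.
  have : coord c k w = 0 by rewrite /w coordB uv subrr.
  rewrite /coord real_dotZr => /eqP; rewrite mulf_eq0 gt_eqF ?powR_gt0//=.
  by move/eqP.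
have w_iota x : real_dot dotK w (iota x) = 0.
  have l1 := cvg_real_dot (y := w) hdotK (@iota_expansion x).
  have l2 : cst (0 : R) n @[n --> \oo] --> (0 : R) by exact: cvg_cst.
  rewrite real_dotC; apply: (cvg_unique (@norm_hausdorff _ R^o) (l1 _)).
  rewrite (_ : (fun n => _) = cst 0); first exact: l2.
  apply/funext => n; rewrite /series /= raddf_sum real_dotC /real_dot dot_sumr raddf_sum big1// => k _.
  exact: w_basis.
have l1 := cvg_real_dot (y := w) hdotK (@iota_cvg _ _ _ iota w).
have PF := trace_filter_proper iota_dense w.
rewrite -rnorm_sqr// in l1 *.
have : rnorm w ^+ 2 = 0.
  apply: (cvg_unique (@norm_hausdorff _ R^o) (l1 _)).
  rewrite (_ : (fun x => _) = cst 0); first exact: cvg_cst.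
  by apply/funext => x /=; rewrite real_dotC w_iota.
by move/eqP; rewrite expf_eq0 /= => /eqP.
Qed.

Lemma unitary_group_lipschitz t x y :
  rnorm ((iota \o unitary_group dot e la t) x - (iota \o unitary_group dot e la t) y) <=
  1 * rnorm (iota x - iota y).
Proof.
rewrite /= -!raddfB; apply: ler_rnorm_iota => // k.
rewrite !linearBl /= !dot_unitary_group -mulrBr Normc.normcM normc_cis.
by rewrite mul1r.
Qed.

Local Notation U := (unitary_group_ext dot e la iota).

(** Both sides are continuous in [u] and agree on the range of [iota]. *)
Lemma coord_unitary c k t u : coord c k (U t u) = coord (cis (- (t * la k)) * c) k u.
Proof.
have PF := trace_filter_proper iota_dense u.
have gl := extend_lipschitz_cvg (u := u) iota_dense ler01 (unitary_group_lipschitz t).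
have l1 : coord c k (iota (unitary_group dot e la t x)) @[x --> trace_filter iota u] -->
    coord c k (U t u).
  by apply: (@cvg_comp _ _ _ _ (coord c k) _ _ _ gl); exact: continuous_coord.
apply: (cvg_unique (@norm_hausdorff _ R^o) l1).
apply: (@extend_continuous_cvg R H K iota R^o
  (fun x => coord c k (iota (unitary_group dot e la t x)) : R^o)
  (coord (cis (- (t * la k)) * c) k)); first exact: continuous_coord.
move=> x; rewrite !coord_iota /real_dot !dotZr dot_unitary_group rmorphM /= mulrA.
congr (complex.Re (_ * _)); rewrite mulrC; congr (_ * _).
by rewrite /cis cosN sinN /= opprK.
Qed.

(** Coordinates separate points, and the two rotations are inverse to each other. *)
Lemma unitary_group_extNK t u : U (- t) (U t u) = u.
Proof.
apply: coord_ext => c k; rewrite !coord_unitary mulrA mulNr opprK.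
rewrite (_ : cis _ * cis _ = 1) ?mul1r//.
apply/eqP; rewrite /cis cosN sinN eq_complex /=; apply/andP; split; apply/eqP.
  by rewrite -(cos2Dsin2 (t * la k)); ring.
by ring.
Qed.

Lemma unitary_group_ext_continuous t : continuous (U t).
Proof.
move=> u; apply/cvg_rnormP => r r0.
have /cvg_rnormP/(_ _ r0) := @cvg_id _ (nbhs u); apply: filterS => v.
apply: le_lt_trans; rewrite -[leRHS]mul1r.
exact: (extend_lipschitz iota_dense u v ler01 (unitary_group_lipschitz t)).
Qed.

Lemma op_pow_ext_iota p x : p <= 0 ->
  op_pow_ext dot e la iota p (iota x) = iota (op_pow dot e la p x).
Proof.
move=> p0; apply: (@extend_lipschitz_range _ _ _ iota iota_dense (iota \o op_pow dot e la p) _ x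
  (powR_ge0 c0 p)) => y z.
rewrite /= -!raddfB; apply: ler_rnorm_iota => [|k]; first exact: powR_ge0.
rewrite !linearBl /= !dot_op_pow// -mulrBr Normc.normcM ler_wpM2r ?op_pow_bounded//.
by case: (_ - _) => a b /=; rewrite sqrtr_ge0.
Qed.

End negative_space.

(** * The coordinates as a Gaussian family *)

Section borel_measurable.
Context (R : realType).

Lemma open_borel (T : ptopologicalType) (A : set T) : open A -> measurable (A : set (borel T)).
Proof. by move=> oA; exact: sub_sigma_algebra. Qed.

Lemma continuous_borel (S T : ptopologicalType) (f : S -> T) :
  continuous f -> measurable_fun setT (f : borel S -> borel T).
Proof.
move=> cf; apply: (@measurability _ _ (borel S) (borel T) setT f (@open T)) => //.
move=> _ [B oB <-]; apply: measurableI => //.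
by apply: open_borel; apply: open_comp => // x _; exact: cf.
Qed.

(** The real line carries its own sigma-algebra rather than [borel], so this is
    not an instance of [continuous_borel]. *)
Lemma continuous_borel_real (T : ptopologicalType) (f : T -> R) :
  continuous f -> measurable_fun setT (f : borel T -> R).
Proof.
move=> cf; apply: (measurability _ (RGenOInfty.measurableE R)).
move=> _ [_ [x ->] <-]; apply: measurableI => //.
apply: open_borel; apply: open_comp; last exact: interval_open.
by move=> y _; exact: cf.
Qed.

End borel_measurable.

Section gaussian_coordinates.
Context (R : realType) (H K : completeNormedModType R[i]).
Variables (dot : {dot H for Num.conj}) (dotK : {dot K for Num.conj}).
Hypothesis hdot : inner_product_of_norm dot.
Hypothesis hdotK : inner_product_of_norm dotK.
Variables (e : nat -> H) (la : nat -> R) (c0 s : R).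
Hypothesis he : orthonormal_basis dot e.
Hypothesis c00 : 0 < c0.
Hypothesis la_ge : forall k, c0 <= la k.
Hypothesis hs : 0 <= s.
Variable iota : {linear H -> K}.
Hypothesis hK : is_negative_space dot e la s iota.
Variable nu0 : probability (borel K) R.
Hypothesis hcov : has_covariance dotK nu0 (op_pow_ext dot e la iota (- (s + 1))).

Local Notation coord := (coord dotK e la s iota).

Lemma coord_measurable c k : measurable_fun setT (coord c k : borel K -> R).
Proof. by apply: continuous_borel_real; exact: continuous_coord. Qed.

(** A linear combination of coordinates is the inner product with some [iota y],
    on which the covariance operator acts through [A^(-(s+1))]; of its power of
    [la k], the two factors [la k `^ s] in the coordinates leave [1 / la k]. *)
Lemma coord_gaussian_vector M (c : 'I_M -> R[i]) (k : 'I_M -> nat) :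
  gaussian_vector nu0 (fun u : borel K => \row_i coord (c i) (k i) u)
    (coord_covariance la c k).
Proof.
have la_gt0 j : 0 < la j by exact: lt_le_trans (la_ge j).
split=> [i||xi a].
- under eq_fun do rewrite mxE; exact: coord_measurable.
- apply/matrixP => i j; rewrite !mxE eq_sym; case: eqP => // ->.
  by case: (c i) (c j) => a b [a' b'] /=; congr (_ / _); ring.
pose y := \sum_i ((xi 0 i * la (k i) `^ s)%:C * c i) *: e (k i).
have yE u : real_dot dotK u (iota y) = \sum_i xi 0 i * coord (c i) (k i) u.
  rewrite raddf_sum /real_dot dot_sumr raddf_sum; apply: eq_bigr => i _.
  rewrite coordE -real_dotZr /real_dot; congr (complex.Re (dotK u _)).
  rewrite !linearZ /= !scalerA.
  by rewrite [LHS]linearZ; congr (_ *: _); rewrite /= rmorphM /=; ring.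
have QE : real_dot dotK (iota y) (op_pow_ext dot e la iota (- (s + 1)) (iota y)) =
    (xi *m coord_covariance la c k *m xi^T) 0 0.
  have s1 : - (s + 1) <= 0 by rewrite oppr_le0 addr_ge0.
  rewrite (op_pow_ext_iota hdot he c00 la_ge hs hK)// real_dotC yE.
  rewrite -mulmxA mxE; apply: eq_bigr => i _; congr (_ * _).
  rewrite (coord_iota hdot hdotK he c00 la_ge hs hK) mxE.
  rewrite /real_dot dotZr (dot_op_pow hdot he c00 la_ge)// /y dot_suml mulr_sumr mulr_sumr.
  rewrite raddf_sum; apply: eq_bigr => j _; rewrite !mxE dotZl he.1 (eq_sym (k j)).
  case: eqP => [<-|_]; last by rewrite !mulr0 mul0r.
  rewrite mulr1 [LHS](_ : _ = complex.Re ((la (k i) `^ (- (s + 1)) * (xi 0 j * la (k i) `^ s))%:C * (c j * conjc (c i)))); last first.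
    by congr complex.Re; rewrite rmorphM /=; ring.
  have -> : la (k i) `^ (- (s + 1)) * (xi 0 j * la (k i) `^ s) = xi 0 j / la (k i).
    rewrite mulrCA -powRD; last by rewrite (gt_eqF (la_gt0 _)) implybT.
    by rewrite opprD addrAC addNr add0r powR_inv1 ?ltW.
  by case: (c i) (c j) => a1 b1 [a2 b2] /=; ring.
have := hcov (iota y); rewrite /complex_integral QE => -[Ecos Esin].
have mS : measurable_fun setT (fun u : borel K => \sum_i xi 0 i * coord (c i) (k i) u).
  apply: measurable_sum => i; apply: measurable_funM => //; exact: coord_measurable.
have sE (u : borel K) : \sum_i xi 0 i * (\row_i coord (c i) (k i) u) 0 i = real_dot dotK u (iota y).
  by rewrite yE; apply: eq_bigr => i _; rewrite mxE.
have mD : measurable_fun setT (fun u : borel K => real_dot dotK u (iota y)).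
  by under eq_fun do rewrite yE.
have mc : measurable_fun setT (fun u : borel K => cos (real_dot dotK u (iota y))).
  by apply: measurableT_comp => //; exact: measurable_cos.
have ms : measurable_fun setT (fun u : borel K => sin (real_dot dotK u (iota y))).
  by apply: measurableT_comp => //; exact: measurable_sin.
have ic : nu0.-integrable setT (EFin \o (fun u : borel K => cos (real_dot dotK u (iota y)))).
  by apply: (@bounded_integrable _ _ _ nu0 _ 1 mc) => u; rewrite ler_norml cos_geN1 cos_le1.
have is_ : nu0.-integrable setT (EFin \o (fun u : borel K => sin (real_dot dotK u (iota y)))).
  by apply: (@bounded_integrable _ _ _ nu0 _ 1 ms) => u; rewrite ler_norml sin_geN1 sin_le1.
rewrite -Ecos.
under eq_Rintegral => u _.
  rewrite sE cosD [X in X - _]mulrC [X in _ - X]mulrC.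
  over.
rewrite RintegralB//; [|exact: integrableRZ..].
by rewrite !RintegralZl// Esin mulr0 subr0 mulrC.
Qed.

End gaussian_coordinates.

(** * Transport of measures and the evolution equation *)

Section transport.
Context d1 d2 (X : measurableType d1) (Y : measurableType d2) (R : realType).
Variables (U : X -> Y) (Q : {measure set X -> \bar R}) (Q' : {measure set Y -> \bar R}).
Hypothesis mU : measurable_fun setT U.
Hypothesis Q'E : forall B, measurable B -> Q' B = pushforward Q U B.

Lemma transport_integral (g : Y -> R) : measurable_fun setT g ->
  Q.-integrable setT (EFin \o (fun x => g (U x))) ->
  Q'.-integrable setT (EFin \o g) /\ \int[Q']_y g y = \int[Q]_x g (U x).
Proof.
move=> mg ig; have mEg : measurable_fun setT (EFin \o g) by exact/measurable_EFinP.
have E (f : Y -> \bar R) : measurable_fun setT f ->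
    Q.-integrable setT (f \o U) -> (\int[Q']_y f y = \int[Q]_x f (U x))%E.
  move=> mf if_; rewrite -(integral_pushforward mU mf (D := setT))//.
  by apply: eq_measure_integral => A mA _; exact: Q'E.
split; last by rewrite /Rintegral E.
apply/integrableP; split=> //.
rewrite (E (abse \o (EFin \o g))).
- by have /integrableP[] := ig.
- exact: measurableT_comp.
- exact: integrable_abse ig.
Qed.

End transport.

Section coord_linear.
Context (R : realType) (H K : completeNormedModType R[i]).
Variables (dotK : {dot K for Num.conj}) (e : nat -> H) (la : nat -> R) (s : R).
Variable iota : {linear H -> K}.
Local Notation coord := (coord dotK e la s iota).

Lemma coord_lincomb (a b : R) (c c' : R[i]) k u :
  coord (a%:C * c + b%:C * c') k u = a * coord c k u + b * coord c' k u.
Proof.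
rewrite !coordE -!real_dotZr -real_dotDr; congr (real_dot dotK u _).
have Z (x : R[i]) : iota (x *: e k) = x *: iota (e k) by exact: linearZ.
by rewrite !Z !scalerA -scalerDl; congr (_ *: _); ring.
Qed.

Lemma coord_opp c k u : coord (- c) k u = - coord c k u.
Proof.
transitivity (-1 * coord c k u + 0 * coord c k u); last by ring.
rewrite -coord_lincomb; congr (coord _ k u).
by rewrite rmorphN1 mulN1r mul0r addr0.
Qed.

(** Euler's formula, in the form needed to differentiate a rotating coordinate. *)
Lemma coord_rot x c k u :
  coord (cis (- x) * c) k u = cos x * coord c k u - sin x * coord ('i * c) k u.
Proof.
rewrite -mulNr -coord_lincomb; congr (coord _ k u).
rewrite -complexiE; case: c => a b; apply/eqP; rewrite /cis cosN sinN eq_complex /=.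
by apply/andP; split; apply/eqP; ring.
Qed.

End coord_linear.

Lemma enumerates_basis (R : realType) (H : completeNormedModType R[i]) (f e : nat -> H) :
  enumerates f e -> exists th : nat -> R[i], exists ka : nat -> nat, forall n,
    f n = th n *: e (ka n) /\ 0 < complex.Re (th n * conjc (th n)).
Proof.
move=> [_ rf].
have /choice[p pP] : forall n, exists p : R[i] * nat, f n = p.1 *: e p.2 /\
    0 < complex.Re (p.1 * conjc p.1).
  move=> n; have : range f (f n) by exists n.
  rewrite rf => -[[k _ <-]|[k _ <-]]; [exists (1, k)|exists ('i, k)] => /=.
    by rewrite scale1r; split=> //; rewrite mulr1 subr0 ltr01.
  by split=> //; rewrite -complexiE /=; lra.
by exists (fun n => (p n).1), (fun n => (p n).2).
Qed.

Lemma eigenvalue_ge (R : realType) (H : completeNormedModType R[i])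
    (dot : {dot H for Num.conj}) (DA : set H) (A : H -> H) (c : R) (e : nat -> H) la :
  bounded_below dot DA A c -> orthonormal_basis dot e -> eigenvectors DA A e la ->
  forall k, c <= la k.
Proof.
move=> hAc [he _] hla k; have [Dk Ak] := hla k.
by have := hAc _ Dk; rewrite Ak dotZl he eqxx !mulr1 lecR.
Qed.

Theorem proposition1p16 (R : realType)
  (H : completeNormedModType R[i]) (dot : {dot H for Num.conj})
  (hdot : inner_product_of_norm dot)
  (DA : set H) (A : H -> H)
  (hA : self_adjoint dot DA A) (hAcomp : compact_resolvent DA A)
  (c : R) (hc : 0 < c) (hAc : bounded_below dot DA A c)
  (e : nat -> H) (he : orthonormal_basis dot e)
  (la : nat -> R) (hla : eigenvectors DA A e la)
  (s : R) (hs : 0 <= s)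
  (hsum : (\sum_(0 <= k <oo) (la k `^ (- (s + 1)))%:E < +oo)%E)
  (K : completeNormedModType R[i]) (dotK : {dot K for Num.conj})
  (hdotK : inner_product_of_norm dotK)
  (iota : {linear H -> K}) (hK : is_negative_space dot e la s iota)
  (f : nat -> H) (hf : enumerates f e)
  (nu0 : probability (borel K) R) (hgauss : centred_gaussian dotK nu0)
  (hcov : has_covariance dotK nu0 (op_pow_ext dot e la iota (- (s + 1))))
  (h : K -> R) (gradh : K -> K)
  (hh : malliavin_derivative dot iota f nu0 h gradh)
  (hexp : (fun u : borel K => expR (- h u)) \in Lfun nu0 2%:E)
  (mu0 : probability (borel K) R)
  (hmu0 : forall B : set (borel K), measurable B ->
    mu0 B = ((\int[nu0]_(u in B) expR (- h u)) /
             (\int[nu0]_u expR (- h u)))%:E)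
  (mu : R -> probability (borel K) R)
  (hmu : forall (t : R) (B : set (borel K)), measurable B ->
    mu t B = pushforward mu0
      (unitary_group_ext dot e la iota t : borel K -> borel K) B)
  (v : R -> K -> K)
  (hv : forall t u, v t u =
    - 'i *: unitary_group_ext dot e la iota t
              (gradh (unitary_group_ext dot e la iota (- t) u))) :
  forall (t : R) (m : nat) (phi : 'rV[R]_m -> R), smooth_bounded phi ->
    (mu t).-integrable setT (fun u : borel K =>
      (bracket dot iota (v t u) (cyl_grad dot iota f phi u))%:E) /\
    is_derive (t : R^o) 1
      (fun r : R^o => \int[mu r]_u cyl dot iota f phi u : R^o)
      (\int[mu t]_u bracket dot iota (v t u) (cyl_grad dot iota f phi u)).
Proof.
move=> t m phi phi_smooth.
have la_ge := eigenvalue_ge hAc he hla.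
have la_gt0 k : 0 < la k := lt_le_trans hc (la_ge k).
have [th [ka thP]] := enumerates_basis hf.
have fE n : f n = th n *: e (ka n) by have [] := thP n.
pose ell b l (u : borel K) : R := coord dotK e la s iota b l u.
have ell_gaussian M (b : 'I_M -> R[i]) (l : 'I_M -> nat) :
    gaussian_vector nu0 (fun u => \row_i ell (b i) (l i) u) (coord_covariance la b l).
  exact: (coord_gaussian_vector hdot hdotK he hc la_ge hs hK hcov).
have ell_opp b l u : ell (- b) l u = - ell b l u by exact: coord_opp.
have ell_rot x b l u : ell (cis (- x) * b) l u = cos x * ell b l u - sin x * ell ('i * b) l u.
  exact: coord_rot.
have cylE n (eta : 'rV[R]_n -> R) u : cyl_coord dot iota f n u =
    family ell (fun i : 'I_n => th i) (fun i => ka i) u.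
  apply/rowP => i; rewrite !mxE fE.
  exact: (bracket_coord hdot hdotK he hc la_ge hs hK).
(* The coordinates rotated by time [r] are [family ell (a r) k]; below, [kap j]
   is the coordinate of [gradh] orthogonal to the [j]-th of them at time [t]. *)
pose k (j : 'I_m) := ka j.
pose a r := rotated la (fun j : 'I_m => th j) k r.
have a_pos r j : 0 < complex.Re (a r j * conjc (a r j)).
  have [_] := thP j; rewrite /a /rotated.
  have := cos2Dsin2 (- (r * la (k j))); rewrite /cis.
  set C := cos _; set S := sin _ => CS; case: (th j) => x y /=.
  suff -> : (C * x - S * y) * (C * x - S * y) - (C * y + S * x) * - (C * y + S * x) = 
    (C ^+ 2 + S ^+ 2) * (x * x - y * - y) by rewrite CS mul1r.
  by ring.
pose kap j (u : borel K) : R := ell ('i * a t j) (k j) (gradh u).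
pose U r : borel K -> borel K := unitary_group_ext dot e la iota r.
have mU r : measurable_fun setT (U r).
  by apply: continuous_borel; exact: (unitary_group_ext_continuous hdot he hc la_ge hs hK).
have ell_U b l r u : ell b l (U r u) = ell (cis (- (r * la l)) * b) l u.
  exact: (coord_unitary hdot hdotK he hc la_ge hs hK).
case: (hh) => h2 mgradh gradh2 happrox.
have mkap j : measurable_fun setT (kap j).
  apply: (measurableT_comp (f := ell ('i * a t j) (k j)) (g := gradh : borel K -> borel K)) => //.
  exact: (coord_measurable hdotK).
have /choice[Bj BjP] : forall j : 'I_m, exists Bj : R, 0 <= Bj /\
    forall u, `|ell ('i * a t j) (k j) u| <= Bj * rnorm (u : K).
  by move=> j; have [B0 ? ?] := coord_bound hdotK e la s iota ('i * a t j) (k j); exists B0.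
(* One constant for all the coordinates involved. *)
pose B := 1 + \sum_j Bj j.
have B0 : 0 < B by rewrite ltr_pwDl// sumr_ge0// => j _; case: (BjP j).
have BjB j : Bj j <= B.
  rewrite /B (bigD1 j)//= addrCA lerDl addr_ge0// sumr_ge0// => i _; by case: (BjP i).
have kap2 j : kap j \in Lfun nu0 2%:E.
  apply: (Lfun2_le (mkap j) _ (Lfun2Z (Bj j) gradh2)) => u.
  have [b0 bP] := BjP j; rewrite normrM (ger0_norm b0) (le_trans (bP _))//.
  by rewrite ler_wpM2l// ler_norm.
have approx (eps : R) : 0 < eps -> exists n (b : 'I_n -> R[i]) (l : 'I_n -> nat) (eta : 'rV[R]_n -> R),
  [/\ smooth_bounded eta,
    (Lnorm nu0 2%:E (EFin \o (fun u => h u - eta (family ell b l u))%R) < eps%:E)%E &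
    exists2 q : borel K -> R, (Lnorm nu0 2%:E (EFin \o q) < eps%:E)%E & forall j u,
    `|kap j u - \sum_i partial i eta (family ell b l u) *
        pairing ('i * a t j) (k j) (b i) (l i)| <= B * `|q u|].
  move=> /happrox[n [eta [ceta heta geta]]].
  exists n, (fun i : 'I_n => th i), (fun i => ka i), eta.
  have seta := smooth_compact_bounded ceta.
  split=> //.
    by under eq_fun do rewrite -(cylE _ eta).
  exists (fun u => rnorm (gradh u - iota (cyl_grad dot iota f eta u))) => // j u.
  rewrite (_ : _ - _ = ell ('i * a t j) (k j) (gradh u - iota (cyl_grad dot iota f eta u))).
    have [b0 bP] := BjP j; apply: le_trans (bP _) _.
    by rewrite ger0_norm ?rnorm_ge0// ler_wpM2r ?rnorm_ge0.
  rewrite /ell coordB; congr (_ - _).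
  rewrite (coord_iota hdot hdotK he hc la_ge hs hK) /cyl_grad /real_dot dot_suml raddf_sum.
  apply: eq_bigr => i _. rewrite dotZl [RHS]Re_realM -(cylE _ eta) fE; congr (_ * _).
  rewrite /pairing dotZl dotZr he.1 eq_sym; case: eqP => _; last by rewrite !mulr0.
  rewrite mulr1; case: (th i) ('i * a t j) => x y [x' y'] /=; ring.
have mh : measurable_fun setT (h : borel K -> R) by have /Lfun2P[] := h2.
have parts := exponential_by_parts la_gt0 ell_gaussian phi_smooth (a_pos t) mh kap2 B0 approx hexp.
pose W (u : borel K) := expR (- h u).
pose Z := \int[nu0]_u W u.
have iW : nu0.-integrable setT (EFin \o W) by exact: Lfun2_integrable1 hexp.
have mW : measurable_fun setT W by apply/measurable_EFinP; exact: measurable_int iW.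
(* The total mass of [mu0] is [Z / Z], which would be [0] if [Z] were. *)
have Z0 : 0 < Z.
  rewrite lt_neqAle Rintegral_ge0 ?andbT => [|u _]; last exact: expR_ge0.
  apply/eqP => Z0; have := hmu0 _ measurableT.
  rewrite probability_setT -/W -/Z -Z0 invr0 mulr0 => /eqP.
  by rewrite eqe oner_eq0.
have iWZ : nu0.-integrable setT (EFin \o (fun u => Z^-1 * W u)) by exact: integrableRZ.
have WZ0 u : 0 <= Z^-1 * W u by rewrite mulr_ge0 ?invr_ge0 ?(ltW Z0)// expR_ge0.
have mu0E (E : set (borel K)) : measurable E ->
    mu0 E = (\int[nu0]_(u in E) (Z^-1 * W u)%:E)%E.
  move=> mE; have iWE : nu0.-integrable E (EFin \o W) by exact: integrableS iW.
  rewrite hmu0// -[RHS]fineK; last first.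
    by apply: integrable_fin_num => //; exact: integrableS iWZ.
  by congr (_%:E); rewrite -/(Rintegral _ _ _) RintegralZl// mulrC.
(* Pushing forward by [U r], then using the density [W / Z]. *)
have transport r (g : borel K -> R) (g' : borel K -> R) : measurable_fun setT g ->
    (forall u, g (U r u) = g' u) -> measurable_fun setT g' ->
    nu0.-integrable setT (EFin \o (fun u => g' u * W u)) ->
    (mu r).-integrable setT (EFin \o g) /\
    \int[mu r]_u g u = Z^-1 * \int[nu0]_u (g' u * W u).
  move=> mg gg' mg' ig'.
  have ig'' : nu0.-integrable setT (EFin \o (fun u => g' u * (Z^-1 * W u))).
    by have := integrableRZ Z^-1 ig'; apply: eq_integrable => // u _; rewrite /= mulrCA.
  have [j1 e1] := density_integral iWZ WZ0 mu0E mg' ig''.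
  have j1' : mu0.-integrable setT (EFin \o (fun u => g (U r u))).
    by move: j1; apply: eq_integrable => // u _; rewrite /= gg'.
  have [j2 e2] := transport_integral (mU r) (hmu r) mg j1'.
  split=> //; rewrite e2; under eq_Rintegral do rewrite gg'.
  rewrite e1 -RintegralZl//; apply: eq_Rintegral => u _; rewrite mulrCA //.
have family_U r u : family ell (fun i : 'I_m => th i) k (U r u) = family ell (a r) k u.
  by apply/rowP => j; rewrite !mxE ell_U.
have phiE r : \int[mu r]_u cyl dot iota f phi u =
    Z^-1 * \int[nu0]_u (phi (family ell (a r) k u) * W u).
  have mphi b := family_bounded_measurable ell_gaussian b k
    (smooth_bounded_continuous phi_smooth).
  have [m1 _] := mphi (fun i : 'I_m => th i); have [m2 [C phiC]] := mphi (a r).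
  have [||||_ ->//] := transport r (cyl dot iota f phi) (fun u => phi (family ell (a r) k u)).
  - by apply: eq_measurable_fun m1 => u _; rewrite /cyl (cylE _ phi).
  - by move=> u; rewrite /cyl (cylE _ phi) family_U.
  - exact: m2.
  - have := integrable_bounded_mul iW m2 phiC.
    by apply: eq_integrable => // u _; rewrite /= mulrC.
have bp j := smooth_bounded_continuous (smooth_bounded_partial j phi_smooth).
pose g (u : borel K) := bracket dot iota (v t u) (cyl_grad dot iota f phi u).
pose g' u := \sum_j partial j phi (family ell (a t) k u) * kap j u.
(* Multiplication by [- 'i] and the group are both moved onto the coefficient,
   which becomes ['i * a t j]. *)
have gE u : g u = \sum_j partial j phi (family ell (fun i : 'I_m => th i) k u) *
    kap j (U (- t) u).
  rewrite /g /cyl_grad; under [X in bracket _ _ _ X]eq_bigr do rewrite fE.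
  rewrite (bracket_sum hdot hdotK he hc la_ge hs hK); apply: eq_bigr => j _.
  rewrite -(cylE _ phi); congr (_ * _); rewrite hv coord_mulNi -/(ell _ _ _) ell_U.
  by congr (ell _ _ _); rewrite mulrCA.
have UK u : U (- t) (U t u) = u := unitary_group_extNK hdot hdotK he hc la_ge hs hK t u.
have i_term j : nu0.-integrable setT (EFin \o
    (fun u => kap j u * (partial j phi (family ell (a t) k u) * W u))).
  have [mp [C pC]] := family_bounded_measurable ell_gaussian (a t) k (bp j).
  apply: Lfun2_integrable => //.
  by under eq_fun do rewrite mulrC; exact: (Lfun2_bounded_mul mp pC).
have i_sum : nu0.-integrable setT (EFin \o (fun u => \sum_j
    partial j phi (family ell (a t) k u) * kap j u * W u)).
  have := @integrable_sum _ _ _ nu0 setT measurableT _ (index_enum 'I_m) xpredT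
    (fun j => EFin \o (fun u => kap j u * (partial j phi (family ell (a t) k u) * W u)))
    (fun j _ => i_term j).
  apply: eq_integrable => // u _; rewrite /= sumEFin; congr EFin.
  by apply: eq_bigr => j _; ring.
have [i1 e1] : (mu t).-integrable setT (EFin \o g) /\
    \int[mu t]_u g u = Z^-1 * \int[nu0]_u (g' u * W u).
  apply: transport.
  - rewrite (funext gE); apply: measurable_sum => j; apply: measurable_funM.
      by have [] := family_bounded_measurable ell_gaussian (fun i : 'I_m => th i) k (bp j).
    exact: measurableT_comp.
  - by move=> u; rewrite gE; apply: eq_bigr => j _; rewrite family_U UK.
  - apply: measurable_sum => j; apply: measurable_funM => //.
    by have [] := family_bounded_measurable ell_gaussian (a t) k (bp j).
  - by have := i_sum; apply: eq_integrable => // u _; rewrite /= mulr_suml.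
split; first exact: i1.
rewrite [\int[mu t]_u _]e1.
have -> : (fun r : R^o => \int[mu r]_u cyl dot iota f phi u : R^o) =
    Z^-1 \*: (fun r : R^o => \int[nu0]_u (phi (family ell (a r) k u) * W u) : R^o).
  by apply/funext => r; rewrite phiE.
have D := is_derive_rotated_integral la_gt0 ell_gaussian ell_opp ell_rot
  (fun j : 'I_m => th j) k phi_smooth hexp t.
apply: is_derive_eq; rewrite /GRing.scale /=; congr (_ * _).
rewrite -[RHS]opprK -[X in - - X](_ : \sum_j \int[nu0]_u (kap j u * (partial j phi (family ell (a t) k u) * W u)) = _).
  by rewrite -parts.
rewrite -Rintegral_sum//; apply: eq_Rintegral => u _.
by rewrite /g' mulr_suml; apply: eq_bigr => j _; ring.
Qed.
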